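(* Let $\mathcal{N}_1$ and $\mathcal{N}_2$ be non-degenerate clones-free LFNNs with the same input set $V_{in}$ and the same output set $V_{out}$. Let $\sigma=C+\sum_{s\in S}c_s\tanh(\pi(\cdot-s))$, where $C\in\mathbb{R}$, $S\subset\mathbb{R}$ is a discrete self-avoiding set, and $\{c_s\}_{s\in S}\in\ell^1(S)$ consists of non-zero real numbers. Suppose $\mathcal{N}_1^\sigma(\mathbf{t})=\mathcal{N}_2^\sigma(\mathbf{t})$ for all $\mathbf{t}\in\mathbb{R}^{V_{in}}$. Then $\mathcal{N}_1$ and $\mathcal{N}_2$ are faithfully isomorphic.
   Context: A DAG is a pair $(V,E)$ with $V$ finite, $E\subset V\times V$, without directed cycles. $\mathrm{par}(v)=\{\tilde v:(\tilde v,v)\in E\}$; input nodes are those with empty parent set; the level is $\mathrm{lv}(v)=0$ for input nodes and otherwise $1+\max\{\mathrm{lv}(u):u\in\mathrm{par}(v)\}$. A general feed-forward neural network (GFNN) is $\mathcal{N}=(V,E,V_{in},V_{out},\Omega,\Theta)$ with $(V,E)$ a DAG, $V_{in}$ its set of input nodes, $V_{out}\subset V\setminus V_{in}$, weights $\Omega=\{\omega_{\tilde v v}\in\mathbb{R}\setminus\{0\}:(v,\tilde v)\in E\}$ and biases $\Theta=\{\theta_v\in\mathbb{R}:v\in V\setminus V_{in}\}$. An LFNN (layered network) is a GFNN with $\mathrm{lv}(\tilde v)=\mathrm{lv}(v)+1$ for every edge $(v,\tilde v)$. For $\rho:\mathbb{R}\to\mathbb{R}$, each node $v$ realizes $v^\rho:\mathbb{R}^{V_{in}}\to\mathbb{R}$: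 $v^\rho(\mathbf{t})=t_v$ for $v\in V_{in}$, otherwise $v^\rho(\mathbf{t})=\rho(\sum_{u\in\mathrm{par}(v)}\omega_{vu}u^\rho(\mathbf{t})+\theta_v)$; and $\mathcal{N}^\rho=(w^\rho)_{w\in V_{out}}:\mathbb{R}^{V_{in}}\to\mathbb{R}^{V_{out}}$. Distinct nodes $v_1,v_2$ are clones if $\mathrm{par}(v_1)=\mathrm{par}(v_2)$, $\theta_{v_1}=\theta_{v_2}$ and $\omega_{v_1u}=\omega_{v_2u}$ for all $u\in\mathrm{par}(v_1)$; $\mathcal{N}$ is clones-free if it has no clones. $\mathcal{N}$ is non-degenerate if every node of $V$ is $V_{out}$ itself or has a directed path to some node of $V_{out}$. Two GFNNs $\mathcal{N}^1,\mathcal{N}^2$ with the same input set are extensionally isomorphic if there is a bijection $\pi:V^1\to V^2$ that is the identity on $V_{in}$, satisfies $\pi(V^1_{out})=V^2_{out}$, maps edges to edges ($(v,\tilde v)\in E^1$ iff $(\pi(v),\pi(\tilde v))\in E^2$) with $\omega^2_{\pi(\tilde v)\pi(v)}=\omega^1_{\tilde v v}$, and satisfies $\theta^2_{\pi(v)}=\theta^1_v$ for $v\notin V_{in}$. They are faithfully isomorphic if moreover $V^1_{out}=V^2_{out}$ and $\pi$ is the identity on $V^1_{out}$. A discrete set $S\subset\mathbb{R}$ is self-avoiding if for every finite collection of pairwise distinct pairs $\{(\omega_j,\theta_j)\}_{j=1}^m\subset(2\mathbb{Z}+1)\times\mathbb{R}$ there are $j^*\in\{1,\dots,m\}$ and $t^*\in\frac{S-\theta_{j^*}}{\omega_{j^*}}\setminus\bigcup_{j\neq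 j^*}\frac{S-\theta_j}{\omega_j}$. *)

(* Defs.v *)
From mathcomp Require Import all_boot all_order all_algebra finmap.
From mathcomp Require Import mathcomp_extra boolp classical_sets functions.
From mathcomp Require Import cardinality fsbigop reals ereal topology.
From mathcomp Require Import normedtype numfun esum sequences exp trigo.

Set Implicit Arguments.
Unset Strict Implicit.
Unset Printing Implicit Defensive.

Import Order.TTheory GRing.Theory Num.Theory.
Import numFieldNormedType.Exports.

Local Open Scope fset_scope.
Local Open Scope ring_scope.

(* Nodes are elements of an ambient type [T], so that two networks can share
   input and output nodes.  [weight v u] is the weight of the edge from [u] to
   [v] and is meaningful only on edges; [bias v] is meaningful only when [v] is
   a non-input node.  The set of input nodes is not part of the data: it is
   [Vin] below. *)
Record gfnn_data (R : realType) (T : choiceType) := GFNNData {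
  nodes : {fset T};
  edges : {fset T * T};
  Vout : {fset T};
  weight : T -> T -> R;
  bias : T -> R }.

Section Graph.
Variables (R : realType) (T : choiceType) (N : gfnn_data R T).

Definition edge : rel T := fun u v => (u, v) \in edges N.

Definition par (v : T) : {fset T} := [fset u in nodes N | edge u v].

Definition Vin : {fset T} := [fset v in nodes N | par v == fset0].

Record gfnn_axioms : Prop := GFNNAxioms {
  edges_sub : forall u v, edge u v -> u \in nodes N /\ v \in nodes N;
  acyclic : forall s : seq T, cycle edge s -> s = [::];
  Vout_sub : Vout N `<=` nodes N `\` Vin;
  weight_neq0 : forall u v, edge u v -> weight N v u != 0 }.

(* Recursion along the graph: [dag_rec F] is the unique solution on the nodes
   of [g v = F v g] when [F v g] depends only on [g] at the parents of [v] (see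
   [dag_recE]).  The fuel suffices because a directed path in an acyclic graph
   visits each node at most once. *)
Fixpoint dag_iter (A : Type) (a0 : A) (F : T -> (T -> A) -> A) (n : nat)
    (v : T) : A :=
  if n is m.+1 then F v (dag_iter a0 F m) else a0.

Definition dag_rec (A : Type) (a0 : A) (F : T -> (T -> A) -> A) (v : T) : A :=
  dag_iter a0 F #|` nodes N| v.

Definition level : T -> nat :=
  dag_rec 0%N (fun v lv =>
    if par v == fset0 then 0%N else (\max_(u <- par v) lv u).+1).

(* An input vector is represented by a function on [T], of which only the
   values on [Vin] are used (see [node_map_ext]). *)
Definition node_map (rho : R -> R) (t : T -> R) : T -> R :=
  dag_rec 0 (fun v x =>
    if v \in Vin then t v
    else rho (\sum_(u <- par v) weight N v u * x u + bias N v)).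

Definition clones (v1 v2 : T) : Prop :=
  [/\ v1 \in nodes N `\` Vin, v2 \in nodes N `\` Vin & v1 != v2] /\
  [/\ par v1 = par v2, bias N v1 = bias N v2 &
      forall u, u \in par v1 -> weight N v1 u = weight N v2 u].

Definition clones_free : Prop := forall v1 v2, ~ clones v1 v2.

(* [p] may be empty, in which case [v] itself is an output node. *)
Definition non_degenerate : Prop :=
  forall v, v \in nodes N ->
    exists2 p : seq T, path edge v p & last v p \in Vout N.

Definition layered : Prop :=
  forall u v, edge u v -> level v = (level u).+1.

End Graph.

Record gfnn (R : realType) (T : choiceType) := GFNN {
  gfnn_val :> gfnn_data R T;
  gfnnP : gfnn_axioms gfnn_val }.

Record lfnn (R : realType) (T : choiceType) := LFNN {
  lfnn_val :> gfnn R T;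
  lfnnP : layered lfnn_val }.

Definition extensional_iso (R : realType) (T : choiceType) (N1 N2 : gfnn R T)
    (f : T -> T) : Prop :=
  [/\ set_bij [set` nodes N1] [set` nodes N2] f,
      Vin N1 = Vin N2 /\ {in Vin N1, forall v, f v = v},
      f @` Vout N1 = Vout N2,
      (forall u v, u \in nodes N1 -> v \in nodes N1 ->
         edge N1 u v = edge N2 (f u) (f v)) /\
      (forall u v, edge N1 u v -> weight N2 (f v) (f u) = weight N1 v u) &
      forall v, v \in nodes N1 `\` Vin N1 -> bias N2 (f v) = bias N1 v].

Definition extensionally_isomorphic (R : realType) (T : choiceType)
    (N1 N2 : gfnn R T) : Prop :=
  exists f, extensional_iso N1 N2 f.

Definition faithfully_isomorphic (R : realType) (T : choiceType)
    (N1 N2 : gfnn R T) : Prop :=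
  Vout N1 = Vout N2 /\
  exists2 f, extensional_iso N1 N2 f & {in Vout N1, forall v, f v = v}.

Section Nonlinearity.
Variable R : realType.
Local Open Scope classical_set_scope.

Definition tanh (x : R) : R :=
  (expR x - expR (- x)) / (expR x + expR (- x)).

Definition discrete_subset (S : set R) : Prop := S `<=` isolated S.

(* The collection of pairs is nonempty: for [m = 0] there is no index [j]. *)
Definition self_avoiding (S : set R) : Prop :=
  forall (m : nat) (w : 'I_m -> int) (th : 'I_m -> R),
    (0 < m)%N ->
    (forall j, exists k : int, w j = 2 * k + 1) ->
    injective (fun j => (w j, th j)) ->
    exists (j : 'I_m) (t : R),
      [set (s - th j) / (w j)%:~R | s in S] t /\
      forall i, i != j -> ~ [set (s - th i) / (w i)%:~R | s in S] t.

(* Sum of an absolutely summable real family, as the difference of the sums of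
   its positive and negative parts. *)
Definition rsum (S : set R) (f : R -> R) : R :=
  fine (\esum_(s in S) (EFin \o f)^\+ s)%E
  - fine (\esum_(s in S) (EFin \o f)^\- s)%E.

Definition tanh_series (C : R) (S : set R) (c : R -> R) (x : R) : R :=
  C + rsum S (fun s => c s * tanh (pi * (x - s))).

End Nonlinearity.

Section DagRec.
Variables (R : realType) (T : choiceType) (N : gfnn R T).

Lemma path_uniq (x : T) p : path (edge N) x p -> uniq (x :: p).
Proof.
elim: p x => [//|y p IHp] x xp.
rewrite cons_uniq; apply/andP; split; last by case/andP: xp => _ /IHp.
apply/negP => xin.
have [p1 [p2 e]] : exists p1 p2, y :: p = p1 ++ x :: p2.
  by case/splitPr: xin => p1 p2; exists p1, p2.
have : cycle (edge N) (x :: p1).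
  move: xp; rewrite e cat_path /= => /andP[xp1 /andP[lx _]].
  by rewrite rcons_path xp1.
by move/(acyclic (gfnnP N)).
Qed.

Lemma path_nodes (x : T) p : path (edge N) x p -> last x p \in nodes N ->
  {subset x :: p <= nodes N}.
Proof.
elim: p x => [|y p IHp] x /=.
  by move=> _ xN z; rewrite inE => /eqP ->.
move=> /andP[xy yp] l z; rewrite inE => /predU1P[->|zp].
  by case: (edges_sub (gfnnP N) xy).
exact: (IHp y).
Qed.

Lemma path_size (x : T) p : path (edge N) x p -> last x p \in nodes N ->
  (size p < #|` nodes N|)%N.
Proof.
move=> xp l; have /uniq_leq_size := path_uniq xp.
by move/(_ _ (path_nodes xp l)).
Qed.

Lemma dag_recE (A : Type) (a0 : A) (F : T -> (T -> A) -> A) :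
  (forall v g h, {in par N v, g =1 h} -> F v g = F v h) ->
  forall v, v \in nodes N -> dag_rec N a0 F v = F v (dag_rec N a0 F).
Proof.
move=> Fext.
have stable n k v : (n <= k)%N -> v \in nodes N ->
    (forall u p, path (edge N) u p -> last u p = v -> (size p < n)%N) ->
    dag_iter a0 F n v = dag_iter a0 F k v.
  elim: n k v => [|n IHn] [|k] v // nk vN short.
  - by have := short v [::] isT erefl.
  - apply: Fext => u; rewrite !inE /= => /andP[uN uv].
    apply: IHn => // w p wp lp.
    have := short w (rcons p v).
    by rewrite rcons_path last_rcons size_rcons wp lp; apply.
move=> v vN; rewrite {1}/dag_rec.
rewrite (stable _ #|` nodes N|.+1) // => u p up l.
by apply: path_size up _; rewrite l.
Qed.

Lemma levelE v : v \in nodes N ->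
  level N v = if par N v == fset0 then 0%N
              else (\max_(u <- par N v) level N u).+1.
Proof.
move=> vN; rewrite /level dag_recE // => {vN} w g h gh.
by case: ifP => // _; congr _.+1; rewrite !big_seq; apply: eq_bigr.
Qed.

Lemma node_map_in (rho : R -> R) t v :
  v \in Vin N -> node_map N rho t v = t v.
Proof.
move=> vI; have vN : v \in nodes N by move: vI; rewrite !inE => /andP[].
rewrite /node_map dag_recE ?vI // => w g h gh.
case: ifP => // _; congr (rho (_ + _)).
by rewrite !big_seq; apply: eq_bigr => u /gh ->.
Qed.

Lemma node_mapE (rho : R -> R) t v : v \in nodes N `\` Vin N ->
  node_map N rho t v =
  rho (\sum_(u <- par N v) weight N v u * node_map N rho t u + bias N v).
Proof.
rewrite in_fsetD => /andP[vI vN].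
rewrite {1}/node_map dag_recE ?(negPf vI) // => w g h gh.
case: ifP => // _; congr (rho (_ + _)).
by rewrite !big_seq; apply: eq_bigr => u /gh ->.
Qed.

Lemma node_map_ext (rho : R -> R) t t' : {in Vin N, t =1 t'} ->
  node_map N rho t =1 node_map N rho t'.
Proof.
move=> tt' v; rewrite /node_map /dag_rec.
elim: #|` nodes N| v => [//|n IHn] v /=; case: ifP => [/tt' //|_].
by congr (rho (_ + _)); apply: eq_bigr => u _; rewrite IHn.
Qed.

End DagRec.

(* Main.v *)
(** Feed all inputs along a generic line, [t = d / x]. The arguments of [sigma] at
    the nodes of both networks are then germs at [x = 1] built from [1 / x], the
    constants and [sigma]. The function [sigma] is meromorphic off the closure of
    its poles [s + (k + 1/2) i], [s \in S]. By induction on the level, every finite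
    nonempty family of such germs continues to a common connected domain on which
    its only singularity is a simple pole [z0] of at least one member. For the
    induction step, composing with [sigma] creates infinitely many poles near
    [z0]; among the members that differ by an odd rational factor and a real
    shift, self-avoidance of [S] provides a pole that is not cancelled, and the
    others have asymptotically smaller residues there. Choosing an isolated
    surviving pole closes the induction. In particular no such germ is constant,
    so [1], [1 / x] and the [sigma \o g], for distinct germs [g], are linearly
    independent. Hence the germ at a node determines its bias, its parents and
    their weights; clones-freeness makes the germ determine the node, and
    non-degeneracy propagates the matching from the outputs to all nodes. *)

(* The inputs run along [d / x] rather than [x * d] so that the germs of the lowest nodes,
   [w / x + b], already have the shape that the induction carries: a simple pole at a finite point,
   the origin. The obstacle throughout is that [S] is only discrete, so that its points may
   accumulate on the line. A composite [sigma \o g] then need not be meromorphic even where [g] is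
   analytic. Contour arguments are therefore replaced by absolutely convergent sums of principal
   parts, with Taylor bounds uniform in the pole, and the domain has to be shown connected after the
   preimage of the closure of the poles is removed. Families instead of single germs go through the
   induction because cancellation between the terms of a layer can be studied only near a
   singularity that they share. Equality of germs is allowed between different networks, where it is
   the desired conclusion; inside one network the same induction excludes it. *)
Require Import Defs.
From mathcomp Require Import all_boot all_order all_algebra finmap.
From mathcomp Require Import boolp classical_sets functions.
From mathcomp Require Import cardinality fsbigop reals ereal topology.
From mathcomp Require Import normedtype numfun esum sequences derive realfun exp trigo.
From mathcomp Require Import complex zify ring lra.

Set Implicit Arguments.
Unset Strict Implicit.
Unset Printing Implicit Defensive.

Import Order.TTheory GRing.Theory Num.Theory.
Import numFieldNormedType.Exports.

Local Open Scope complex_scope.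
Local Open Scope ring_scope.
Local Notation Re := complex.Re.
Local Notation Im := complex.Im.

(** * Complex modulus *)

Section Modulus.
Variable R : realType.
Implicit Types (z w : R[i]) (x y : R).

(** The norm of [R[i]] has its values in [R[i]]; a modulus with values in [R] keeps all estimates
    within real arithmetic. *)
Definition cabs z : R := ComplexField.Normc.normc z.

Lemma cabsE z : cabs z = Num.sqrt (Re z ^+ 2 + Im z ^+ 2).
Proof. by case: z. Qed.

Lemma cabs_ge0 z : 0 <= cabs z.
Proof. by rewrite cabsE sqrtr_ge0. Qed.

Lemma cabs0 : cabs 0 = 0. Proof. exact: ComplexField.Normc.normc0. Qed.
Lemma cabs1 : cabs 1 = 1. Proof. exact: ComplexField.Normc.normc1. Qed.

Lemma cabs_eq0 z : (cabs z == 0) = (z == 0).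
Proof.
by apply/eqP/eqP => [/ComplexField.Normc.eq0_normc//|->]; rewrite cabs0.
Qed.

Lemma cabs_gt0 z : (0 < cabs z) = (z != 0).
Proof. by rewrite lt_def cabs_ge0 andbT cabs_eq0. Qed.

Lemma cabsM z w : cabs (z * w) = cabs z * cabs w.
Proof. exact: ComplexField.Normc.normcM. Qed.

Lemma cabsV z : cabs z^-1 = (cabs z)^-1.
Proof. exact: ComplexField.Normc.normcV. Qed.

Lemma cabsN z : cabs (- z) = cabs z.
Proof. exact: normcN. Qed.

Lemma cabsX z n : cabs (z ^+ n) = cabs z ^+ n.
Proof. by elim: n => [|n IH]; rewrite ?expr0 ?cabs1// !exprS cabsM IH. Qed.

Lemma cabsD z w : cabs (z + w) <= cabs z + cabs w.
Proof. exact: le_normcD. Qed.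

Lemma cabsBC z w : cabs (z - w) = cabs (w - z).
Proof. by rewrite -cabsN opprB. Qed.

Lemma cabsB z w : cabs (z - w) <= cabs z + cabs w.
Proof. by rewrite -(cabsN w); exact: cabsD. Qed.

Lemma cabs_dist w z v : cabs (z - v) <= cabs (z - w) + cabs (w - v).
Proof. by apply: le_trans (cabsD _ _); rewrite addrA subrK. Qed.

Lemma cabsD_ge z w : cabs z - cabs w <= cabs (z + w).
Proof.
by rewrite lerBlDr -(cabsN w); apply: le_trans (cabsD _ _); rewrite addrK.
Qed.

Lemma cabsB_ge z w : cabs z - cabs w <= cabs (z - w).
Proof. by rewrite -(cabsN w) cabsD_ge. Qed.

Lemma cabsC x : cabs x%:C = `|x|.
Proof. by rewrite cabsE /= expr0n addr0 sqrtr_sqr. Qed.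

Lemma cabs_nat n : cabs n%:R = n%:R.
Proof.
by have <- := rmorph_nat (real_complex R) n; rewrite cabsC ger0_norm.
Qed.

Lemma Re_le_cabs z : `|Re z| <= cabs z.
Proof.
by rewrite cabsE -sqrtr_sqr ler_sqrt ?addr_ge0 ?sqr_ge0// lerDl sqr_ge0.
Qed.

Lemma Im_le_cabs z : `|Im z| <= cabs z.
Proof.
by rewrite cabsE -sqrtr_sqr ler_sqrt ?addr_ge0 ?sqr_ge0// lerDr sqr_ge0.
Qed.

Lemma cabs_le z : cabs z <= `|Re z| + `|Im z|.
Proof.
rewrite cabsE -[leRHS]ger0_norm ?addr_ge0// -sqrtr_sqr ler_sqrt ?sqr_ge0//.
rewrite sqrrD !real_normK ?num_real// lerD2r lerDl.
by rewrite mulrn_wge0// mulr_ge0.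
Qed.

Lemma cabs_sum (I : Type) (r : seq I) (P : pred I) (F : I -> R[i]) :
  cabs (\sum_(i <- r | P i) F i) <= \sum_(i <- r | P i) cabs (F i).
Proof.
elim/big_ind2 : _ => [|z a w b za wb|//]; first by rewrite cabs0.
by apply: le_trans (cabsD _ _) _; exact: lerD.
Qed.

Lemma ReD z w : Re (z + w) = Re z + Re w. Proof. by case: z; case: w. Qed.
Lemma ImD z w : Im (z + w) = Im z + Im w. Proof. by case: z; case: w. Qed.
Lemma ReN z : Re (- z) = - Re z. Proof. by case: z. Qed.
Lemma ImN z : Im (- z) = - Im z. Proof. by case: z. Qed.
Lemma ReB z w : Re (z - w) = Re z - Re w. Proof. by rewrite ReD ReN. Qed.
Lemma ImB z w : Im (z - w) = Im z - Im w. Proof. by rewrite ImD ImN. Qed.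
Lemma Re_mul z w : Re (z * w) = Re z * Re w - Im z * Im w.
Proof. by case: z; case: w. Qed.
Lemma Im_mul z w : Im (z * w) = Re z * Im w + Im z * Re w.
Proof. by case: z => a b; case: w. Qed.
Lemma Re_scale x z : Re (x%:C * z) = x * Re z.
Proof. by rewrite Re_mul /= mul0r subr0. Qed.
Lemma Im_scale x z : Im (x%:C * z) = x * Im z.
Proof. by rewrite Im_mul /= mul0r addr0. Qed.
Lemma Re_real x : Re x%:C = x. Proof. by []. Qed.
Lemma complex_eq z w : Re z = Re w -> Im z = Im w -> z = w.
Proof. by case: z => a b; case: w => c d /= -> ->. Qed.
Lemma realCD x y : (x + y)%:C = x%:C + y%:C. Proof. exact: rmorphD. Qed.
Lemma realCB x y : (x - y)%:C = x%:C - y%:C. Proof. exact: rmorphB. Qed.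
Lemma realCM x y : (x * y)%:C = x%:C * y%:C. Proof. exact: rmorphM. Qed.
Lemma realCV x : (x^-1)%:C = (x%:C)^-1. Proof. exact: fmorphV. Qed.
Lemma realC_sum (I : Type) (r : seq I) (P : pred I) (F : I -> R) :
  (\sum_(i <- r | P i) F i)%:C = \sum_(i <- r | P i) (F i)%:C.
Proof. exact: rmorph_sum. Qed.
Lemma realC_inj : injective (real_complex R). Proof. by move=> x y []. Qed.

Lemma cabs_lt_eps z : (forall e, 0 < e -> cabs z < e) -> z = 0.
Proof.
move=> H; apply/eqP; rewrite -cabs_eq0; apply/negPn/negP => z0.
have z1 : 0 < cabs z by rewrite lt_def z0 cabs_ge0.
by have := H _ z1; rewrite ltxx.
Qed.

End Modulus.

(** * Unordered sums of complex families *)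

Section UnorderedSums.
Variables (R : realType) (I : choiceType).
Implicit Types (f g : I -> R[i]) (A B : {fset I}).
Local Open Scope fset_scope.
Local Open Scope ring_scope.

(** Convergence along the net of finite subsets: poles are indexed by points of [S], later by points
    of the plane, and neither index set has a natural order. *)
Definition is_sum f (l : R[i]) : Prop := forall e : R, 0 < e ->
  exists A, forall B, A `<=` B -> cabs (\sum_(i <- B) f i - l) < e.

Definition csum f : R[i] := xget 0 [set l | is_sum f l]%classic.

Definition abs_summable f (M : R) : Prop :=
  forall A, \sum_(i <- A) cabs (f i) <= M.

Lemma is_sum_unique f l l' : is_sum f l -> is_sum f l' -> l = l'.
Proof.
move=> H H'; apply/eqP; rewrite -subr_eq0; apply/eqP/cabs_lt_eps => e e0.
have e20 : 0 < e / 2 by lra.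
have [A HA] := H _ e20; have [A' HA'] := H' _ e20.
have h1 := HA (A `|` A') (fsubsetUl _ _).
have h2 := HA' (A `|` A') (fsubsetUr _ _).
rewrite (le_lt_trans (cabs_dist (\sum_(i <- A `|` A') f i) _ _))//.
by rewrite cabsBC; lra.
Qed.

Lemma csumE f l : is_sum f l -> csum f = l.
Proof.
move=> H; rewrite /csum; case: xgetP => [x _ Hx|/(_ l)//].
exact: is_sum_unique Hx H.
Qed.

Lemma is_sumD f g l m : is_sum f l -> is_sum g m ->
  is_sum (fun i => f i + g i) (l + m).
Proof.
move=> Hf Hg e e0; have e20 : 0 < e / 2 by lra.
have [A HA] := Hf _ e20; have [A' HA'] := Hg _ e20.
exists (A `|` A') => B; rewrite fsubUset => /andP[AB A'B].
have h1 := HA _ AB; have h2 := HA' _ A'B.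
rewrite big_split/= opprD addrACA.
by rewrite (le_lt_trans (cabsD _ _))//; lra.
Qed.

Lemma is_sumZ f l (k : R[i]) : is_sum f l -> is_sum (fun i => k * f i) (k * l).
Proof.
move=> Hf e e0.
have k1 : 0 < cabs k + 1 by rewrite ltr_wpDl ?cabs_ge0.
have [A HA] := Hf (e / (cabs k + 1)) (divr_gt0 e0 k1).
exists A => B AB; rewrite -mulr_sumr -mulrBr cabsM.
have := HA _ AB; rewrite ltr_pdivlMr// mulrC mulrDl mul1r => h.
by apply: le_lt_trans h; rewrite lerDl cabs_ge0.
Qed.

Lemma is_sum_eq f g l : f =1 g -> is_sum f l -> is_sum g l.
Proof. by move=> /funext ->. Qed.

Lemma is_sum0 : is_sum (fun=> 0) 0.
Proof. by move=> e e0; exists fset0 => B _; rewrite big1// subrr cabs0. Qed.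

Lemma is_sum_bigfin (J : Type) (r : seq J) (f : J -> I -> R[i]) (l : J -> R[i]) :
  (forall j, is_sum (f j) (l j)) ->
  is_sum (fun i => \sum_(j <- r) f j i) (\sum_(j <- r) l j).
Proof.
move=> H; elim: r => [|j r IH].
  by rewrite big_nil; apply: is_sum_eq is_sum0 => i; rewrite big_nil.
rewrite big_cons; apply: is_sum_eq (is_sumD (H j) IH) => i.
by rewrite big_cons.
Qed.

Lemma is_sum_point f i0 : (forall i, i != i0 -> f i = 0) -> is_sum f (f i0).
Proof.
move=> H e e0; exists [fset i0] => B; rewrite fsub1set => iB.
by rewrite (big_fsetD1 i0)//= big_seq big1 ?addr0 ?subrr ?cabs0// => i;
  rewrite !inE => /andP[/H].
Qed.

Lemma is_sum_bound f l M : is_sum f l -> abs_summable f M -> cabs l <= M.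
Proof.
move=> H HM; rewrite leNgt; apply/negP => Ml.
have [A HA] := H (cabs l - M) ltac:(lra).
have := HA A (fsubset_refl A); have := HM A.
have := cabs_sum A xpredT f; have := cabsD (l - \sum_(i <- A) f i) (\sum_(i <- A) f i).
by rewrite subrK (cabsBC l); lra.
Qed.

Let is_sum_ge0 (f : I -> R) (M : R) : (forall i, 0 <= f i) ->
  (forall A, \sum_(i <- A) f i <= M) -> exists l : R, is_sum (fun i => (f i)%:C) l%:C.
Proof.
move=> f0 HM; pose E := [set x | exists A, x = \sum_(i <- A) f i]%classic.
have hs : has_sup E.
  split; first by exists (\sum_(i <- fset0 : {fset I}) f i); exists fset0.
  by exists M => x [A ->].
exists (sup E) => e e0; have [x [A ->] HA] := sup_adherent e0 hs.
exists A => B AB; rewrite -realC_sum -realCB cabsC.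
have h1 : \sum_(i <- B) f i <= sup E by apply: ub_le_sup; [case: hs|exists B].
have h2 : \sum_(i <- A) f i <= \sum_(i <- B) f i.
  rewrite [leRHS](big_fsetID _ (mem A))/=.
  have -> : [fset x in B | x \in A] = A.
    by apply/fsetP => i; rewrite !inE/= andbC; case: (boolP (i \in A)) => // /(fsubsetP AB) ->.
  by rewrite lerDl sumr_ge0.
by rewrite ler0_norm ?subr_le0//; lra.
Qed.

Let is_sum_real (f : I -> R) (M : R) :
  (forall A, \sum_(i <- A) `|f i| <= M) -> exists l : R, is_sum (fun i => (f i)%:C) l%:C.
Proof.
move=> HM.
have [||p Hp] := @is_sum_ge0 (fun i => (`|f i| + f i) / 2) M.
- by move=> i; have := ler_norm (- f i); rewrite normrN; lra.
- move=> A; apply: le_trans (HM A); apply: ler_sum => i _.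
  by have := ler_norm (f i); lra.
have [||n Hn] := @is_sum_ge0 (fun i => (`|f i| - f i) / 2) M.
- by move=> i; have := ler_norm (f i); lra.
- move=> A; apply: le_trans (HM A); apply: ler_sum => i _.
  by have := ler_norm (- f i); rewrite normrN; lra.
exists (p + - 1 * n); rewrite realCD realCM.
apply: is_sum_eq (is_sumD Hp (is_sumZ (-1)%:C Hn)) => i /=.
by rewrite -realCM -realCD; congr (_ %:C); lra.
Qed.

Lemma abs_summable_ex f M : abs_summable f M -> exists l, is_sum f l.
Proof.
move=> HM.
have [A|l Hl] := @is_sum_real (fun i => Re (f i)) M.
  by apply: le_trans (HM A); apply: ler_sum => i _; exact: Re_le_cabs.
have [A|m Hm] := @is_sum_real (fun i => Im (f i)) M.
  by apply: le_trans (HM A); apply: ler_sum => i _; exact: Im_le_cabs.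
exists (l%:C + 'i%C * m%:C).
by apply: is_sum_eq (is_sumD Hl (is_sumZ 'i%C Hm)) => i; rewrite [RHS]complexE.
Qed.

Lemma csumP f M : abs_summable f M -> is_sum f (csum f).
Proof. by move=> /abs_summable_ex[l H]; rewrite (csumE H). Qed.

Lemma csum_bound f M : abs_summable f M -> cabs (csum f) <= M.
Proof. by move=> H; apply: is_sum_bound (csumP H) H. Qed.

Lemma abs_summable_le f g (M K : R) : 0 <= K ->
  (forall i, cabs (g i) <= K * cabs (f i)) ->
  abs_summable f M -> abs_summable g (K * M).
Proof.
move=> K0 gf fM A; apply: le_trans (_ : K * \sum_(i <- A) cabs (f i) <= _).
  by rewrite mulr_sumr; exact: ler_sum.
by rewrite ler_wpM2l.
Qed.

End UnorderedSums.

(** Only indices with non-zero terms have to correspond. In [local_expansion] this turns a sum over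
    the abscissas of poles into a sum over all points of the plane, most of which carry no
    residue. *)
Lemma is_sum_reindex (R : realType) (I J : choiceType) (h : I -> J)
    (f : I -> R[i]) (g : J -> R[i]) l :
  (forall i i', f i != 0 -> f i' != 0 -> h i = h i' -> i = i') ->
  (forall i, f i != 0 -> g (h i) = f i) ->
  (forall j, g j != 0 -> exists2 i, f i != 0 & h i = j) ->
  is_sum f l -> is_sum g l.
Proof.
move=> hinj gf gex H e e0; have [A HA] := H _ e0.
pose P := [fset i in A | f i != 0]%fset.
have sumP (B : {fset J}) (A' : {fset I}) :
    (forall i, f i != 0 -> (i \in A') = (h i \in B)) ->
    \sum_(j <- B) g j = \sum_(i <- A') f i.
  move=> AB.
  rewrite (bigID (fun i => f i == 0))/= [X in _ = X + _]big1 ?add0r; last first.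
    by move=> i /eqP.
  rewrite (bigID (fun j => g j == 0))/= [X in X + _ = _]big1 ?add0r; last first.
    by move=> i /eqP.
  rewrite -big_filter -[RHS]big_filter.
  have -> : \sum_(i <- [seq i <- A' | f i != 0]) f i
      = \sum_(j <- map h [seq i <- A' | f i != 0]) g j.
    rewrite big_map !big_filter big_seq_cond [RHS]big_seq_cond.
    by apply: eq_bigr => i /andP[_ /gf].
  apply: perm_big; apply: uniq_perm.
  - by rewrite filter_uniq.
  - rewrite map_inj_in_uniq ?filter_uniq// => i i'.
    by rewrite !mem_filter => /andP[fi _] /andP[fi' _]; exact: hinj.
  - move=> j; rewrite mem_filter; apply/andP/mapP => [[gj jB]|[k]].
      have [i fi hi] := gex _ gj; exists i => //.
      by rewrite mem_filter fi/= AB// hi.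
    rewrite mem_filter => /andP[fk kA] ->.
    by rewrite gf// fk -AB.
exists [fset h i | i in P]%fset => B PB.
have [inv Hinv] : exists inv : J -> option I, forall j, g j != 0 ->
    exists2 i, inv j = Some i & f i != 0 /\ h i = j.
  suff : forall j, exists oi : option I, g j != 0 ->
    exists2 i, oi = Some i & f i != 0 /\ h i = j by move=> /choice[inv Hinv]; exists inv.
  move=> j; have [/gex[i fi hi]|_] := boolP (g j != 0); last by exists None.
  by exists (Some i) => _; exists i.
(* The sum over [B] is the sum over the preimage of its support, enlarged by [A]; the indices of [A]
   outside that preimage have zero terms. *)
rewrite (sumP _ (A `|` [fset i in pmap inv [seq j <- B | g j != 0]])%fset).
  by apply: HA; exact: fsubsetUl.
move=> i fi; rewrite !inE/= mem_pmap; apply/orP/idP => [[iA|]|hiB].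
- by apply: (fsubsetP PB); apply/imfsetP; exists i => //=; rewrite !inE/= iA.
- move=> /mapP[j]; rewrite mem_filter => /andP[gj jB].
  by have [k -> [_ hk]] := Hinv _ gj => -[->]; rewrite hk.
- right; apply/mapP; exists (h i); first by rewrite mem_filter gf// fi.
  have [|k -> [fk hk]] := Hinv (h i); first by rewrite gf.
  by congr Some; apply: hinj.
Qed.

(** * Taylor expansions *)

(* [tay f M rho] says that [f] is a convergent power series in the disc of
   radius [1/rho]. The functions [F n] are the successive Taylor remainders
   divided by [h ^+ n], so that no infinite sum occurs in the definition; the
   Taylor coefficients are the values [F n 0]. *)
Section Taylor.
Variable R : realType.
Local Notation C := R[i].
Implicit Types (f g : C -> C) (F G : nat -> C -> C) (M N rho : R) (h k : C).

Lemma le_of_eq (x y : R) : x = y -> x <= y. Proof. by move->. Qed.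

Definition taylor_seq F M rho : Prop := 0 < rho /\
  forall n h, rho * cabs h < 1 ->
    F n h = F n 0 + h * F n.+1 h /\ cabs (F n h) <= M * rho ^+ n.

Definition tay f M rho : Prop :=
  exists2 F, taylor_seq F M rho & forall h, rho * cabs h < 1 -> F 0 h = f h.

Lemma tay_gt0 f M rho : tay f M rho -> 0 < rho.
Proof. by case=> F []. Qed.

Lemma disc0 rho : rho * cabs (0 : C) < 1.
Proof. by rewrite cabs0 mulr0 ltr01. Qed.
Hint Resolve disc0 : core.

Lemma tay_bound f M rho h : tay f M rho -> rho * cabs h < 1 -> cabs (f h) <= M.
Proof.
by move=> [F [r0 H] Ff] hr; have [_] := H 0%N h hr; rewrite Ff// expr0 mulr1.
Qed.

Lemma tay_ge0 f M rho : tay f M rho -> 0 <= M.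
Proof. by move=> /tay_bound/(_ (disc0 rho)); apply: le_trans (cabs_ge0 _). Qed.

Lemma tay_ext f g M rho : tay f M rho ->
  (forall h, rho * cabs h < 1 -> f h = g h) -> tay g M rho.
Proof. by move=> [F HF Ff] fg; exists F => // h hr; rewrite Ff ?fg. Qed.

Lemma tay_weaken f M rho M' rho' : tay f M rho -> M <= M' -> rho <= rho' ->
  tay f M' rho'.
Proof.
move=> tf MM rr; have M0 := tay_ge0 tf; have [F [r0 H] Ff] := tf.
have sub h : rho' * cabs h < 1 -> rho * cabs h < 1.
  by apply: le_lt_trans; rewrite ler_wpM2r ?cabs_ge0.
exists F => [|h /sub/Ff//]; split; first exact: lt_le_trans rr.
move=> n h /sub/(H n)[-> b]; split=> //.
apply: le_trans b _; apply: ler_pM => //; first by rewrite exprn_ge0// ltW.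
by rewrite lerXn2r// nnegrE ltW//; apply: lt_le_trans rr.
Qed.

Lemma tay_cst (a : C) rho : 0 < rho -> tay (fun=> a) (cabs a) rho.
Proof.
move=> r0; exists (fun n _ => if n is 0%N then a else 0) => //; split=> // -[|n] h _.
  by rewrite mulr0 addr0 expr0 mulr1.
by rewrite mulr0 addr0 cabs0 mulr_ge0 ?cabs_ge0// exprn_ge0// ltW.
Qed.

Lemma tay_id rho : 0 < rho -> tay id rho^-1 rho.
Proof.
move=> r0; exists (fun n h => match n with 0%N => h | 1%N => 1 | _ => 0 end) => //.
split=> // -[|[|n]] h hr.
- by rewrite mulr1 add0r expr0 mulr1 -(ler_pM2l r0) divff ?gt_eqF// ltW.
- by rewrite mulr0 addr0 cabs1 expr1 mulVf ?gt_eqF.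
- by rewrite mulr0 addr0 cabs0 mulr_ge0 ?invr_ge0 ?exprn_ge0// ltW.
Qed.

Lemma tayD f g M N rho : tay f M rho -> tay g N rho ->
  tay (fun h => f h + g h) (M + N) rho.
Proof.
move=> [F [r0 HF] Ff] [G [_ HG] Gg].
exists (fun n h => F n h + G n h) => [|h hr]; last by rewrite Ff ?Gg.
split=> // n h hr; have [F1 F2] := HF n h hr; have [G1 G2] := HG n h hr.
split; first by rewrite F1 G1; ring.
by apply: le_trans (cabsD _ _) _; rewrite mulrDl lerD.
Qed.

Lemma tayZ f M rho (a : C) : tay f M rho -> tay (fun h => a * f h) (cabs a * M) rho.
Proof.
move=> [F [r0 HF] Ff].
exists (fun n h => a * F n h) => [|h hr]; last by rewrite Ff.
split=> // n h hr; have [F1 F2] := HF n h hr; split; first by rewrite F1; ring.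
by rewrite cabsM -mulrA ler_wpM2l ?cabs_ge0.
Qed.

Lemma tay_dil f M rho (a : C) : a != 0 -> tay f M rho ->
  tay (fun h => f (a * h)) M (rho * cabs a).
Proof.
move=> a0 [F [r0 HF] Ff].
exists (fun n h => a ^+ n * F n (a * h)) => [|h hr]; last first.
  by rewrite expr0 mul1r Ff// cabsM mulrA.
split=> [|n h hr]; first by rewrite mulr_gt0// cabs_gt0.
have [F1 F2] := HF n (a * h) ltac:(by rewrite cabsM mulrA).
split; first by rewrite F1 mulr0 exprS; ring.
rewrite cabsM cabsX exprMn mulrC mulrA ler_wpM2r//.
by rewrite exprn_ge0 ?cabs_ge0.
Qed.

(** The remainders of a product are read off from the expansion of [f] truncated at order [n]. As
    [g] has the rate [2 * rho], the terms of the resulting bound decay like [2^-1 ^+ i], and the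
    product keeps the rate of [g]. *)
Lemma tayM f g M N rho : tay f M rho -> tay g N (2 * rho) ->
  tay (fun h => f h * g h) (2 * M * N) (2 * rho).
Proof.
move=> tf tg; have M0 := tay_ge0 tf; have N0 := tay_ge0 tg.
move: tf tg => [F [r0 HF] Ff] [G [r1 HG] Gg].
have sub h : 2 * rho * cabs h < 1 -> rho * cabs h < 1.
  apply: le_lt_trans; rewrite ler_wpM2r ?cabs_ge0//; lra.
exists (fun n h => F n h * G 0 h + \sum_(i < n) F i 0 * G (n - i)%N h);
  last by move=> h hr; rewrite big_ord0 addr0 Ff ?sub// Gg.
split=> // n h hr.
have [F1 F2] := HF n h (sub _ hr); split.
  rewrite big_ord_recr/= subSnn.
  have Fh : h * F n.+1 h = F n h - F n 0 by rewrite [F n h]F1 addrC addKr.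
  have Gh m : h * G m.+1 h = G m h - G m 0.
    by have [{2}-> _] := HG m h hr; rewrite addrC addKr.
  rewrite !mulrDr [h * (F n.+1 h * _)]mulrA Fh.
  rewrite [h * (F n 0 * _)]mulrCA Gh.
  have -> : h * (\sum_(i < n) F i 0 * G (n.+1 - i)%N h) =
      \sum_(i < n) F i 0 * G (n - i)%N h - \sum_(i < n) F i 0 * G (n - i)%N 0.
    rewrite mulr_sumr -sumrB; apply: eq_bigr => i _.
    by rewrite mulrCA subSn 1?ltnW// Gh mulrBr.
  by ring.
have bG m : cabs (G m h) <= N * (2 * rho) ^+ m by have [] := HG m h hr.
have bF m : cabs (F m 0) <= M * rho ^+ m by have [] := HF m 0 (disc0 _).
have q i : (i <= n)%N -> rho ^+ i * (2 * rho) ^+ (n - i) = (2 * rho) ^+ n * 2^-1 ^+ i.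
  move=> le_in; have e : rho = 2 * rho * 2^-1 by field.
  by rewrite {1}e exprMn mulrAC -exprD subnKC.
have qs : 2^-1 ^+ n + \sum_(i < n) 2^-1 ^+ i <= 2 :> R.
  have -> : 2^-1 ^+ n + \sum_(i < n) 2^-1 ^+ i = 2 - 2^-1 ^+ n :> R.
    elim: (n) => [|m IH]; first by rewrite big_ord0 expr0; lra.
    by rewrite big_ord_recr/= exprS; move: IH; lra.
  by rewrite gerBl exprn_ge0.
apply: le_trans (cabsD _ _) _.
apply: le_trans (_ : M * N * (2 * rho) ^+ n *
    (2^-1 ^+ n + \sum_(i < n) 2^-1 ^+ i) <= _); last first.
  have K0 : 0 <= M * N * (2 * rho) ^+ n by rewrite !mulr_ge0 ?exprn_ge0// ltW.
  by apply: le_trans (ler_wpM2l K0 qs) _; apply: le_of_eq; ring.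
rewrite mulrDr; apply: lerD.
  rewrite cabsM; apply: le_trans (ler_pM (cabs_ge0 _) (cabs_ge0 _) F2 (bG 0%N)) _.
  by rewrite -[_ * 2^-1 ^+ n]mulrA -q// subnn !expr0 !mulr1; apply: le_of_eq; ring.
apply: le_trans (cabs_sum _ _ _) _; rewrite mulr_sumr; apply: ler_sum => i _.
rewrite cabsM; apply: le_trans (ler_pM (cabs_ge0 _) (cabs_ge0 _) (bF i) (bG (n - i)%N)) _.
by rewrite -[_ * 2^-1 ^+ i]mulrA -q ?(ltnW (ltn_ord i))//; apply: le_of_eq; ring.
Qed.

Lemma tay_shift f M rho : tay f M rho ->
  exists2 g, tay g (M * rho) rho & forall h, rho * cabs h < 1 -> f h = f 0 + h * g h.
Proof.
move=> [F [r0 HF] Ff]; exists (F 1%N).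
  exists (fun n => F n.+1) => //; split=> // n h hr.
  by have [-> b] := HF n.+1 h hr; split => //; rewrite -mulrA -exprS.
by move=> h hr; have [e _] := HF 0%N h hr; rewrite -Ff// e Ff.
Qed.

(** Since [M] and [rho] do not depend on [i], all remainders may be summed term by term. Indices
    with [c i = 0] are exempt, which matters for abscissas outside [S]. *)
Lemma tay_csum (I : choiceType) (f : I -> C -> C) (c : I -> C) M rho K :
  0 < rho -> 0 <= M ->
  (forall i, c i != 0 -> tay (f i) M rho) -> abs_summable c K ->
  tay (fun h => csum (fun i => c i * f i h)) (M * K) rho /\
  forall h, rho * cabs h < 1 ->
    is_sum (fun i => c i * f i h) (csum (fun i => c i * f i h)).
Proof.
move=> r0 M0 tf cK.
have /choice[F HF] : forall i, exists F : nat -> C -> C, c i != 0 ->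
    taylor_seq F M rho /\ (forall h, rho * cabs h < 1 -> F 0 h = f i h).
  move=> i; have [ci|] := boolP (c i != 0); last by exists (fun _ _ => 0).
  by have [F ? ?] := tf i ci; exists F.
have sm n h : rho * cabs h < 1 -> abs_summable (fun i => c i * F i n h) (M * rho ^+ n * K).
  move=> hr; apply: abs_summable_le cK => [|i].
    by rewrite mulr_ge0// exprn_ge0// ltW.
  rewrite cabsM mulrC; have [ci|/negPn/eqP->] := boolP (c i != 0); last first.
    by rewrite cabs0 !mulr0.
  rewrite ler_wpM2r ?cabs_ge0//.
  by have [[_ /(_ n h hr)[]]] := HF i ci.
have e0 h : rho * cabs h < 1 -> (fun i => c i * f i h) = (fun i => c i * F i 0 h).
  move=> hr; apply/funext => i; have [ci|/negPn/eqP->] := boolP (c i != 0); last by rewrite !mul0r.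
  by have [_ ->] := HF i ci.
split; last by move=> h hr; rewrite e0//; exact: csumP (sm _ _ hr).
exists (fun n h => csum (fun i => c i * F i n h)); last by move=> h hr; rewrite e0.
split=> // n h hr; split; last by rewrite mulrAC; exact: csum_bound (sm _ _ hr).
have s0 := csumP (sm n 0 (disc0 _)); have s1 := csumP (sm n.+1 h hr).
apply: csumE; apply: is_sum_eq (is_sumD s0 (is_sumZ h s1)) => i /=.
have [ci|/negPn/eqP->] := boolP (c i != 0); last by ring.
by have [[_ /(_ n h hr)[-> _]] _] := HF i ci; ring.
Qed.

Lemma geom_small (K e : R) : 0 < e -> exists m, K * 2^-1 ^+ m <= e.
Proof.
move=> e0; have [m Km] : exists m, K / e <= m%:R.
  exists (Num.bound (`|K / e|)).
  by apply: le_trans (ler_norm _) _; rewrite ltW// archi_boundP.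
exists m; rewrite exprVn ler_pdivrMr ?exprn_gt0// mulrC -ler_pdivrMr//.
by apply: le_trans Km _; rewrite -natrX ler_nat ltnW// ltn_expl.
Qed.

(** Iterate [F n h - F n k = (h - k) * F n.+1 h + k * (F n.+1 h - F n.+1 k)]; each round halves the
    bound on the last term because [rho * cabs k <= 2^-1]. *)
Lemma taylor_seq_lip F M rho n h k : taylor_seq F M rho ->
  rho * cabs h <= 2^-1 -> rho * cabs k <= 2^-1 ->
  cabs (F n h - F n k) <= 2 * M * rho ^+ n.+1 * cabs (h - k).
Proof.
move=> [r0 HF] h2 k2.
have hr : rho * cabs h < 1 by lra.
have kr : rho * cabs k < 1 by lra.
have M0 : 0 <= M.
  by have [_] := HF 0%N 0 (disc0 _); rewrite expr0 mulr1; apply: le_trans (cabs_ge0 _).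
have main m : forall n, cabs (F n h - F n k) <=
    2 * M * rho ^+ n.+1 * cabs (h - k) + 2 * M * rho ^+ n * 2^-1 ^+ m.
  elim: m => [|m IH] {}n.
    have [_ b1] := HF n h hr; have [_ b2] := HF n k kr.
    apply: le_trans (cabsB _ _) _; rewrite expr0 mulr1.
    have : 0 <= 2 * M * rho ^+ n.+1 * cabs (h - k).
      by rewrite !mulr_ge0 ?exprn_ge0 ?cabs_ge0// ltW.
    by lra.
  have [e1 _] := HF n h hr; have [e2 _] := HF n k kr.
  have -> : F n h - F n k = (h - k) * F n.+1 h + k * (F n.+1 h - F n.+1 k).
    by rewrite e1 e2; ring.
  apply: le_trans (cabsD _ _) _; rewrite !cabsM.
  have [_ b] := HF n.+1 h hr.
  have b' := IH n.+1.
  have c0 := cabs_ge0 (h - k).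
  apply: le_trans (lerD (ler_wpM2l c0 b) (ler_wpM2l (cabs_ge0 k) b')) _.
  have Q0 : 0 <= 2 * M * rho ^+ n.+1 * cabs (h - k) + 2 * M * rho ^+ n * 2^-1 ^+ m.
    by rewrite addr_ge0 ?mulr_ge0 ?exprn_ge0// ltW.
  have := ler_wpM2r Q0 k2; rewrite !exprS; set t := rho ^+ n; set u := 2^-1 ^+ m.
  by set d := cabs (h - k); set x := cabs k; lra.
apply/ler_addgt0Pr => e e0.
have [m Hm] := geom_small (2 * M * rho ^+ n) e0.
by apply: le_trans (main m n) _; rewrite lerD2l.
Qed.

Lemma tay_lip f M rho h k : tay f M rho ->
  rho * cabs h <= 2^-1 -> rho * cabs k <= 2^-1 ->
  cabs (f h - f k) <= 2 * M * rho * cabs (h - k).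
Proof.
move=> [F HF Ff] h2 k2; have := taylor_seq_lip 0%N HF h2 k2.
by rewrite expr1 !Ff; lra.
Qed.

Lemma geom_fset_le (A : {fset nat}) : \sum_(i <- A) 2^-1 ^+ i <= 2 :> R.
Proof.
have [n An] : exists n, forall i, i \in A -> (i < n)%N.
  exists (\max_(i <- A) i).+1 => i iA; rewrite ltnS.
  by rewrite (big_rem i)//= leq_max leqnn.
apply: le_trans (_ : \sum_(0 <= i < n) 2^-1 ^+ i <= _).
  rewrite [leRHS](bigID (fun i => i \in A))/= -[X in X <= _]addr0 lerD//; last first.
    by apply: sumr_ge0 => i _; rewrite exprn_ge0.
  rewrite -[X in _ <= X]big_filter (perm_big [seq i <- index_iota 0 n | i \in A])//=.
  apply: uniq_perm; [exact: fset_uniq|by rewrite filter_uniq// iota_uniq|move=> i].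
  rewrite mem_filter mem_index_iota/= andbC.
  by case: (boolP (i \in A)) => [/An ->|]; rewrite ?andbF.
have -> : \sum_(0 <= i < n) 2^-1 ^+ i = 2 - 2 * 2^-1 ^+ n :> R.
  elim: (n) => [|m IH]; first by rewrite big_nil expr0; lra.
  by rewrite big_nat_recr//= exprS; move: IH; lra.
by rewrite gerBl mulr_ge0// exprn_ge0.
Qed.

Lemma abs_summable_geom (a : nat -> C) M :
  (forall n, cabs (a n) <= M * 2^-1 ^+ n) -> abs_summable a (M * 2).
Proof.
move=> H A; have M0 : 0 <= M.
  by have := H 0%N; rewrite expr0 mulr1; apply: le_trans (cabs_ge0 _).
apply: le_trans (_ : M * \sum_(i <- A) 2^-1 ^+ i <= _).
  by rewrite mulr_sumr; apply: ler_sum => i _.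
by rewrite ler_wpM2l// geom_fset_le.
Qed.

Lemma is_sum_partial (a : nat -> C) l : is_sum a l -> forall e, 0 < e ->
  exists m : nat, forall n, (m <= n)%N -> cabs (\sum_(i < n) a i - l) < e.
Proof.
move=> H e /H[A HA].
have [n An] : exists n, forall i, i \in A -> (i < n)%N.
  exists (\max_(i <- A) i).+1 => i iA; rewrite ltnS.
  by rewrite (big_rem i)//= leq_max leqnn.
exists n => m nm.
have := HA [fset i in iota 0 m]%fset.
have -> : \sum_(i <- [fset i in iota 0 m]%fset) a i = \sum_(i < m) a i.
  rewrite -(big_mkord xpredT); apply: perm_big; apply: uniq_perm => //.
    exact: iota_uniq.
  by move=> i; rewrite !inE /index_iota subn0.
apply; apply/fsubsetP => i /An im; rewrite !inE mem_iota/= add0n.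
exact: leq_trans im nm.
Qed.

Lemma taylor_partial F M rho n h : taylor_seq F M rho -> rho * cabs h < 1 ->
  F 0 h = \sum_(i < n) F i 0 * h ^+ i + h ^+ n * F n h.
Proof.
move=> [r0 HF] hr; elim: n => [|n ->]; first by rewrite big_ord0 expr0 mul1r add0r.
by have [-> _] := HF n h hr; rewrite big_ord_recr/= exprS; ring.
Qed.

Lemma taylor_is_sum F M rho h : taylor_seq F M rho -> rho * cabs h <= 2^-1 ->
  is_sum (fun n => F n 0 * h ^+ n) (F 0 h).
Proof.
move=> HF h2; have [r0 HF'] := HF.
have hr : rho * cabs h < 1 by lra.
have M0 : 0 <= M.
  by have [_] := HF' 0%N 0 (disc0 _); rewrite expr0 mulr1; apply: le_trans (cabs_ge0 _).
have pw n : M * rho ^+ n * cabs h ^+ n <= M * 2^-1 ^+ n.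
  rewrite -mulrA -exprMn ler_wpM2l// lerXn2r// nnegrE ?mulr_ge0 ?cabs_ge0//.
  exact: ltW.
have b n : cabs (F n 0 * h ^+ n) <= M * 2^-1 ^+ n.
  rewrite cabsM cabsX; apply: le_trans (pw n); rewrite ler_wpM2r ?exprn_ge0 ?cabs_ge0//.
  by have [_] := HF' n 0 (disc0 _).
have Hs := csumP (abs_summable_geom b).
suff -> : F 0 h = csum (fun n => F n 0 * h ^+ n) by [].
apply/eqP; rewrite -subr_eq0; apply/eqP/cabs_lt_eps => e e0.
have e2 : 0 < e / 2 by lra.
have e4 : 0 < e / 4 by lra.
have [N HN] := is_sum_partial Hs e2.
have [m Hm] := geom_small M e4.
have := HN (N + m)%N (leq_addr _ _); set X := csum _; set Y := \sum_(i < _) _ => HX.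
rewrite (le_lt_trans (cabs_dist Y _ _))//.
have -> : F 0 h - Y = h ^+ (N + m) * F (N + m)%N h.
  by rewrite (taylor_partial (N + m) HF hr) addrC addKr.
have : cabs (h ^+ (N + m) * F (N + m)%N h) <= e / 4.
  rewrite cabsM cabsX; have [_ bF] := HF' (N + m)%N h hr.
  apply: le_trans Hm; apply: le_trans (_ : M * 2^-1 ^+ (N + m) <= _).
    apply: le_trans (pw _); rewrite mulrC ler_wpM2r// exprn_ge0 ?cabs_ge0//.
  rewrite ler_wpM2l// exprD ler_piMl ?exprn_ge0// exprn_ile1//; lra.
by lra.
Qed.

(* The Taylor coefficients of the divided difference at [k] are the values
   [F n.+1 k], and its remainders are the divided differences of the [F n]. *)
Lemma tay_divdiff f M rho k : tay f M rho -> rho * cabs k <= 2^-1 ->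
  exists2 Q, tay Q (2 * M * rho) (2 * rho) &
    forall h, 2 * rho * cabs h < 1 -> f h - f k = (h - k) * Q h.
Proof.
move=> tf k2; have M0 := tay_ge0 tf; have [F HF Ff] := tf; have [r0 HF'] := HF.
have kr : rho * cabs k < 1 by lra.
have sub h : 2 * rho * cabs h < 1 -> rho * cabs h <= 2^-1 by lra.
(* The value at [h = k] of the divided difference of [F n]. Letting [h] tend to [k] in the recursion
   gives [d n = F n.+1 k + k * d n.+1], which this series solves. *)
pose d n := csum (fun i => k ^+ i * F (n + i).+1 k).
have ds n : abs_summable (fun i => k ^+ i * F (n + i).+1 k) (M * rho ^+ n.+1 * 2).
  apply: abs_summable_geom => i; rewrite cabsM cabsX.
  have [_ b] := HF' (n + i).+1 k kr.
  apply: le_trans (ler_wpM2l (exprn_ge0 i (cabs_ge0 k)) b) _.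
  have -> : cabs k ^+ i * (M * rho ^+ (n + i).+1) = M * rho ^+ n.+1 * (rho * cabs k) ^+ i.
    by rewrite exprMn -addSn exprD; ring.
  apply: ler_wpM2l; first by rewrite mulr_ge0// exprn_ge0// ltW.
  by apply: lerXn2r => //; rewrite nnegrE ?invr_ge0// mulr_ge0 ?cabs_ge0// ltW.
have dE n : d n = F n.+1 k + k * d n.+1.
  have h1 := is_sum_partial (csumP (ds n)).
  have h2 := is_sum_partial (csumP (ds n.+1)).
  apply/eqP; rewrite -subr_eq0; apply/eqP/cabs_lt_eps => e e0.
  have k1 : 0 < 2 * (cabs k + 1) by have := cabs_ge0 k; lra.
  have [N1 H1] := h1 (e / 2) ltac:(lra).
  have [N2 H2] := h2 (e / (2 * (cabs k + 1))) (divr_gt0 e0 k1).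
  have := H1 (N1 + N2).+1 (leqW (leq_addr _ _)).
  have := H2 (N1 + N2)%N (leq_addl _ _).
  rewrite -/(d n) -/(d n.+1) big_ord_recl/= expr0 mul1r addn0.
  under [in X in _ -> X -> _]eq_bigr => i _ do rewrite /bump/= add1n exprS -mulrA addnS -addSn.
  rewrite -mulr_sumr; set Y := \sum_(i < _) _; rewrite ltr_pdivlMr// => A1 A2.
  have -> : d n - (F n.+1 k + k * d n.+1) =
     k * (Y - d n.+1) - (F n.+1 k + k * Y - d n) by ring.
  apply: le_lt_trans (cabsB _ _) _; rewrite cabsM.
  have : cabs k * cabs (Y - d n.+1) <= (cabs k + 1) * cabs (Y - d n.+1).
    by rewrite ler_wpM2r ?cabs_ge0//; lra.
  by lra.
pose G n h := if h == k then d n else (F n h - F n k) / (h - k).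
exists (G 0%N); last first.
  move=> h hr; rewrite /G; case: eqP => [->|/eqP hk]; first by rewrite !subrr mul0r.
  have h1 : rho * cabs h < 1 by have := sub h hr; lra.
  by rewrite -(Ff h)// -(Ff k)// mulrCA divff ?subr_eq0// mulr1.
exists G => //; split; first by lra.
have G0 n : G n 0 = F n.+1 k.
  rewrite /G eq_sym; case: eqP => [k0|/eqP k0]; first by rewrite dE k0 mul0r addr0.
  by have [-> _] := HF' n k kr; field.
move=> n h hr; have h2 := sub h hr; have h1 : rho * cabs h < 1 by lra.
split.
  rewrite G0 /G; case: eqP => [->|/eqP hk]; first exact: dE.
  have [-> _] := HF' n k kr; have [-> _] := HF' n h h1.
  by field; rewrite subr_eq0.
have -> : 2 * M * rho * (2 * rho) ^+ n = 2 * M * rho ^+ n.+1 * 2 ^+ n.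
  by rewrite exprMn exprS; ring.
apply: le_trans (_ : 2 * M * rho ^+ n.+1 <= _); last first.
  rewrite ler_peMr ?exprn_ege1 ?ler1n// !mulr_ge0 ?exprn_ge0// ltW//.
rewrite /G; case: eqP => [_|/eqP hk].
  by apply: le_trans (csum_bound (ds n)) _; lra.
rewrite cabsM cabsV ler_pdivrMr ?cabs_gt0 ?subr_eq0//.
exact: (taylor_seq_lip n HF h2 k2).
Qed.

(** The asymmetry of [tayM] keeps the rate at [2 * rho] for every power. *)
Lemma tayX f K rho j : tay f K rho -> tay (fun h => f h ^+ j) ((2 * K) ^+ j) (2 * rho).
Proof.
move=> tf; have r0 := tay_gt0 tf; elim: j => [|j IH].
  have r2 : 0 < 2 * rho by lra.
  by have := tay_cst 1 r2; rewrite cabs1.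
by rewrite exprS; apply: tay_ext (tayM tf IH) _ => h _; rewrite exprS.
Qed.

(** Write [f h = h * f1 h], so that [g (f h)] is the sum of [G j 0 * h ^+ j * f1 h ^+ j]. A
    remainder of order [n] combines the remainders of the powers of [f1] with
    [f1 h ^+ n * G n (f h)]; the rates [2 * (M * rho) * tau] and [2 * rho] add up by a binomial
    bound. *)
Lemma tay_comp f g M rho N tau : tay f M rho -> f 0 = 0 -> tay g N tau ->
  tay (fun h => g (f h)) N (2 * M * rho * tau + 2 * rho).
Proof.
move=> tf f0 tg; have M0 := tay_ge0 tf; have N0 := tay_ge0 tg.
have r0 := tay_gt0 tf.
have [f1 tf1 ff1] := tay_shift tf.
have /choice[P HP] : forall j, exists P : nat -> C -> C,
    taylor_seq P ((2 * (M * rho)) ^+ j) (2 * rho) /\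
    (forall h, 2 * rho * cabs h < 1 -> P 0%N h = f1 h ^+ j).
  by move=> j; have [P ? ?] := tayX j tf1; exists P.
have [G [t0 HG] Gg] := tg.
set K := M * rho in tf1 HP.
have K0 : 0 <= K by rewrite mulr_ge0// ltW.
set r := 2 * M * rho * tau + 2 * rho.
have rE : r = 2 * K * tau + 2 * rho by rewrite /r /K; ring.
have Kt0 : 0 <= K * tau by rewrite mulr_ge0// ltW.
have sub1 h : r * cabs h < 1 -> 2 * rho * cabs h < 1.
  apply: le_lt_trans; rewrite ler_wpM2r ?cabs_ge0// rE; lra.
have sub0 h : r * cabs h < 1 -> rho * cabs h < 1.
  by move=> /sub1; have := mulr_ge0 (ltW r0) (cabs_ge0 h); lra.
have fb h : r * cabs h < 1 -> tau * cabs (f h) < 1.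
  move=> hr; rewrite (ff1 _ (sub0 _ hr)) f0 add0r cabsM.
  have := tay_bound tf1 (sub0 _ hr); rewrite -/K => b.
  have h1 : cabs h * cabs (f1 h) <= cabs h * K by rewrite ler_wpM2l ?cabs_ge0.
  have h2 := ler_wpM2l (ltW t0) h1.
  have h3 := mulr_ge0 Kt0 (cabs_ge0 h).
  have h4 := mulr_ge0 (ltW r0) (cabs_ge0 h).
  by apply: le_lt_trans h2 _; move: hr; rewrite rE; lra.
exists (fun n h => \sum_(j < n) G j 0 * P j (n - j)%N h + f1 h ^+ n * G n (f h));
  last by move=> h hr; rewrite big_ord0 add0r expr0 mul1r Gg// fb.
split; first by rewrite rE; lra.
move=> n h hr; have hr0 := sub0 _ hr; have hr1 := sub1 _ hr; split.
  rewrite big_ord_recr/= subSnn f0.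
  have Ph j m : h * P j m.+1 h = P j m h - P j m 0.
    by have [[_ /(_ m h hr1)[{2}-> _]] _] := HP j; rewrite addrC addKr.
  have -> : h * (\sum_(j < n) G j 0 * P j (n.+1 - j)%N h + G n 0 * P n 1%N h
      + f1 h ^+ n.+1 * G n.+1 (f h)) =
    h * (\sum_(j < n) G j 0 * P j (n.+1 - j)%N h) + G n 0 * (h * P n 1%N h)
     + f1 h ^+ n * (f h * G n.+1 (f h)).
    have fE : f h = h * f1 h by rewrite (ff1 _ hr0) f0 add0r.
    by move: (G n.+1 (f h)) => Gv; rewrite fE exprS; ring.
  rewrite Ph (HP n).2// (HP n).2 ?disc0//.
  have -> : h * (\sum_(i < n) G i 0 * P i (n.+1 - i)%N h) =
      \sum_(i < n) G i 0 * P i (n - i)%N h - \sum_(i < n) G i 0 * P i (n - i)%N 0.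
    rewrite mulr_sumr -sumrB; apply: eq_bigr => i _.
    by rewrite mulrCA subSn 1?ltnW// Ph mulrBr.
  have [eG _] := HG n (f h) (fb _ hr).
  by rewrite [G n (f h)]eG; ring.
pose x := 2 * K * tau; pose y := 2 * rho.
have x0 : 0 <= x by rewrite /x; lra.
have y0 : 0 <= y by rewrite /y; lra.
have bin : \sum_(j < n.+1) x ^+ j * y ^+ (n - j) <= (x + y) ^+ n.
  elim: (n) => [|m IH]; first by rewrite big_ord1 !expr0 mul1r.
  rewrite big_ord_recr/= subnn expr0 mulr1.
  have -> : \sum_(i < m.+1) x ^+ i * y ^+ (m.+1 - i) = y * \sum_(i < m.+1) x ^+ i * y ^+ (m - i).
    rewrite mulr_sumr; apply: eq_bigr => i _.
    by rewrite subSn -1?ltnS// exprS; ring.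
  rewrite [in leRHS]exprS mulrDl addrC lerD// ?ler_wpM2l// exprS ler_wpM2l//.
  by rewrite lerXn2r ?nnegrE ?addr_ge0// lerDl.
rewrite rE -/x -/y; apply: le_trans (_ : N * \sum_(j < n.+1) x ^+ j * y ^+ (n - j) <= _);
  last by rewrite ler_wpM2l.
apply: le_trans (cabsD _ _) _; rewrite big_ord_recr/= subnn expr0 mulr1 mulrDr lerD//.
  apply: le_trans (cabs_sum _ _ _) _; rewrite mulr_sumr; apply: ler_sum => j _.
  have [_ bG] := HG j 0 (disc0 _); have [[_ /(_ (n - j)%N h hr1)[_ bP]] _] := HP j.
  rewrite cabsM; apply: le_trans (ler_pM (cabs_ge0 _) (cabs_ge0 _) bG bP) _.
  by rewrite /x /y [(2 * K * tau) ^+ j]exprMn; apply: le_of_eq; move: ((2 * rho) ^+ _) ((2 * K) ^+ _) => X Y; ring.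
have [_ bG] := HG n (f h) (fb _ hr).
have bf := tay_bound tf1 hr0; rewrite -/K in bf.
rewrite cabsM cabsX; apply: le_trans (ler_pM (exprn_ge0 _ (cabs_ge0 _)) (cabs_ge0 _) (_ : _ <= K ^+ n) bG) _.
  by rewrite lerXn2r ?nnegrE ?cabs_ge0.
rewrite mulrCA -exprMn ler_wpM2l// lerXn2r ?nnegrE//; rewrite /x; lra.
Qed.

Lemma tay_geom : tay (fun h => (1 - h)^-1) 2 2.
Proof.
exists (fun _ h => (1 - h)^-1) => //; split=> // n h hr.
have h1 : 1 - h != 0.
  rewrite subr_eq0; apply/eqP => h1; move: hr; rewrite -h1 cabs1; lra.
split; first by rewrite subr0 invr1; field.
apply: le_trans (_ : 2 <= _); last by rewrite ler_peMr// exprn_ege1// ler1n.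
rewrite cabsV -[2]invrK lef_pV2 ?posrE ?cabs_gt0// ?invr_gt0//.
have := cabsB_ge 1 h; rewrite cabs1; lra.
Qed.

(** Geometric series in [1 - f h / f 0]. The constants involve only a lower bound [a] of
    [cabs (f 0)], so that infinitely many functions can share them. *)
Lemma tay_inv f M rho a : tay f M rho -> 0 < a -> a <= cabs (f 0) ->
  tay (fun h => (f h)^-1) (2 / a) (4 * (1 + M / a) * rho + 2 * rho).
Proof.
move=> tf a0 af; have r0 := tay_gt0 tf; have M0 := tay_ge0 tf.
have fn : f 0 != 0 by rewrite -cabs_gt0; lra.
have iV : (cabs (f 0))^-1 <= a^-1 by rewrite lef_pV2 ?posrE//; lra.
have tu : tay (fun h => 1 + - (f 0)^-1 * f h) (1 + M / a) rho.
  have := tayD (tay_cst 1 r0) (tayZ (- (f 0)^-1) tf).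
  move=> /tay_weaken; apply => //; rewrite cabs1 cabsN cabsV lerD2l mulrC.
  by rewrite ler_wpM2l.
have u0 : 1 + - (f 0)^-1 * f 0 = 0 by field.
have := tayZ (f 0)^-1 (tay_comp tu u0 tay_geom).
move=> /(@tay_weaken _ _ _ (2 / a) (4 * (1 + M / a) * rho + 2 * rho)) H.
apply: tay_ext (H _ _) _ => [||h hr].
- by rewrite cabsV mulrC ler_wpM2l.
- by apply: le_of_eq; ring.
have -> : 1 - (1 + - (f 0)^-1 * f h) = (f 0)^-1 * f h by ring.
by rewrite invfM invrK mulrA mulVf// mul1r.
Qed.

End Taylor.

(** * Analytic functions of one complex variable *)

Section Analytic.
Variable R : realType.
Local Notation C := R[i].
Implicit Types (f g : C -> C) (p z w : C).

Definition analytic_at f p : Prop :=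
  exists M rho : R, tay (fun h => f (p + h)) M rho.

Lemma small_radius (K e r : R) : 0 <= K -> 0 < e -> 0 < r ->
  exists s : R, [/\ 0 < s, s <= r & K * s <= e].
Proof.
move=> K0 e0 r0; have K1 : 0 < K + 1 by lra.
exists (Num.min r (e / (K + 1))); split.
- by rewrite lt_min r0 divr_gt0.
- by rewrite ge_min lexx.
apply: le_trans (_ : (K + 1) * (e / (K + 1)) <= _); last first.
  by rewrite mulrC divfK// gt_eqF.
apply: ler_pM => //; first by rewrite le_min (ltW r0) divr_ge0// ltW.
  by lra.
by rewrite ge_min lexx orbT.
Qed.

Lemma disc_radius (rho r : R) (h : C) : 0 < r -> (rho + r^-1) * cabs h < 1 ->
  0 < rho -> cabs h < r.
Proof.
move=> r0 h1 rho0; rewrite -(ltr_pM2l (_ : 0 < r^-1)) ?invr_gt0// mulVf ?gt_eqF//.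
by have := mulr_ge0 (ltW rho0) (cabs_ge0 h); lra.
Qed.

Lemma analytic_near_eq f g p (r : R) : analytic_at f p -> 0 < r ->
  (forall z, cabs (z - p) < r -> f z = g z) -> analytic_at g p.
Proof.
move=> [M [rho tf]] r0 fg; have rho0 := tay_gt0 tf.
exists M, (rho + r^-1); apply: tay_ext (tay_weaken tf (lexx _) _) _.
  by rewrite lerDl invr_ge0 ltW.
by move=> h hr; apply: fg; rewrite addrC addKr; apply: disc_radius hr _.
Qed.

Lemma analytic_cst (a : C) p : analytic_at (fun=> a) p.
Proof. by exists (cabs a), 1; apply: tay_cst. Qed.

Lemma analytic_id p : analytic_at id p.
Proof. by exists (cabs p + 1^-1), 1; apply: tayD (tay_cst _ _) (tay_id _). Qed.

Lemma analyticD f g p : analytic_at f p -> analytic_at g p ->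
  analytic_at (fun z => f z + g z) p.
Proof.
move=> [M [rho tf]] [N [tau tg]]; exists (M + N), (rho + tau).
have [r0 t0] := (tay_gt0 tf, tay_gt0 tg).
apply: (tayD (f := fun h => f (p + h)) (g := fun h => g (p + h))).
  by apply: tay_weaken tf _ _ => //; rewrite lerDl ltW.
by apply: tay_weaken tg _ _ => //; rewrite lerDr ltW.
Qed.

Lemma analyticM f g p : analytic_at f p -> analytic_at g p ->
  analytic_at (fun z => f z * g z) p.
Proof.
move=> [M [rho tf]] [N [tau tg]].
have [r0 t0] := (tay_gt0 tf, tay_gt0 tg).
exists (2 * M * N), (2 * (rho + tau)).
apply: (tayM (f := fun h => f (p + h)) (g := fun h => g (p + h))).
  by apply: tay_weaken tf _ _ => //; rewrite lerDl ltW.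
by apply: tay_weaken tg _ _ => //; lra.
Qed.

Lemma analyticZ f p (a : C) : analytic_at f p -> analytic_at (fun z => a * f z) p.
Proof. exact/analyticM/analytic_cst. Qed.

Lemma analyticB f g p : analytic_at f p -> analytic_at g p ->
  analytic_at (fun z => f z - g z) p.
Proof.
move=> af ag; have := analyticD af (analyticZ (-1) ag).
by move/analytic_near_eq; apply; [exact: ltr01|move=> z _; rewrite mulN1r].
Qed.

Lemma analytic_sum (J : Type) (s : seq J) (f : J -> C -> C) p :
  (forall j, analytic_at (f j) p) -> analytic_at (fun z => \sum_(j <- s) f j z) p.
Proof.
move=> H; elim: s => [|j s IH].
  apply: (analytic_near_eq (r := 1) (analytic_cst 0 p)) => // z _.
  by rewrite big_nil.
apply: (analytic_near_eq (r := 1) (analyticD (H j) IH)) => // z _.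
by rewrite big_cons.
Qed.

Lemma analytic_comp f g p : analytic_at f p -> analytic_at g (f p) ->
  analytic_at (fun z => g (f z)) p.
Proof.
move=> [M [rho tf]] [N [tau tg]]; have r0 := tay_gt0 tf.
have tf' := tayD tf (tay_cst (- f p) r0).
have f0 : f (p + 0) - f p = 0 by rewrite addr0 subrr.
have := tay_comp tf' f0 tg => t; eexists; eexists.
by apply: tay_ext t _ => h _; rewrite addrC subrK.
Qed.

Lemma analytic_inv f p : analytic_at f p -> f p != 0 ->
  analytic_at (fun z => (f z)^-1) p.
Proof.
move=> [M [rho tf]] fp; eexists; eexists.
apply: (tay_inv tf (a := cabs (f p))); last by rewrite addr0.
by rewrite cabs_gt0.
Qed.

Lemma tay_analytic f M rho p : tay (fun h => f (p + h)) M rho -> analytic_at f p.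
Proof. by exists M, rho. Qed.

(** The power series is expanded around [k] monomial by monomial. Scaled by [2 * rho], every
    monomial obeys the bound [1] at the rate [16 * rho], while the scaled coefficients decay like
    [2^-1 ^+ n], so [tay_csum] applies. *)
Lemma tay_recenter f M rho (k : C) : tay f M rho -> rho * cabs k <= 8^-1 ->
  tay (fun h => f (k + h)) (1 * (M * 2)) (16 * rho).
Proof.
move=> tf k8; have r0 := tay_gt0 tf; have M0 := tay_ge0 tf.
have [F HF Ff] := tf; have [_ HF'] := HF.
have r8 : 0 < 8 * rho by lra.
have t1 n : tay (fun h => ((2 * rho)%:C * (k + h)) ^+ n) 1 (16 * rho).
  have tk : tay (fun h => k + h) ((4 * rho)^-1) (8 * rho).
    apply: tay_weaken (tayD (tay_cst k r8) (tay_id r8)) _ _ => //.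
    rewrite -(ler_pM2l r8) mulrDr divff ?gt_eqF// [leRHS](_ : _ = 2); first by lra.
    by field; rewrite gt_eqF.
  have := tayX n (tayZ (2 * rho)%:C tk); rewrite cabsC ger0_norm; last lra.
  have -> : 2 * (2 * rho / (4 * rho)) = 1 by field; rewrite gt_eqF.
  by rewrite expr1n mulrA; have -> : 2 * 8 = 16 :> R by lra.
have sc : abs_summable (fun n => F n 0 * ((2 * rho)%:C)^-1 ^+ n) (M * 2).
  apply: abs_summable_geom => n; have [_ b] := HF' n 0 (disc0 _).
  rewrite cabsM cabsX cabsV cabsC ger0_norm; last lra.
  apply: le_trans (ler_wpM2r _ b) _; first by rewrite exprn_ge0// invr_ge0; lra.
  rewrite -mulrA -exprMn; have -> : rho / (2 * rho) = 2^-1 by field; rewrite gt_eqF.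
  by [].
have r16 : 0 < 16 * rho by lra.
have [t2 _] := tay_csum r16 ler01 (fun n _ => t1 n) sc.
apply: tay_ext t2 _ => h hr.
have kh : rho * cabs (k + h) <= 2^-1.
  have := ler_wpM2l (ltW r0) (cabsD k h); rewrite mulrDr; lra.
rewrite -Ff; last lra.
apply: csumE; apply: is_sum_eq (taylor_is_sum HF kh) => n.
rewrite -mulrA -exprMn mulKf//.
by apply/eqP => /(congr1 (@complex.Re R))/=; lra.
Qed.

Lemma analytic_nearby f p : analytic_at f p ->
  exists2 r : R, 0 < r & forall z, cabs (z - p) < r -> analytic_at f z.
Proof.
move=> [M [rho tf]]; have r0 := tay_gt0 tf.
have r8 : 0 < 8 * rho by lra.
exists (8 * rho)^-1; first by rewrite invr_gt0.
move=> z; rewrite -(ltr_pM2l r8) divff ?gt_eqF// => hz.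
have z8 : rho * cabs (z - p) <= 8^-1 by lra.
have t := tay_recenter tf z8; apply: (tay_analytic (M := 1 * (M * 2)) (rho := 16 * rho)).
by apply: tay_ext t _ => h _; rewrite addrA [p + _]addrC subrK.
Qed.

Lemma analytic_continuous f p (e : R) : analytic_at f p -> 0 < e ->
  exists2 r : R, 0 < r & forall z, cabs (z - p) < r -> cabs (f z - f p) < e.
Proof.
move=> [M [rho tf]] e0; have r0 := tay_gt0 tf; have M0 := tay_ge0 tf.
have K0 : 0 <= 2 * M * rho + 1 by rewrite addr_ge0// !mulr_ge0// ltW.
have r20 : 0 < (2 * rho)^-1 by rewrite invr_gt0; lra.
have e2 : 0 < e / 2 by lra.
have [s [s0 sr Ks]] := small_radius K0 e2 r20.
exists s => // z hs; have -> : z = p + (z - p) by rewrite addrC subrK.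
move: hs; set h := z - p => hs.
have h2 : rho * cabs h <= 2^-1.
  have : cabs h <= (2 * rho)^-1 by lra.
  by rewrite invfM ler_pdivlMr// mulrC.
have := tay_lip tf h2 (_ : rho * cabs 0 <= 2^-1).
rewrite cabs0 mulr0 invr_ge0 addr0 subr0 => /(_ (ler0n _ _)) le1.
apply: le_lt_trans le1 _.
have : 2 * M * rho * cabs h <= (2 * M * rho + 1) * s.
  by apply: ler_pM; rewrite ?cabs_ge0//; [rewrite !mulr_ge0// ltW|lra|exact: ltW].
by lra.
Qed.

(** A two-point estimate: on pairs near [p] it yields both the contraction of the inverse function
    theorem and the continuity of the derivative. *)
Definition strict_deriv f p (d : C) : Prop := exists K r : R,
  [/\ 0 <= K, 0 < r & forall z w, cabs (z - p) < r -> cabs (w - p) < r ->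
   cabs (f z - f w - d * (z - w)) <= K * (cabs (z - p) + cabs (w - p)) * cabs (z - w)].

Definition is_cderiv f p (d : C) : Prop := forall e : R, 0 < e ->
  exists2 r : R, 0 < r & forall z, cabs (z - p) < r ->
    cabs (f z - f p - d * (z - p)) <= e * cabs (z - p).

Definition cderiv f p : C := xget 0 [set d | is_cderiv f p d]%classic.

Lemma strict_is_cderiv f p d : strict_deriv f p d -> is_cderiv f p d.
Proof.
move=> [K [r [K0 r0 H]]] e e0.
have [s [s0 sr Ks]] := small_radius K0 e0 r0.
exists s => // z zs.
have := H z p (lt_le_trans zs sr); rewrite subrr cabs0 => /(_ r0) /le_trans; apply.
rewrite addr0 ler_wpM2r ?cabs_ge0//.
by apply: le_trans Ks; rewrite ler_wpM2l// ltW.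
Qed.

Lemma is_cderiv_unique f p d d' : is_cderiv f p d -> is_cderiv f p d' -> d = d'.
Proof.
move=> H H'; apply/eqP; rewrite -subr_eq0; apply/eqP/cabs_lt_eps => e e0.
have e4 : 0 < e / 4 by lra.
have [r r0 Hr] := H _ e4; have [r' r'0 Hr'] := H' _ e4.
pose h := (Num.min r r' / 2)%:C : C.
have m0 : 0 < Num.min r r' by rewrite lt_min r0.
have mr : Num.min r r' <= r by rewrite ge_min lexx.
have mr' : Num.min r r' <= r' by rewrite ge_min lexx orbT.
have hE : cabs h = Num.min r r' / 2 by rewrite cabsC ger0_norm//; lra.
have hh : cabs (p + h - p) = cabs h by rewrite addrC addKr.
have h1 := Hr (p + h) ltac:(rewrite hh hE; lra).
have h2 := Hr' (p + h) ltac:(rewrite hh hE; lra).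
have hp : 0 < cabs h by rewrite hE; lra.
have : cabs ((d - d') * h) <= e / 2 * cabs h.
  have -> : (d - d') * h = (f (p + h) - f p - d' * (p + h - p)) -
      (f (p + h) - f p - d * (p + h - p)) by ring.
  by apply: le_trans (cabsB _ _) _; rewrite -hh; lra.
by rewrite cabsM ler_pM2r//; lra.
Qed.

Lemma cderivE f p d : is_cderiv f p d -> cderiv f p = d.
Proof.
move=> H; rewrite /cderiv; case: xgetP => [x _ Hx|/(_ d)//].
exact: is_cderiv_unique Hx H.
Qed.

Lemma analytic_strict f p : analytic_at f p -> strict_deriv f p (cderiv f p).
Proof.
move=> [M [rho [F HF Ff]]]; have [r0 HF'] := HF.
suff H : strict_deriv f p (F 1%N 0) by rewrite (cderivE (strict_is_cderiv H)).
have M0 : 0 <= M.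
  by have [_] := HF' 0%N 0 (disc0 _); rewrite expr0 mulr1; apply: le_trans (cabs_ge0 _).
have r2 : 0 < 2 * rho by lra.
exists (2 * M * rho ^+ 2), (2 * rho)^-1; split.
- by rewrite !mulr_ge0// ltW.
- by rewrite invr_gt0; lra.
move=> z w; rewrite -(ltr_pM2l r2) divff ?gt_eqF// => zr.
rewrite -(ltr_pM2l r2) divff ?gt_eqF//; move: zr.
move: (subrK p z) (subrK p w); set h := z - p; set k := w - p => <- <- hr kr.
have h2 : rho * cabs h <= 2^-1 by lra.
have k2 : rho * cabs k <= 2^-1 by lra.
have z2 : rho * cabs 0 <= 2^-1 by rewrite cabs0; lra.
rewrite ![_ + p]addrC -!Ff; try lra.
have [e1 _] := HF' 0%N h ltac:(lra); have [e2 _] := HF' 0%N k ltac:(lra).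
have -> : p + h - (p + k) = h - k by ring.
have -> : F 0%N h - F 0%N k - F 1%N 0 * (h - k) =
   (h - k) * (F 1%N h - F 1%N 0) + k * (F 1%N h - F 1%N k) by rewrite e1 e2; ring.
have l1 := taylor_seq_lip 1 HF h2 z2; have l2 := taylor_seq_lip 1 HF h2 k2.
rewrite subr0 in l1; apply: le_trans (cabsD _ _) _; rewrite !cabsM.
apply: le_trans (lerD (ler_wpM2l (cabs_ge0 _) l1) (ler_wpM2l (cabs_ge0 _) l2)) _.
by apply: le_of_eq; ring.
Qed.

Lemma analytic_cderiv f p : analytic_at f p -> is_cderiv f p (cderiv f p).
Proof. by move=> /analytic_strict/strict_is_cderiv. Qed.

Lemma is_cderivD f g p d e : is_cderiv f p d -> is_cderiv g p e ->
  is_cderiv (fun z => f z + g z) p (d + e).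
Proof.
move=> Hf Hg x x0; have x2 : 0 < x / 2 by lra.
have [r r0 Hr] := Hf _ x2; have [s s0 Hs] := Hg _ x2.
exists (Num.min r s); first by rewrite lt_min r0.
move=> z; rewrite lt_min => /andP[/Hr h1 /Hs h2].
have -> : f z + g z - (f p + g p) - (d + e) * (z - p) =
  (f z - f p - d * (z - p)) + (g z - g p - e * (z - p)) by ring.
by apply: le_trans (cabsD _ _) _; lra.
Qed.

Lemma is_cderivZ f p d (a : C) : is_cderiv f p d ->
  is_cderiv (fun z => a * f z) p (a * d).
Proof.
move=> Hf x x0; have a1 : 0 < cabs a + 1 by have := cabs_ge0 a; lra.
have [r r0 Hr] := Hf (x / (cabs a + 1)) (divr_gt0 x0 a1).
exists r => // z /Hr h1.
have -> : a * f z - a * f p - a * d * (z - p) = a * (f z - f p - d * (z - p)) by ring.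
rewrite cabsM.
have := ler_wpM2l (cabs_ge0 a) h1 => /le_trans; apply.
rewrite mulrA ler_wpM2r ?cabs_ge0// mulrA ler_pdivrMr// mulrC ler_wpM2l ?ltW//; lra.
Qed.

Lemma is_cderiv_near f g p d (r : R) : is_cderiv f p d -> 0 < r ->
  (forall z, cabs (z - p) < r -> f z = g z) -> is_cderiv g p d.
Proof.
move=> H r0 fg e e0; have [s s0 Hs] := H _ e0.
exists (Num.min r s); first by rewrite lt_min r0.
move=> z; rewrite lt_min => /andP[zr zs].
by rewrite -!fg ?subrr ?cabs0//; apply: Hs.
Qed.

(** Both [d] and [d'] approximate the increment of [f] from [z] to [z + h]; as [h] shrinks, the
    relative error for [d'] vanishes and that for [d] tends to the stated bound. *)
Lemma strict_deriv_bound f p d K r (z : C) : 0 <= K -> 0 < r ->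
  (forall z w, cabs (z - p) < r -> cabs (w - p) < r ->
   cabs (f z - f w - d * (z - w)) <= K * (cabs (z - p) + cabs (w - p)) * cabs (z - w)) ->
  cabs (z - p) < r -> forall d', is_cderiv f z d' ->
  cabs (d' - d) <= K * (2 * cabs (z - p)).
Proof.
move=> K0 r0 H zr d' Hd'; apply/ler_addgt0Pr => e e0.
have K1 : 0 < 4 * (K + 1) by lra.
have e2 : 0 < e / 2 by lra.
have [s s0 Hs] := Hd' _ e2.
pose m := Num.min (Num.min s (r - cabs (z - p))) (e / (4 * (K + 1))).
have m0 : 0 < m by rewrite !lt_min s0/= subr_gt0 zr/= divr_gt0.
have [ms mr me] : [/\ m <= s, m <= r - cabs (z - p) & m <= e / (4 * (K + 1))].
  by rewrite /m !ge_min !lexx !orbT.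
pose h := (m / 2)%:C : C.
have hE : cabs h = m / 2 by rewrite cabsC ger0_norm//; lra.
have zh : z + h - z = h by rewrite addrC addKr.
have h1 := Hs (z + h) ltac:(rewrite zh hE; lra).
have wp : cabs (z + h - p) <= cabs (z - p) + m / 2.
  by rewrite -hE addrAC; exact: cabsD.
have h2 := H (z + h) z ltac:(lra) zr.
rewrite zh in h1 h2; have hp : 0 < cabs h by rewrite hE; lra.
rewrite -(ler_pM2r hp) -cabsM.
have -> : (d' - d) * h = (f (z + h) - f z - d * h) - (f (z + h) - f z - d' * h) by ring.
apply: le_trans (cabsB _ _) _; apply: le_trans (lerD h2 h1) _.
rewrite -mulrDl ler_wpM2r ?cabs_ge0//.
have : K * (cabs (z + h - p) + cabs (z - p)) <= K * (2 * cabs (z - p) + m / 2).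
  by rewrite ler_wpM2l//; lra.
have : K * m <= e / 4.
  apply: le_trans (ler_wpM2l K0 me) _; rewrite mulrA ler_pdivrMr//; nra.
by lra.
Qed.

Lemma cderiv_near f p (e : R) : analytic_at f p -> 0 < e ->
  exists2 r : R, 0 < r & forall z, cabs (z - p) < r ->
    forall d', is_cderiv f z d' -> cabs (d' - cderiv f p) <= e.
Proof.
move=> /analytic_strict[K [r [K0 r0 H]]] e0.
have K20 : 0 <= 2 * K by lra.
have [s [s0 sr Ks]] := small_radius K20 e0 r0.
exists s => // z zs d' Hd'.
apply: le_trans (strict_deriv_bound K0 r0 H (lt_le_trans zs sr) Hd') _.
by apply: le_trans Ks; rewrite mulrCA mulrA ler_wpM2l// ltW.
Qed.

Lemma inverse_function f p : analytic_at f p -> cderiv f p != 0 ->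
  exists L r : R, [/\ 0 < L, 0 < r,
    forall z w, cabs (z - p) < r -> cabs (w - p) < r ->
      cabs (z - w) <= L * cabs (f z - f w) &
    forall y, L * cabs (y - f p) < r ->
      exists2 z, cabs (z - p) <= L * cabs (y - f p) & f z = y].
Proof.
move=> /analytic_strict; set d := cderiv f p => -[K [r [K0 r0 H]]] d0.
have dp : 0 < cabs d by rewrite cabs_gt0.
have K40 : 0 <= 4 * K by lra.
have [s [s0 sr Ks]] := small_radius K40 dp r0.
have contr z w : cabs (z - p) < s -> cabs (w - p) < s ->
    cabs (f z - f w - d * (z - w)) <= cabs d / 2 * cabs (z - w).
  move=> zs ws; apply: le_trans (H z w _ _) _; try lra.
  rewrite ler_wpM2r ?cabs_ge0//.
  apply: le_trans (ler_wpM2l K0 (_ : _ <= 2 * s)) _; lra.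
exists (2 / cabs d), s; split => //; first by rewrite divr_gt0.
  move=> z w zs ws; have h1 := contr z w zs ws.
  have h2 := cabsD_ge (d * (z - w)) (f z - f w - d * (z - w)).
  rewrite [d * _ + _]addrC subrK cabsM in h2.
  by rewrite mulrAC ler_pdivlMr//; lra.
move=> y; set e := cabs (y - f p) => ys.
pose T z := z - (f z - y) / d.
have TT z w : cabs (z - p) < s -> cabs (w - p) < s ->
    cabs (T z - T w) <= cabs (z - w) / 2.
  move=> zs ws; have h1 := contr z w zs ws.
  have -> : T z - T w = - ((f z - f w - d * (z - w)) / d) by rewrite /T; field.
  by rewrite cabsN cabsM cabsV ler_pdivrMr//; lra.
pose x n := iter n T p.
have e0 : 0 <= e / cabs d by rewrite divr_ge0 ?cabs_ge0// ltW.
have pn m : 0 < 2^-1 ^+ m :> R by rewrite exprn_gt0.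
have small m : cabs (x m - p) <= e / cabs d * (2 - 2 * 2^-1 ^+ m) -> cabs (x m - p) < s.
  move=> b; apply: le_lt_trans b _.
  have := mulr_ge0 e0 (ltW (pn m)); move: ys; rewrite mulrAC -mulrA; lra.
have st n : cabs (x n.+1 - x n) <= e / cabs d * 2^-1 ^+ n /\
    cabs (x n - p) <= e / cabs d * (2 - 2 * 2^-1 ^+ n).
  elim: n => [|n [IH1 IH2]].
    have -> : x 1%N - x 0%N = (y - f p) / d by rewrite /x/= /T; field.
    by rewrite /x/= subrr cabs0 cabsM cabsV -/e expr0; split; lra.
  have b : cabs (x n.+1 - p) <= e / cabs d * (2 - 2 * 2^-1 ^+ n.+1).
    apply: le_trans (cabs_dist (x n) _ _) _; rewrite exprS; lra.
  split=> //; have := TT _ _ (small _ b) (small _ IH2).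
  by rewrite exprS; lra.
pose a n := x n.+1 - x n.
have sa : abs_summable a (e / cabs d * 2).
  by apply: abs_summable_geom => n; have [] := st n.
have ps n : \sum_(i < n) a i = x n - p.
  elim: n => [|n IH]; first by rewrite big_ord0 /x/= subrr.
  by rewrite big_ord_recr/= IH /a addrC addrA subrK.
have cb := csum_bound sa.
exists (p + csum a); first by rewrite addrC addKr; move: cb; rewrite mulrAC -mulrA; lra.
set z := p + csum a.
have zs : cabs (z - p) < s.
  by rewrite addrC addKr; apply: le_lt_trans cb _; move: ys; rewrite mulrAC -mulrA; lra.
suff : T z - z = 0.
  rewrite /T addrAC subrr add0r => /eqP; rewrite oppr_eq0 mulf_eq0 invr_eq0 (negPf d0) orbF.
  by rewrite subr_eq0 => /eqP.
apply: cabs_lt_eps => q q0; have q2 : 0 < q / 2 by lra.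
have [N HN] := is_sum_partial (csumP sa) q2.
have h1 := HN N (leqnn N); have h2 := HN N.+1 (leqW (leqnn N)); rewrite !ps in h1 h2.
have e1 u : u - p - csum a = u - z by rewrite /z; ring.
rewrite !e1 in h1 h2.
have h3 := TT z (x N) zs (small _ (st N).2).
have := cabs_dist (T (x N)) (T z) z; rewrite cabsBC in h1.
rewrite -/(x N.+1) in h2 *; rewrite [T (x N)](_ : _ = x N.+1)//.
by lra.
Qed.

(** The exponent is the index of the first non-zero Taylor coefficient, and the cofactor is the
    Taylor remainder of that order. *)
Lemma analytic_factor f p : analytic_at f p ->
  (exists2 r : R, 0 < r & forall z, cabs (z - p) < r -> f z = 0) \/
  exists (e : nat) (g : C -> C), [/\ analytic_at g p, g p != 0 &
    exists2 r : R, 0 < r & forall z, cabs (z - p) < r -> f z = (z - p) ^+ e * g z].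
Proof.
move=> [M [rho [F HF Ff]]]; have [r0 HF'] := HF.
have r2 : 0 < 2 * rho by lra.
have rr z : cabs (z - p) < (2 * rho)^-1 -> rho * cabs (z - p) <= 2^-1.
  by rewrite -(ltr_pM2l r2) divff ?gt_eqF//; lra.
have M0 : 0 <= M.
  by have [_] := HF' 0%N 0 (disc0 _); rewrite expr0 mulr1; apply: le_trans (cabs_ge0 _).
have fE z n : cabs (z - p) < (2 * rho)^-1 ->
    f z = \sum_(i < n) F i 0 * (z - p) ^+ i + (z - p) ^+ n * F n (z - p).
  move=> /rr zr; have z1 : rho * cabs (z - p) < 1 by lra.
  by rewrite -(taylor_partial n HF z1) Ff// addrC subrK.
have [[n Fn]|F0] := pselect (exists n, F n 0 != 0); last first.
  left; exists (2 * rho)^-1; first by rewrite invr_gt0.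
  move=> z zr; apply: cabs_lt_eps => e e0; have e2 : 0 < e / 2 by lra.
  have [m Hm] := geom_small M e2; have z2 := rr _ zr.
  rewrite (fE z m zr) big1 ?add0r; last first.
    move=> i _; have [->|Fi] := eqVneq (F i 0) 0; first by rewrite mul0r.
    by exfalso; apply: F0; exists i.
  have z1 : rho * cabs (z - p) < 1 by lra.
  have [_ b] := HF' m _ z1; rewrite cabsM cabsX.
  apply: le_lt_trans (_ : M * 2^-1 ^+ m < _); last lra.
  apply: le_trans (ler_wpM2l (exprn_ge0 _ (cabs_ge0 _)) b) _.
  rewrite mulrCA -exprMn ler_wpM2l// [cabs _ * _]mulrC lerXn2r// nnegrE ?invr_ge0//.
  by rewrite mulr_ge0 ?cabs_ge0// ltW.
right; have ex : exists n, F n 0 != 0 by exists n.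
case: (ex_minnP ex) => m Fm mmin; exists m, (fun z => F m (z - p)); split.
- exists (M * rho ^+ m), rho; apply: tay_ext (_ : tay (F m) _ _) _ => [|h _]; last first.
    by rewrite addrC addKr.
  exists (fun n => F (m + n)%N) => [|h _]; last by rewrite addn0.
  split=> // k h hr; have [-> b] := HF' (m + k)%N h hr; rewrite addnS; split=> //.
  by rewrite -mulrA -exprD.
- by rewrite subrr.
exists (2 * rho)^-1; first by rewrite invr_gt0.
move=> z zr; rewrite (fE z m zr) big1 ?add0r// => i _.
have [->|Fi] := eqVneq (F i 0) 0; first by rewrite mul0r.
by have := mmin _ Fi; rewrite leqNgt ltn_ord.
Qed.

Lemma analytic_zeros f p : analytic_at f p ->
  (exists2 r : R, 0 < r & forall z, cabs (z - p) < r -> f z = 0) \/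
  (exists2 r : R, 0 < r & forall z, z != p -> cabs (z - p) < r -> f z != 0).
Proof.
move=> /analytic_factor[|[e [g [ag g0 [r r0 H]]]]]; [by left|right].
have gp : 0 < cabs (g p) by rewrite cabs_gt0.
have [s s0 Hs] := analytic_continuous ag gp.
exists (Num.min r s); first by rewrite lt_min r0.
move=> z zp; rewrite lt_min => /andP[zr zs]; rewrite H// mulf_neq0//.
  by rewrite expf_neq0// subr_eq0.
by apply: contraTneq (Hs _ zs) => ->; rewrite sub0r cabsN ltxx.
Qed.

End Analytic.

(** * Connectedness through locally constant predicates *)

Section Connected.
Variable R : realType.
Local Notation C := R[i].
Implicit Types (D X : C -> Prop) (f g : C -> C) (p q z w : C).

(** [X] is compared only at points of [D]. The notion is thus relative to [D] and makes sense for
    sets that are not open, such as a half disc together with one boundary point. *)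
Definition locally_constant D X : Prop := forall p, D p ->
  exists2 r : R, 0 < r & forall z, D z -> cabs (z - p) < r -> (X z <-> X p).

Definition connected_dom D : Prop := forall X, locally_constant D X ->
  forall p q, D p -> D q -> X p -> X q.

Definition open_dom D : Prop := forall p, D p ->
  exists2 r : R, 0 < r & forall z, cabs (z - p) < r -> D z.

Lemma locally_constant_sub D D' X : (forall z, D' z -> D z) ->
  locally_constant D X -> locally_constant D' X.
Proof.
move=> DD H p /DD/H[r r0 Hr]; exists r => // z /DD; exact: Hr.
Qed.

Lemma connected_union D1 D2 (D : C -> Prop) z : connected_dom D1 -> connected_dom D2 ->
  D1 z -> D2 z -> (forall w, D w <-> D1 w \/ D2 w) -> connected_dom D.
Proof.
move=> c1 c2 z1 z2 DE X lX p q.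
have l1 : locally_constant D1 X by apply: locally_constant_sub lX => w; rewrite DE; left.
have l2 : locally_constant D2 X by apply: locally_constant_sub lX => w; rewrite DE; right.
rewrite !DE => -[p1|p2] [q1|q2] Xp.
- exact: c1 p1 q1 Xp.
- exact: c2 z2 q2 (c1 _ l1 _ _ p1 z1 Xp).
- exact: c1 z1 q1 (c2 _ l2 _ _ p2 z2 Xp).
- exact: c2 p2 q2 Xp.
Qed.

Lemma connected_dense D1 D : connected_dom D1 -> (forall z, D1 z -> D z) ->
  (forall p (r : R), D p -> 0 < r -> exists2 z, D1 z & cabs (z - p) < r) ->
  connected_dom D.
Proof.
move=> c1 D1D dn X lX p q Dp Dq Xp.
have l1 := locally_constant_sub D1D lX.
have [r r0 Hr] := lX p Dp; have [s s0 Hs] := lX q Dq.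
have [z z1 zr] := dn p r Dp r0; have [w w1 ws] := dn q s Dq s0.
by apply/(Hs w (D1D _ w1) ws); apply: (c1 X l1 z w) => //; apply/(Hr z (D1D _ z1) zr).
Qed.

Lemma connected_convex D :
  (forall p q (t : R), D p -> D q -> 0 <= t <= 1 -> D (p + t%:C * (q - p))) ->
  connected_dom D.
Proof.
move=> cv X lX p q Dp Dq Xp.
pose ga (t : R) := p + t%:C * (q - p).
have Dga t : 0 <= t <= 1 -> D (ga t) by exact: cv.
pose E := [set t : R | 0 <= t <= 1 /\ forall u, 0 <= u <= t -> X (ga u)]%classic.
have E0 : E 0.
  split; first by rewrite lexx ler01.
  by move=> u /andP[u0 u1]; rewrite (_ : u = 0) ?/ga ?mul0r ?addr0//; lra.
have hs : has_sup E by split; [exists 0|exists 1 => t [/andP[]]].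
set s := sup E.
have s0 : 0 <= s by apply: ub_le_sup => //; case: hs.
have s1 : s <= 1 by apply: ge_sup; [exists 0|move=> t [/andP[]]].
have Ds : D (ga s) by apply: Dga; rewrite s0 s1.
have [r r0 Hr] := lX _ Ds.
have K1 : 0 < cabs (q - p) + 1 by have := cabs_ge0 (q - p); lra.
pose d := r / (cabs (q - p) + 1); have d0 : 0 < d by rewrite divr_gt0.
have near t : 0 <= t <= 1 -> `|t - s| < d -> (X (ga t) <-> X (ga s)).
  move=> t01 ts; apply: Hr; first exact: Dga.
  have -> : ga t - ga s = (t - s)%:C * (q - p) by rewrite /ga realCB; ring.
  rewrite cabsM cabsC; move: ts; rewrite /d ltr_pdivlMr//.
  by have := normr_ge0 (t - s); lra.
have [t [/andP[t0 t1] Et] ts] := sup_adherent d0 hs; rewrite -/s in ts.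
have ts' : t <= s by apply: ub_le_sup; [case: hs|split=> //; rewrite t0 t1].
have Xs : X (ga s).
  have t01 : 0 <= t <= 1 by rewrite t0.
  have tsd : `|t - s| < d by rewrite ltr_norml; apply/andP; split; lra.
  by apply/(near t t01 tsd); apply: Et; rewrite t0 lexx.
have Es u : 0 <= u <= Num.min 1 (s + d / 2) -> X (ga u).
  move=> /andP[u0]; rewrite le_min => /andP[u1 us].
  have [ut|tu] := leP u t; first by apply: Et; rewrite u0.
  have u01 : 0 <= u <= 1 by rewrite u0.
  have usd : `|u - s| < d by rewrite ltr_norml; apply/andP; split; lra.
  by apply/(near u u01 usd).
have : Num.min 1 (s + d / 2) <= s.
  apply: ub_le_sup; first by case: hs.
  split => //; rewrite le_min ge_min lexx/= ler01/=; lra.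
rewrite ge_min => /orP[s1'|]; last lra.
have s1E : s = 1 by lra.
by move: Xs; rewrite s1E /ga mul1r addrC subrK.
Qed.

Lemma connected_ball p (r : R) : connected_dom (fun z => cabs (z - p) < r).
Proof.
apply: connected_convex => z w t zr wr /andP[t0 t1].
have -> : z + t%:C * (w - z) - p = (1 - t)%:C * (z - p) + t%:C * (w - p).
  by rewrite realCB; ring.
apply: le_lt_trans (cabsD _ _) _; rewrite !cabsM !cabsC !ger0_norm; try lra.
have h1 : (1 - t) * cabs (z - p) <= (1 - t) * r by rewrite ler_wpM2l; lra.
have [t00|tp] := eqVneq t 0; first by rewrite t00; lra.
have h2 : t * cabs (w - p) < t * r by rewrite ltr_pM2l//; lra.
by lra.
Qed.

Lemma connected_half p (r : R) (l : C -> R) :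
  (forall z w (t : R), l (z + t%:C * (w - z)) = (1 - t) * l z + t * l w) ->
  connected_dom (fun z => cabs (z - p) < r /\ 0 < l z).
Proof.
move=> lin; apply: connected_convex => z w t [zr lz] [wr lw] /andP[t0 t1].
split; last first.
  rewrite lin; have [t00|tp] := eqVneq t 0; first by rewrite t00; lra.
  have : 0 < t * l w by rewrite mulr_gt0//; lra.
  have : 0 <= (1 - t) * l z by rewrite mulr_ge0//; lra.
  by lra.
have -> : z + t%:C * (w - z) - p = (1 - t)%:C * (z - p) + t%:C * (w - p).
  by rewrite realCB; ring.
apply: le_lt_trans (cabsD _ _) _; rewrite !cabsM !cabsC !ger0_norm; try lra.
have h1 : (1 - t) * cabs (z - p) <= (1 - t) * r by rewrite ler_wpM2l; lra.
have [t00|tp] := eqVneq t 0; first by rewrite t00; lra.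
have h2 : t * cabs (w - p) < t * r by rewrite ltr_pM2l//; lra.
by lra.
Qed.

(** The open half discs to the right, above, to the left and below cover the punctured disc, and
    consecutive ones overlap. *)
Lemma connected_punctured p (r : R) :
  connected_dom (fun z => z != p /\ cabs (z - p) < r).
Proof.
have [r0|r0] := leP r 0.
  move=> X _ z w [_ zr]; have := cabs_ge0 (z - p); lra.
have h1 : connected_dom (fun z => cabs (z - p) < r /\ 0 < Re (z - p)).
  by apply: connected_half => z w t; rewrite !(ReB, ReD, Re_scale); ring.
have h2 : connected_dom (fun z => cabs (z - p) < r /\ 0 < Im (z - p)).
  by apply: connected_half => z w t; rewrite !(ImB, ImD, Im_scale); ring.
have h3 : connected_dom (fun z => cabs (z - p) < r /\ 0 < - Re (z - p)).
  by apply: connected_half => z w t; rewrite !(ReB, ReD, Re_scale); ring.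
have h4 : connected_dom (fun z => cabs (z - p) < r /\ 0 < - Im (z - p)).
  by apply: connected_half => z w t; rewrite !(ImB, ImD, Im_scale); ring.
have pt (a b : R) : `|a| + `|b| < r -> cabs (p + (a +i* b) - p) < r.
  by move=> ab; rewrite addrC addKr; apply: le_lt_trans (cabs_le _) _.
have r3 : 0 < r / 3 by lra.
have n1 : `|r / 3| = r / 3 by rewrite ger0_norm// ltW.
have n2 : `|- (r / 3)| = r / 3 by rewrite normrN n1.
have h12 : connected_dom (fun z => cabs (z - p) < r /\ (0 < Re (z - p) \/ 0 < Im (z - p))).
  apply: (connected_union (z := p + ((r / 3) +i* (r / 3))) h1 h2) => [||w]; last by tauto.
    by split; [apply: pt; rewrite n1; lra|rewrite addrC addKr/=; lra].
  by split; [apply: pt; rewrite n1; lra|rewrite addrC addKr/=; lra].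
have h123 : connected_dom (fun z => cabs (z - p) < r /\
    (0 < Re (z - p) \/ 0 < Im (z - p) \/ 0 < - Re (z - p))).
  apply: (connected_union (z := p + ((- (r / 3)) +i* (r / 3))) h12 h3) => [||w]; last by tauto.
    by split; [apply: pt; rewrite n2 n1; lra|right; rewrite addrC addKr/=; lra].
  by split; [apply: pt; rewrite n2 n1; lra|rewrite addrC addKr/=; lra].
apply: (connected_union (z := p + ((r / 3) +i* (- (r / 3)))) h123 h4) => [||w].
- by split; [apply: pt; rewrite n2 n1; lra|left; rewrite addrC addKr/=; lra].
- by split; [apply: pt; rewrite n2 n1; lra|rewrite addrC addKr/=; lra].
rewrite -subr_eq0; set u := w - p; split=> [[u0 ur]|[[ur H]|[ur H]]]; last 2 first.
- split=> //; apply/eqP => u0; move: H; rewrite u0/= oppr0 ltxx.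
  by case=> [|[|]].
- by split=> //; apply/eqP => u0; move: H; rewrite u0/= oppr0 ltxx.
have [re|re|re] := ltgtP (Re u) 0.
- by left; split=> //; right; right; lra.
- by left; split=> //; left.
have [im|im|im] := ltgtP (Im u) 0.
- by right; split=> //; lra.
- by left; split=> //; right; left.
by case/eqP: u0; exact: complex_eq.
Qed.

(** A predicate that is locally constant on [D'] extends to [D] if it takes a single value on [D']
    near every point of [D]: the extension [Y] is the truth of [X] on [D'] near the point. *)
Lemma connected_remove D D' : connected_dom D -> (forall z, D' z -> D z) ->
  (forall p (r : R), D p -> 0 < r -> exists2 z, D' z & cabs (z - p) < r) ->
  (forall X, locally_constant D' X -> forall p, D p -> exists2 r : R, 0 < r &
    forall z w, D' z -> D' w -> cabs (z - p) < r -> cabs (w - p) < r -> X z -> X w) ->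
  connected_dom D'.
Proof.
move=> cD D'D dn loc X lX p q D'p D'q Xp.
pose Y u := exists2 r : R, 0 < r & forall z, D' z -> cabs (z - u) < r -> X z.
have lY : locally_constant D Y.
  move=> u Du; have [r r0 Hr] := loc X lX u Du; exists r => // v Dv vr; split.
    move=> [s s0 Hs].
    have m0 : 0 < Num.min s (r - cabs (v - u)) by rewrite lt_min s0 subr_gt0.
    have [z D'z] := dn v _ Dv m0; rewrite lt_min => /andP[zs zr].
    exists r => // w D'w wr; apply: (Hr z w) => //; last exact: Hs.
    by apply: le_lt_trans (cabs_dist v _ _) _; lra.
  move=> [s s0 Hs].
  have m0 : 0 < Num.min s r by rewrite lt_min s0.
  have [z D'z] := dn u _ Du m0; rewrite lt_min => /andP[zs zr].
  exists (r - cabs (v - u)); first by rewrite subr_gt0.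
  move=> w D'w wr; apply: (Hr z w) => //; last exact: Hs.
  by apply: le_lt_trans (cabs_dist v _ _) _; lra.
have Yp : Y p by have [r r0 Hr] := lX p D'p; exists r => // z D'z zr; apply/(Hr z).
have [r r0 Hr] := cD Y lY p q (D'D _ D'p) (D'D _ D'q) Yp.
by apply: Hr => //; rewrite subrr cabs0.
Qed.

Lemma connected_remove_isolated D D' : connected_dom D -> (forall z, D' z -> D z) ->
  (forall p, D p -> exists2 r : R, 0 < r &
     forall z, z != p -> cabs (z - p) < r -> D' z) ->
  connected_dom D'.
Proof.
move=> cD D'D H; apply: connected_remove cD D'D _ _.
  move=> p r Dp r0; have [s s0 Hs] := H p Dp.
  have m0 : 0 < Num.min r s by rewrite lt_min r0.
  pose h := (Num.min r s / 2)%:C : C.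
  have hE : cabs h = Num.min r s / 2 by rewrite cabsC ger0_norm//; lra.
  have mr : Num.min r s <= r by rewrite ge_min lexx.
  have ms : Num.min r s <= s by rewrite ge_min lexx orbT.
  exists (p + h); last by rewrite addrC addKr hE; lra.
  apply: Hs; last by rewrite addrC addKr hE; lra.
  by rewrite -subr_eq0 addrC addKr -cabs_gt0 hE; lra.
move=> X lX p Dp; have [r r0 Hr] := H p Dp.
have lX' : locally_constant (fun z => z != p /\ cabs (z - p) < r) X.
  by apply: locally_constant_sub lX => z [zp zr]; exact: Hr.
have [D'p|nD'p] := pselect (D' p); last first.
  exists r => // z w D'z D'w zr wr; apply: (connected_punctured lX'); split=> //.
    by apply: contra_notN nD'p => /eqP <-.
  by apply: contra_notN nD'p => /eqP <-.
have [s s0 Hs] := lX p D'p; exists s => // z w D'z D'w zs ws.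
by move/(Hs z D'z zs)/(Hs w D'w ws).
Qed.

(** Vanishing in a neighbourhood is a locally constant predicate, since otherwise zeros are
    isolated. *)
Lemma identity_theorem D f : connected_dom D -> (forall z, D z -> analytic_at f z) ->
  forall q (r : R), D q -> 0 < r -> (forall z, cabs (z - q) < r -> f z = 0) ->
  forall p, D p -> exists2 s : R, 0 < s & forall z, cabs (z - p) < s -> f z = 0.
Proof.
move=> cD af q r Dq r0 fq p Dp.
pose X u := exists2 s : R, 0 < s & forall z, cabs (z - u) < s -> f z = 0.
apply: (cD X _ q p) => //; last by exists r.
move=> u Du; have [[s s0 Hs]|[s s0 Hs]] := analytic_zeros (af u Du).
  exists s => // z _ zs; split=> _; first by exists s.
  exists (s - cabs (z - u)); first by rewrite subr_gt0.
  by move=> w wz; apply: Hs; apply: le_lt_trans (cabs_dist z _ _) _; lra.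
exists s => // z _ zs; split; last first.
  move=> [t t0 Ht]; exfalso.
  have m0 : 0 < Num.min s t by rewrite lt_min s0.
  pose h := (Num.min s t / 2)%:C : C.
  have hE : cabs h = Num.min s t / 2 by rewrite cabsC ger0_norm//; lra.
  have mr : Num.min s t <= s by rewrite ge_min lexx.
  have ms : Num.min s t <= t by rewrite ge_min lexx orbT.
  have hu : u + h - u = h by rewrite addrC addKr.
  have : f (u + h) != 0.
    by apply: Hs; rewrite ?hu ?hE; [rewrite -subr_eq0 hu -cabs_gt0 hE|]; lra.
  by rewrite Ht ?eqxx// hu hE; lra.
move=> [t t0 Ht]; exfalso.
pose m := Num.min t (s - cabs (z - u)).
have m0 : 0 < m by rewrite lt_min t0 subr_gt0.
have mt : m <= t by rewrite ge_min lexx.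
have ms : m <= s - cabs (z - u) by rewrite ge_min lexx orbT.
have [h [hm hu]] : exists h : C, cabs h < m /\ z + h != u.
  have hE : cabs ((m / 2)%:C : C) = m / 2 by rewrite cabsC ger0_norm//; lra.
  have [zu|zu] := eqVneq z u.
    exists (m / 2)%:C; rewrite hE; split; first lra.
    by rewrite zu -subr_eq0 addrC addKr -cabs_gt0 hE; lra.
  by exists 0; rewrite cabs0 addr0.
have hz : z + h - z = h by rewrite addrC addKr.
have : f (z + h) != 0.
  by apply: Hs => //; apply: le_lt_trans (cabs_dist z _ _) _; rewrite hz; lra.
by rewrite Ht ?eqxx// hz; lra.
Qed.

End Connected.

(** * The complex exponential *)

Section Exponential.
Variable R : realType.
Local Notation C := R[i].

Definition cexp (z : C) : C := (expR (Re z))%:C * (cos (Im z) +i* sin (Im z)).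

Lemma cexpD (z w : C) : cexp (z + w) = cexp z * cexp w.
Proof.
rewrite /cexp ReD ImD expRD realCM cosD sinD mulrACA; congr (_ * _).
by apply: complex_eq; rewrite ?Re_mul ?Im_mul /=; ring.
Qed.

Lemma cexp_real (x : R) : cexp x%:C = (expR x)%:C.
Proof.
rewrite /cexp /= cos0 sin0; have -> : 1 +i* 0 = 1 :> C by [].
by rewrite mulr1.
Qed.

Lemma cexp0 : cexp 0 = 1.
Proof. by have := cexp_real 0; rewrite expR0. Qed.

Lemma cabs_cexp (z : C) : cabs (cexp z) = expR (Re z).
Proof.
rewrite /cexp cabsM cabsC ger0_norm ?expR_ge0// cabsE/= cos2Dsin2 sqrtr1.
by rewrite mulr1.
Qed.

Lemma cexp_neq0 (z : C) : cexp z != 0.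
Proof. by rewrite -cabs_gt0 cabs_cexp expR_gt0. Qed.

Section Remainder.
Variable h : C.

(** The Taylor remainder of [cexp] along the segment from [0] to [h]; the derivative of [r n.+1] in
    [t] is [h * r n]. *)
Let r n (t : R) : C := cexp (t%:C * h) - \sum_(k < n) (t ^+ k / k`!%:R)%:C * h ^+ k.

Let rS n t : r n.+1 t = r n t - (t ^+ n / n`!%:R)%:C * h ^+ n.
Proof. by rewrite /r big_ord_recr/= opprD addrA. Qed.

Let derive_part (L : C -> R) :
  (forall z w, L (z - w) = L z - L w) -> (forall (t : R) z, L (t%:C * z) = t * L z) ->
  (forall t : R, is_derive t 1 (fun t : R => L (r 0 t)) (L (h * r 0 t))) ->
  forall n (t : R), is_derive t 1 (fun t : R => L (r n.+1 t)) (L (h * r n t)).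
Proof.
move=> LB LZ L0.
have fE n : (fun t : R => L (r n.+1 t)) =
    (fun t : R => L (r n t)) - (L (h ^+ n) / n`!%:R) *: (id ^+ n : R -> R).
  by apply/funext => t /=; rewrite rS LB LZ !fctE/=; congr (_ - _); rewrite /GRing.scale/=; ring.
elim=> [|n IH] t.
  rewrite fE; apply: is_derive_eq (is_deriveB (L0 t) (is_deriveZ _ (is_deriveX 0 (is_derive_id _ _)))) _.
  by rewrite mul0r scale0r scaler0 subr0.
rewrite fE; apply: is_derive_eq (is_deriveB (IH t) (is_deriveZ _ (is_deriveX n.+1 (is_derive_id _ _)))) _.
have e : h * ((t ^+ n / n`!%:R)%:C * h ^+ n) = (t ^+ n / n`!%:R)%:C * h ^+ n.+1.
  by rewrite exprS mulrCA.
have -> : h * r n.+1 t = h * r n t - (t ^+ n / n`!%:R)%:C * h ^+ n.+1.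
  by rewrite rS -e -mulrBr.
rewrite [in RHS]LB LZ /GRing.scale/= factS natrM.
by field; rewrite pnatr_eq0 -lt0n fact_gt0 nat1r pnatr_eq0.
Qed.

Let derive0 (a b t : R) :
  is_derive t 1 (fun t : R => expR (a * t) * cos (b * t))
    (a * (expR (a * t) * cos (b * t)) - b * (expR (a * t) * sin (b * t))) /\
  is_derive t 1 (fun t : R => expR (a * t) * sin (b * t))
    (a * (expR (a * t) * sin (b * t)) + b * (expR (a * t) * cos (b * t))).
Proof.
have lin k : is_derive t 1 (k *: (id : R -> R)) k.
  by apply: is_derive_eq (is_deriveZ _ (is_derive_id _ _)) _; rewrite /GRing.scale/= mulr1.
have de := is_derive1_comp (is_derive_expR _) (lin a).
have dc := is_derive1_comp (is_derive_cos _) (lin b).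
have ds := is_derive1_comp (is_derive_sin _) (lin b).
split.
  by apply: is_derive_eq (is_deriveM de dc) _; rewrite /GRing.scale/=; ring.
by apply: is_derive_eq (is_deriveM de ds) _; rewrite /GRing.scale/=; ring.
Qed.

Let r0E t : Re (r 0 t) = expR (Re h * t) * cos (Im h * t) /\
  Im (r 0 t) = expR (Re h * t) * sin (Im h * t).
Proof.
by rewrite /r big_ord0 subr0 /cexp !Re_scale !Im_scale/= ![t * _]mulrC.
Qed.

Let deriveRe n (t : R) : is_derive t 1 (fun t : R => Re (r n.+1 t)) (Re (h * r n t)).
Proof.
apply: derive_part => [z w|u z|u]; [exact: ReB|exact: Re_scale|].
have [d _] := derive0 (Re h) (Im h) u.
rewrite (_ : (fun t => _) = (fun t => expR (Re h * t) * cos (Im h * t))); last first.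
  by apply/funext => v; case: (r0E v).
by apply: is_derive_eq d _; rewrite Re_mul; have [-> ->] := r0E u.
Qed.

Let deriveIm n (t : R) : is_derive t 1 (fun t : R => Im (r n.+1 t)) (Im (h * r n t)).
Proof.
apply: derive_part => [z w|u z|u]; [exact: ImB|exact: Im_scale|].
have [_ d] := derive0 (Re h) (Im h) u.
rewrite (_ : (fun t => _) = (fun t => expR (Re h * t) * sin (Im h * t))); last first.
  by apply/funext => v; case: (r0E v).
by apply: is_derive_eq d _; rewrite Im_mul; have [-> ->] := r0E u; ring.
Qed.

(** The mean value theorem holds for real functions only. Applied separately to real and imaginary
    parts it costs a factor [2] at every order, hence [2 * cabs h]. *)
Lemma cexp_remainder n : cabs h <= 1 ->
  cabs (cexp h - \sum_(k < n) (k`!%:R^-1)%:C * h ^+ k) <= expR 1 * (2 * cabs h) ^+ n.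
Proof.
move=> h1.
suff H : forall t : R, 0 <= t <= 1 -> cabs (r n t) <= expR 1 * (2 * cabs h) ^+ n.
  have := H 1; rewrite ler01 lexx /r mul1r => /(_ isT).
  by under eq_bigr do rewrite expr1n div1r.
elim: n => [|n IH] t /andP[t0 t1].
  rewrite /r big_ord0 subr0 cabs_cexp expr0 mulr1 ler_expR Re_scale.
  have := le_trans (ler_norm _) (Re_le_cabs h) => rh.
  by have := ler_wpM2l t0 rh; nra.
have b s : s \in `[0, t] -> cabs (h * r n s) * t <= cabs h * (expR 1 * (2 * cabs h) ^+ n).
  rewrite in_itv/= => /andP[s0 st]; rewrite cabsM -[leRHS]mulr1 ler_pM// ?mulr_ge0 ?cabs_ge0//.
  by rewrite ler_wpM2l ?cabs_ge0// IH// s0/=; lra.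
have at0 : r n.+1 0 = 0.
  rewrite /r mul0r cexp0 big_ord_recl/= expr0 fact0 invr1 !mulr1 big1 ?addr0 ?subrr//.
  by move=> i _; rewrite /bump/= expr0n/= mul0r mul0r.
have [x xt e1] := @MVT_segment _ (fun t : R => Re (r n.+1 t)) (fun t => Re (h * r n t)) 0 t t0
  (fun x _ => deriveRe n x) (derivable_within_continuous (fun x _ => @ex_derive _ _ _ _ _ _ _ (deriveRe n x))).
have [y yt e2] := @MVT_segment _ (fun t : R => Im (r n.+1 t)) (fun t => Im (h * r n t)) 0 t t0
  (fun x _ => deriveIm n x) (derivable_within_continuous (fun x _ => @ex_derive _ _ _ _ _ _ _ (deriveIm n x))).
have e1' : Re (r n.+1 t) - Re (r n.+1 0) = Re (h * r n x) * (t - 0) := e1.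
have e2' : Im (r n.+1 t) - Im (r n.+1 0) = Im (h * r n y) * (t - 0) := e2.
rewrite at0 !subr0 in e1' e2'; move: e1' e2' => {}e1 {}e2.
apply: le_trans (cabs_le _) _; rewrite e1 e2 !normrM (ger0_norm t0).
have h2 := ler_wpM2r t0 (Re_le_cabs (h * r n x)).
have h3 := ler_wpM2r t0 (Im_le_cabs (h * r n y)).
by rewrite [in leRHS]exprS; have := b x xt; have := b y yt; lra.
Qed.

End Remainder.

Lemma tay_cexp : tay cexp (expR 1) 2.
Proof.
pose F n (h : C) : C := if h == 0 then (n`!%:R^-1)%:C else
  (cexp h - \sum_(k < n) (k`!%:R^-1)%:C * h ^+ k) / h ^+ n.
exists F; last first.
  move=> h _; rewrite /F big_ord0 expr0 subr0 divr1; case: eqP => // ->.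
  by rewrite cexp0 fact0 invr1.
split=> // n h hr; have [->|h0] := eqVneq h 0.
  rewrite mul0r addr0 /F eqxx; split=> //; rewrite cabsC ger0_norm ?invr_ge0//.
  apply: le_trans (_ : 1 <= _).
    by rewrite invf_le1 ?ltr0n ?fact_gt0// ler1n fact_gt0.
  rewrite -[leLHS]mulr1; apply: ler_pM => //; first by rewrite -[leLHS]expR0 ler_expR.
  by rewrite exprn_ege1// ler1n.
have hn : h ^+ n != 0 by rewrite expf_neq0.
split.
  by rewrite /F eqxx (negPf h0) big_ord_recr/= exprS; field; rewrite h0 hn pnatr_eq0 -lt0n fact_gt0.
rewrite /F (negPf h0) cabsM cabsV cabsX ler_pdivrMr ?exprn_gt0 ?cabs_gt0//.
by rewrite -mulrA -exprMn; apply: cexp_remainder; lra.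
Qed.

(** It has period ['i], which puts the poles of [tanh (pi * z)] at the points [(k + 1/2) * 'i]. *)
Definition e2pi (z : C) : C := cexp ((2 * pi)%:C * z).

Lemma pi2_gt0 : 0 < 2 * pi :> R.
Proof. by rewrite mulr_gt0// pi_gt0. Qed.

Lemma e2piD z w : e2pi (z + w) = e2pi z * e2pi w.
Proof. by rewrite /e2pi mulrDr cexpD. Qed.

Lemma e2pi0 : e2pi 0 = 1. Proof. by rewrite /e2pi mulr0 cexp0. Qed.

Lemma e2pi_neq0 z : e2pi z != 0. Proof. exact: cexp_neq0. Qed.

Lemma cabs_e2pi z : cabs (e2pi z) = expR (2 * pi * Re z).
Proof. by rewrite /e2pi cabs_cexp Re_scale. Qed.

Lemma e2pi_real (x : R) : e2pi x%:C = (expR (2 * pi * x))%:C.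
Proof. by rewrite /e2pi -realCM cexp_real. Qed.

Lemma tay_e2pi : tay e2pi (expR 1) (2 * cabs ((2 * pi)%:C : C)).
Proof.
apply: tay_dil tay_cexp; apply/eqP => /(congr1 (@complex.Re R))/=.
by have := pi2_gt0; lra.
Qed.

Lemma e2pi_i : e2pi 'i%C = 1.
Proof.
rewrite /e2pi /cexp Re_scale Im_scale/= mulr0 expR0 mulr1 mul1r.
by rewrite mulr_natl cos2pi sin2pi.
Qed.

Lemma e2pi_int (k : int) : e2pi (k%:~R * 'i%C) = 1.
Proof.
have nat n : e2pi (n%:R * 'i%C) = 1.
  elim: n => [|n IH]; first by rewrite mul0r e2pi0.
  by rewrite -addn1 natrD mulrDl mul1r e2piD IH e2pi_i mulr1.
case: k => n; first exact: nat.
rewrite NegzE rmorphN/= mulNr; apply: (mulfI (e2pi_neq0 (n.+1%:R * 'i%C))).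
by rewrite -e2piD subrr e2pi0 nat mulr1.
Qed.

(** The horizontal lines on which [e2pi] is real and negative, hence the only ones that carry poles
    of [th (y - s%:C)] with [s] real. *)
Definition half (y : C) : Prop := exists k : int, Im y = k%:~R + 2^-1.

Lemma e2pi_half y : half y -> e2pi y = - (expR (2 * pi * Re y))%:C.
Proof.
move=> [k ky].
have yE : y = (Re y)%:C + (k%:~R * 'i%C + (2^-1)%:C * 'i%C).
  rewrite [LHS]complexE; congr (_ + _); rewrite ky realCD mulrDr ![_ * 'i%C]mulrC.
  by congr (_ + _); rewrite rmorph_int.
rewrite [in LHS]yE !e2piD e2pi_int e2pi_real mul1r.
have -> : e2pi ((2^-1)%:C * 'i%C) = -1.
  rewrite /e2pi mulrA -realCM mulrAC divff// mul1r /cexp Re_scale Im_scale/= mulr0 mulr1 expR0.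
  by rewrite cospi sinpi mul1r; apply: complex_eq => /=; rewrite ?oppr0.
by rewrite mulrN1.
Qed.

(** With [f] the fractional part of [Im y], the real part of the equation gives
    [cos (2 * pi * f) = -1], that is [cos (pi * f) = 0], which leaves only [f = 2^-1]. *)
Lemma e2pi_eqN y (a : R) : 0 < a -> e2pi y = - a%:C -> half y.
Proof.
move=> a0 E.
have aE : a = expR (2 * pi * Re y).
  by rewrite -cabs_e2pi E cabsN cabsC ger0_norm// ltW.
have : Re (e2pi y) = - a by rewrite E ReN.
rewrite /e2pi /cexp Re_mul Re_scale Im_scale -aE/= mul0r subr0 => ca.
have c1 : cos (2 * pi * Im y) = -1.
  by apply: (mulfI (lt0r_neq0 a0)); rewrite ca mulrN1.
pose k := Num.floor (Im y); pose f := Im y - k%:~R.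
have /andP[k0 k1] := floor_itv (Im y); rewrite -/k intrD in k1 k0.
have c2 : cos (2 * pi * f) = -1.
  have := e2pi_int k; rewrite /e2pi /cexp Re_scale Im_scale.
  have rk : (k%:~R : C) = (k%:~R : R)%:C by rewrite rmorph_int.
  rewrite rk Re_scale Im_scale/= !mulr0 !mulr1 expR0 mul1r => -[ck sk].
  have -> : 2 * pi * f = 2 * pi * Im y - 2 * pi * k%:~R by rewrite /f; ring.
  by rewrite cosB c1 ck sk; ring.
have c3 : cos (pi * f) = 0.
  move: c2; have -> : 2 * pi * f = (pi * f) *+ 2 by rewrite mulr2n; ring.
  rewrite cos_mulr2n => c2; apply/eqP; rewrite -sqrf_eq0; apply/eqP.
  by move: c2; rewrite mulr2n; lra.
exists k; suff : f = 2^-1 by rewrite /f; lra.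
have f0 : 0 <= f by rewrite /f; lra.
have f1 : f <= 1 by rewrite /f; lra.
have p0 := pi_gt0 R.
have : pi * f = pi / 2.
  apply: cos_inj; rewrite ?in_itv/= ?cos_pihalf//.
    by apply/andP; split; [rewrite mulr_ge0// ltW|rewrite ger_pMr].
  by apply/andP; split; lra.
by move/(mulfI (lt0r_neq0 p0)).
Qed.

Definition th (z : C) : C := 1 - 2 / (1 + e2pi z).

Lemma th_real (x : R) : th x%:C = (tanh (pi * x))%:C.
Proof.
rewrite /th e2pi_real /tanh.
have -> : expR (2 * pi * x) = expR (pi * x) * expR (pi * x).
  by rewrite -expRD; congr expR; ring.
rewrite expRN; have e0 := expR_gt0 (pi * x).
have E (X : R) : 1 - 2 / (1 + X%:C) = (1 - 2 / (1 + X))%:C.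
  by rewrite realCB realCM realCV !realCD.
rewrite E.
congr (_%:C); field.
by rewrite gt_eqF//= gt_eqF ?addr_gt0 ?mulr_gt0// gt_eqF ?addr_gt0 ?mulr_gt0.
Qed.

Lemma th_half y x : half y -> th (y + x) = 1 - 2 / (1 - (expR (2 * pi * Re y))%:C * e2pi x).
Proof. by move=> hy; rewrite /th e2piD e2pi_half// mulNr. Qed.

(* The Taylor data are uniform over all points at which the denominator of
   [th] is bounded away from [0]. *)
Lemma tay_th (d : R) : 0 < d -> exists M rho : R, [/\ 0 <= M, 0 < rho &
  forall y, d <= cabs (1 + e2pi y) -> tay (fun h => th (y + h)) M rho].
Proof.
move=> d0; set r1 := 2 * cabs ((2 * pi)%:C : C); pose L := 2 / d + 2.
have te := tay_e2pi; rewrite -/r1 in te.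
have r10 := tay_gt0 te.
have L0 : 0 <= L by rewrite addr_ge0// divr_ge0// ltW.
have e10 : 0 < expR 1 :> R by exact: expR_gt0.
pose W := 1 + L * (expR 1 + 1).
have W0 : 0 <= W by rewrite addr_ge0// mulr_ge0// addr_ge0// ltW.
exists (1 + 2 / d * 2), (4 * (1 + W) * r1 + 2 * r1); split.
- by rewrite addr_ge0// mulr_ge0// divr_ge0// ltW.
- by have := mulr_ge0 W0 (ltW r10); lra.
move=> y dy; set Q := e2pi y.
have Q1 : 1 + Q != 0 by rewrite -cabs_gt0; apply: lt_le_trans dy.
(* [1 + e2pi (y + h) = (1 + Q) * (1 + la * (e2pi h - 1))]. The factor [la] stays bounded even where
   [Q] is large, which makes the data uniform in [y]. *)
pose la := Q / (1 + Q).
have laL : cabs la <= L.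
  rewrite /la cabsM cabsV /L.
  have q0 := cabs_ge0 Q.
  have [q2|q2] := leP (cabs Q) 2.
    apply: le_trans (_ : 2 / d <= _); last by lra.
    by apply: ler_pM => //; rewrite ?invr_ge0 ?cabs_ge0// lef_pV2 ?posrE//; apply: lt_le_trans dy.
  apply: le_trans (_ : 2 <= _); last by rewrite lerDr divr_ge0// ltW.
  rewrite ler_pdivrMr ?cabs_gt0//.
  by have := cabsD_ge Q 1; rewrite cabs1 [Q + 1]addrC; lra.
have tw : tay (fun h => 1 + la * (e2pi h + - 1)) W r1.
  have := tayD (tay_cst 1 r10) (tayZ la (tayD te (tay_cst (-1) r10))).
  move=> /tay_weaken; apply => //; rewrite cabsN !cabs1 lerD2l.
  by apply: ler_wpM2r laL; rewrite addr_ge0// ltW.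
have := tay_inv tw ltr01; rewrite e2pi0 subrr mulr0 addr0 cabs1 !divr1 => /(_ (lexx _)) ti.
have rE : 4 * (1 + W) * r1 + 2 * r1 > 0.
  by have := mulr_ge0 W0 (ltW r10); lra.
have := tayD (tay_cst 1 rE) (tayZ (- (2 / (1 + Q))) ti).
move=> /(@tay_weaken _ _ _ _ (1 + 2 / d * 2) (4 * (1 + W) * r1 + 2 * r1)) H.
apply: tay_ext (H _ (lexx _)) _ => [|h _].
  rewrite cabs1 cabsN lerD2l ler_wpM2r// cabsM cabsV cabs_nat ler_wpM2l//.
  by rewrite lef_pV2 ?posrE ?cabs_gt0.
rewrite /th e2piD -/Q mulNr; congr (_ - _); rewrite -mulrA; congr (_ * _).
rewrite -invfM; congr (_^-1); rewrite /la; field.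
exact: Q1.
Qed.

End Exponential.

(** * The nonlinearity on the complex plane *)

Section Sigma.
Variables (R : realType) (C0 : R) (S : set R) (c : R -> R).
Local Notation C := R[i].
Local Open Scope fset_scope.
Local Open Scope ring_scope.

(** Extension by zero turns sums over [S] into sums over the whole line, without a subtype of
    indices. *)
Definition cS (s : R) : R := if `[< S s >] then c s else 0.

Lemma cS_in s : S s -> cS s = c s. Proof. by move=> Ss; rewrite /cS asboolT. Qed.
Lemma cS_out s : ~ S s -> cS s = 0. Proof. by move=> Ss; rewrite /cS asboolF. Qed.

Lemma fset_sum_esum (g : R -> R) (B : {fset R}) : (forall s, 0 <= g s) ->
  ((\sum_(s <- B) (if `[< S s >] then g s else 0))%:E <= \esum_(s in S) (g s)%:E)%E.
Proof.
move=> g0; apply: esum_ge.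
pose B' := [fset s in B | `[< S s >]].
exists [set` B']%classic.
  by split; [exact: finite_fset|move=> s /=; rewrite !inE => /andP[_ /asboolP]].
rewrite fsbig_finite; last exact: finite_fset.
rewrite set_fsetK sumEFin lee_fin; apply: le_of_eq.
rewrite -big_mkcond/= -big_filter; apply: perm_big; apply: uniq_perm.
- by rewrite filter_uniq// fset_uniq.
- exact: fset_uniq.
- by move=> s; rewrite mem_filter !inE andbC.
Qed.

Lemma esum_is_sum (g : R -> R) : (forall s, 0 <= g s) ->
  (\esum_(s in S) (g s)%:E < +oo)%E ->
  is_sum (fun s => (if `[< S s >] then g s else 0)%:C)
    (fine (\esum_(s in S) (g s)%:E)%E)%:C.
Proof.
move=> g0 fin e e0; set E := (\esum_(s in S) _)%E.
have finE : E \is a fin_num by rewrite ge0_fin_numE// esum_ge0// => s _; rewrite lee_fin.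
have [x [X [Xf XS] <-] Hx] := ub_ereal_sup_adherent e0 finE.
exists (fset_set X) => B XB; rewrite -realC_sum -realCB cabsC.
have h1 := fset_sum_esum B g0; rewrite -/E -(fineK finE) lee_fin in h1.
rewrite -/(esum S (fun s => (g s)%:E)) -/E -(fineK finE) fsbig_finite// sumEFin in Hx.
rewrite -EFinB lte_fin in Hx.
have h2 : \sum_(s <- fset_set X) g s <= \sum_(s <- B) (if `[< S s >] then g s else 0).
  rewrite [leRHS](big_fsetID _ (mem (fset_set X)))/=.
  have -> : [fset s in B | s \in fset_set X] = fset_set X.
    apply/fsetP => i; rewrite !inE/= andbC.
    by case: (boolP (i \in fset_set X)) => // /(fsubsetP XB) ->.
  rewrite -[leLHS]addr0 lerD//; last by apply: sumr_ge0 => s _; case: ifP.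
  rewrite big_seq [leRHS]big_seq; apply: ler_sum => s sX.
  by rewrite asboolT//; apply: XS; move: sX; rewrite in_fset_set// inE.
by rewrite ler0_norm ?subr_le0//; lra.
Qed.

Hypothesis c_l1 : summable S (fun s => (c s)%:E).

Lemma cS_summable : exists2 K : R, 0 <= K & abs_summable (fun s => (cS s)%:C : C) K.
Proof.
pose E := (\esum_(s in S) `|(c s)%:E|)%E.
have E0 : (0 <= E)%E by apply: esum_ge0.
have finE : E \is a fin_num by rewrite ge0_fin_numE.
exists (fine E); first exact: fine_ge0.
move=> A; have := @fset_sum_esum (fun s => `|c s|) A (fun=> normr_ge0 _).
rewrite -[X in (_ <= X)%E]/E -(fineK finE) lee_fin; apply: le_trans; apply: ler_sum => s _.
by rewrite cabsC /cS; case: ifP => _; rewrite ?normr0.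
Qed.

(** Links the sum used in the statement, a difference of two extended non-negative sums, with
    [is_sum]. *)
Lemma rsum_is_sum (f : R -> R) : (forall s, `|f s| <= `|c s|) ->
  is_sum (fun s => (if `[< S s >] then f s else 0)%:C : C) (rsum S f)%:C.
Proof.
move=> fc.
have pE : (EFin \o f)^\+%E = (fun s => (Num.max (f s) 0)%:E).
  by apply/funext => s; rewrite funepos.unlock /= EFin_max.
have nE : (EFin \o f)^\-%E = (fun s => (Num.max (- f s) 0)%:E).
  by apply/funext => s; rewrite funeneg.unlock /= EFin_max.
have bnd (g : R -> R) : (forall s, g s <= `|f s|) -> (\esum_(s in S) (g s)%:E < +oo)%E.
  move=> gf; apply: le_lt_trans c_l1; apply: le_esum => s _.
  by rewrite lee_fin; apply: le_trans (gf s) (fc s).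
have bp : (\esum_(s in S) (Num.max (f s) 0)%:E < +oo)%E.
  by apply: bnd => s; rewrite ge_max normr_ge0 ler_norm.
have bn : (\esum_(s in S) (Num.max (- f s) 0)%:E < +oo)%E.
  by apply: bnd => s; rewrite ge_max normr_ge0 -normrN ler_norm.
have m0 (a : R) : 0 <= Num.max a 0 by rewrite le_max lexx orbT.
have hp := esum_is_sum (fun s => m0 (f s)) bp.
have hn := esum_is_sum (fun s => m0 (- f s)) bn.
have := is_sumD hp (is_sumZ (-1) hn).
have -> : (rsum S f)%:C = (fine (\esum_(s in S) (Num.max (f s) 0)%:E)%E)%:C +
    -1 * (fine (\esum_(s in S) (Num.max (- f s) 0)%:E)%E)%:C :> C.
  by rewrite /rsum pE nE realCB mulN1r.
apply: is_sum_eq => s; rewrite mulN1r -realCB; congr (_%:C).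
case: ifP => _; last by rewrite subr0.
have [f0|f0] := leP 0 (f s).
  rewrite (_ : Num.max (- f s) 0 = 0) ?subr0//.
  by apply/max_idPr; rewrite oppr_le0.
rewrite (_ : Num.max (- f s) 0 = - f s) ?sub0r ?opprK//.
by apply/max_idPl; rewrite oppr_ge0 ltW.
Qed.

Definition sigC (y : C) : C := C0%:C + csum (fun s => (cS s)%:C * th (y - s%:C)).

Lemma tanh_le1 (x : R) : `|tanh x| <= 1.
Proof.
rewrite /tanh; have a := expR_gt0 x; have b := expR_gt0 (- x).
rewrite normrM normfV ler_pdivrMr ?mul1r ?normr_gt0 ?gt_eqF ?addr_gt0//.
by rewrite [leRHS]gtr0_norm ?addr_gt0// ler_norml; apply/andP; split; lra.
Qed.

Lemma sigC_real (x : R) : sigC x%:C = (tanh_series C0 S c x)%:C.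
Proof.
rewrite /sigC /tanh_series realCD; congr (_ + _); apply: csumE.
have := @rsum_is_sum (fun s => c s * tanh (pi * (x - s))).
move=> H; apply: is_sum_eq (H _) => s.
  by rewrite -realCB th_real -realCM /cS; case: ifP => _; rewrite ?mul0r.
by rewrite normrM ler_piMr// tanh_le1.
Qed.

(** The complement of the closure of the poles. On the lines [half], the distance from [Re y] to [S]
    has to be positive; [Re y] outside [S] would be too weak, since [S] may accumulate there. *)
Definition reg (y : C) : Prop := ~ half y \/
  exists2 d : R, 0 < d & forall s, S s -> d <= `|Re y - s|.

Lemma nhalf_nbhd (y : C) : ~ half y ->
  exists2 d : R, 0 < d & forall z, `|Im z - Im y| < d -> ~ half z.
Proof.
move=> hy; pose k := Num.floor (Im y - 2^-1).
have /andP[k0 k1] := floor_itv (Im y - 2^-1); rewrite -/k intrD in k0 k1.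
have k0' : k%:~R + 2^-1 != Im y by apply/eqP => E; apply: hy; exists k.
pose d := Num.min (Im y - (k%:~R + 2^-1)) (k%:~R + 1 + 2^-1 - Im y).
have d0 : 0 < d.
  rewrite lt_min !subr_gt0 lt_def eq_sym k0'/=; apply/andP; split; lra.
have d1 : d <= Im y - (k%:~R + 2^-1) by rewrite ge_min lexx.
have d2 : d <= k%:~R + 1 + 2^-1 - Im y by rewrite ge_min lexx orbT.
exists d => // z; rewrite ltr_norml => /andP[z1 z2] [m mz].
have : (k < m)%R by rewrite -(ltr_int R); lra.
by rewrite -lezD1 -(ler_int R) intrD; lra.
Qed.

Lemma half_discrete (y z : C) : half y -> half z -> `|Im z - Im y| < 1 -> Im z = Im y.
Proof.
move=> [k ->] [m ->]; have -> : m%:~R + 2^-1 - (k%:~R + 2^-1) = (m - k)%:~R :> R.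
  by rewrite intrB; ring.
rewrite -intr_norm -[X in _ < X]/(1%:~R) ltr_int => h; congr (_%:~R + _).
by apply/eqP; rewrite -subr_eq0 -normr_eq0; move: h; case: (`|m - k|) (normr_ge0 (m - k)) => [[|n]|n].
Qed.

Lemma reg_open (y : C) : reg y ->
  exists2 d : R, 0 < d & forall z, cabs (z - y) < d -> reg z.
Proof.
move=> [/nhalf_nbhd[d d0 H]|[d d0 H]].
  exists d => // z zd; left; apply: H; rewrite -ImB.
  exact: le_lt_trans (Im_le_cabs _) zd.
have d2 : 0 < d / 2 by lra.
exists (d / 2) => // z zd; right; exists (d / 2) => // s Ss.
have := H s Ss; have := Re_le_cabs (z - y); rewrite ReB.
have := ler_normD (Re z - s) (- (Re z - Re y)); rewrite normrN.
have -> : Re z - s - (Re z - Re y) = Re y - s by ring.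
by lra.
Qed.

Lemma real_reg (x : R) : reg x%:C.
Proof.
left => -[k /=] E; have : (2 * k + 1)%:~R = 0 :> R by rewrite intrD intrM; lra.
move/eqP; rewrite intr_eq0 => /eqP.
case: k {E} => [n|n]; last by rewrite NegzE; lia.
lia.
Qed.

Lemma den_half (y : C) (d : R) : half y -> 0 < d -> d <= `|Re y| ->
  1 - expR (- (2 * pi * d)) <= cabs (1 + e2pi y).
Proof.
move=> hy d0 dy; rewrite (e2pi_half hy).
have -> : 1 - (expR (2 * pi * Re y))%:C = (1 - expR (2 * pi * Re y))%:C :> C.
  by rewrite realCB.
rewrite cabsC; have p0 := pi2_gt0 R.
have q : expR (- (2 * pi * d)) * expR (2 * pi * d) = 1.
  by rewrite -expRD addNr expR0.
have e1 : 1 <= expR (2 * pi * d) by rewrite -[leLHS]expR0 ler_expR mulr_ge0// ltW.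
have [y0|y0] := leP 0 (Re y).
  have : expR (2 * pi * d) <= expR (2 * pi * Re y).
    by rewrite ler_expR ler_pM2l//; move: dy; rewrite ger0_norm.
  have e2 : 0 <= expR (- (2 * pi * d)) by exact: expR_ge0.
  by rewrite distrC; have := ler_norm (expR (2 * pi * Re y) - 1); nra.
have : expR (2 * pi * Re y) <= expR (- (2 * pi * d)).
  rewrite ler_expR -mulrN ler_pM2l//; move: dy; rewrite ltr0_norm//; lra.
by have := ler_norm (1 - expR (2 * pi * Re y)); lra.
Qed.

Lemma den_half_gt0 (d : R) : 0 < d -> 0 < 1 - expR (- (2 * pi * d)).
Proof. by move=> d0; rewrite subr_gt0 expR_lt1 oppr_lt0 mulr_gt0// pi2_gt0. Qed.

Lemma half_sub (y : C) (s : R) : half (y - s%:C) <-> half y.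
Proof. by rewrite /half ImB/= subr0. Qed.

(** As [s] varies, [e2pi (y - s%:C)] runs along an open ray from the origin that misses [-1]. Its
    distance from [-1] is at least the modulus of [sin b] if the ray is not real, and at least [1]
    if it is the positive axis. *)
Lemma den_nhalf (y : C) : ~ half y ->
  exists2 d : R, 0 < d & forall s : R, d <= cabs (1 + e2pi (y - s%:C)).
Proof.
move=> hy; pose b := 2 * pi * Im y.
have eE s : e2pi (y - s%:C) = (expR (2 * pi * (Re y - s)))%:C * (cos b +i* sin b).
  by rewrite /e2pi /cexp Re_scale Im_scale ReB ImB/= subr0.
have cb := cos2Dsin2 b.
have [sb|sb] := eqVneq (sin b) 0; last first.
  exists `|sin b|; first by rewrite normr_gt0.
  move=> s; rewrite eE; set r := expR _.
  rewrite cabsE -sqrtr_sqr ler_sqrt ?addr_ge0 ?sqr_ge0//.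
  rewrite ReD ImD Re_scale Im_scale/=.
  have := sqr_ge0 (r + cos b); move: cb; rewrite !expr2; nra.
exists 1 => // s; rewrite eE sb; set r := expR _.
have r0 : 0 < r by exact: expR_gt0.
have : (cos b - 1) * (cos b + 1) = 0 by move: cb; rewrite sb !expr2; lra.
move/eqP; rewrite mulf_eq0 => /orP[/eqP|/eqP] cb1; last first.
  case: hy; apply/(half_sub y s); apply: (e2pi_eqN r0).
  rewrite eE sb -/r; have -> : cos b = -1 by lra.
  by apply: complex_eq; rewrite ?Re_scale ?Im_scale ?ReN ?ImN/=; ring.
have -> : cos b = 1 by lra.
apply: le_trans (Re_le_cabs _); rewrite ReD Re_scale/=.
by apply: le_trans (ler_norm _); lra.
Qed.

Lemma den_reg (y : C) : reg y -> exists2 d : R, 0 < d &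
  forall s, S s -> d <= cabs (1 + e2pi (y - s%:C)).
Proof.
move=> ry; have [hy|/den_nhalf[d d0 H]] := pselect (half y); last by exists d.
case: ry => [//|[d d0 H]]; exists (1 - expR (- (2 * pi * d))); first exact: den_half_gt0.
move=> s Ss; apply: den_half => //; first exact/half_sub.
by rewrite ReB/=; exact: H.
Qed.

Lemma cS_S s : cS s != 0 -> S s.
Proof. by rewrite /cS; case: asboolP => //; rewrite eqxx. Qed.

Lemma realC_eq0 (x : R) : (x%:C == 0 :> C) = (x == 0).
Proof. by rewrite -cabs_eq0 cabsC normr_eq0. Qed.

Lemma sigC_is_sum (y : C) : reg y ->
  is_sum (fun s => (cS s)%:C * th (y - s%:C)) (csum (fun s => (cS s)%:C * th (y - s%:C))).
Proof.
move=> /den_reg[d d0 H]; have [M [rho [M0 r0 Ht]]] := tay_th d0.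
have [K K0 sK] := cS_summable.
apply: (@csumP _ _ _ (M * K)); apply: abs_summable_le sK => // s.
have [->|cs] := eqVneq (cS s) 0; first by rewrite mul0r cabs0 mulr0.
have := tay_bound (Ht _ (H s (cS_S cs))) (disc0 rho); rewrite addr0 => b.
by rewrite cabsM mulrC ler_wpM2r ?cabs_ge0.
Qed.

Lemma sigC_analytic (y : C) : reg y -> analytic_at sigC y.
Proof.
move=> /den_reg[d d0 H]; have [M [rho [M0 r0 Ht]]] := tay_th d0.
have [K K0 sK] := cS_summable.
have hc s : (cS s)%:C != 0 :> C -> tay (fun h => th (y - s%:C + h)) M rho.
  by rewrite realC_eq0 => /cS_S Ss; apply: Ht; exact: H.
have [t _] := tay_csum r0 M0 hc sK.
apply: (tay_analytic (M := cabs (C0%:C : C) + M * K) (rho := rho)).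
apply: tay_ext (tayD (tay_cst C0%:C r0) t) _ => h _.
by rewrite /sigC; congr (_ + csum _); apply/funext => s; rewrite addrAC.
Qed.

End Sigma.

(** * Local expansion of the composite at a singular point *)

Section LocalExpansion.
Variables (R : realType) (C0 : R) (S : set R) (c : R -> R).
Hypothesis c_l1 : summable S (fun s => (c s)%:E).
Local Notation C := R[i].
Local Notation cS := (cS S c).
Local Notation sigC := (sigC C0 S c).

Lemma sigC_def y : sigC y = C0%:C + csum (fun s => (cS s)%:C * th (y - s%:C)).
Proof. by []. Qed.

(** The function [coth (pi * x)]: [th] seen from one of its poles. *)
Definition cth (x : C) : C := 1 - 2 / (1 - e2pi x).

Lemma e2pi_cderiv0 : is_cderiv (@e2pi R) 0 (2 * pi)%:C.
Proof.
move=> e e0; have p0 := pi2_gt0 R.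
have K0 : 0 <= expR 1 * 4 * (2 * pi) * (2 * pi) :> R.
  by rewrite !mulr_ge0 ?expR_ge0 ?pi_ge0.
have r0 : 0 < (2 * pi)^-1 :> R by rewrite invr_gt0.
have [s [s0 sr Ks]] := small_radius K0 e0 r0.
exists s => // z; rewrite subr0 => zs; rewrite e2pi0 /e2pi.
have zE : cabs ((2 * pi)%:C * z) = 2 * pi * cabs z by rewrite cabsM cabsC ger0_norm// ltW.
have b : cabs ((2 * pi)%:C * z) <= 1.
  by rewrite zE -ler_pdivlMl// mulr1; lra.
have := cexp_remainder 2 b; rewrite !big_ord_recr big_ord0/= add0r expr0 expr1 !fact0 factS fact0 muln1.
rewrite invr1 !mul1r opprD addrA zE => /le_trans; apply.
have z0 := cabs_ge0 z.
have : expR 1 * 4 * (2 * pi) * (2 * pi) * cabs z * cabs z <= e * cabs z.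
  rewrite ler_wpM2r//; apply: le_trans Ks; rewrite ler_wpM2l// ltW//.
by apply: le_trans; apply: le_of_eq; rewrite expr2; ring.
Qed.

(** Write [e2pi x = 1 + x * u x] with [u 0 = 2 * pi]. The singular term is [2 / (x * u x)], and the
    expansion of [1 / u] splits off [1 / (pi * x)]. *)
Lemma cth_pole : exists phi (r : R), [/\ analytic_at phi 0, 0 < r &
  forall x : C, x != 0 -> cabs x < r -> cth x = (pi%:C)^-1 / x + phi x].
Proof.
have p0 := pi2_gt0 R.
have [u tu uE] := tay_shift (tay_e2pi R).
set rho := 2 * cabs _ in tu uE; have r0 := tay_gt0 tu.
have au : analytic_at u 0.
  by eexists; eexists; apply: tay_ext tu _ => h _; rewrite add0r.
have u0 : u 0 = (2 * pi)%:C.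
  apply: is_cderiv_unique e2pi_cderiv0 => e e0.
  have [s s0 Hs] := analytic_continuous au e0.
  exists (Num.min s rho^-1); first by rewrite lt_min s0 invr_gt0.
  move=> z; rewrite subr0 lt_min => /andP[zs zr].
  have zr' : rho * cabs z < 1 by rewrite -(mulfV (lt0r_neq0 r0)) ltr_pM2l.
  rewrite (uE z zr').
  have -> : e2pi 0 + z * u z - e2pi 0 - u 0 * z = z * (u z - u 0) by ring.
  rewrite cabsM mulrC ler_wpM2r ?cabs_ge0//.
  by apply: ltW; have := Hs z; rewrite subr0; apply.
have un : u 0 != 0 by rewrite u0 realC_eq0 gt_eqF.
have av := analytic_inv au un.
have [M [tau tv]] := av.
have [w tw wE] := tay_shift tv.
have t0 := tay_gt0 tw.
exists (fun x => 1 + 2 * w x), (Num.min rho^-1 tau^-1); split.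
- apply: analyticD; first exact: analytic_cst.
  apply: analyticZ; eexists; eexists; apply: tay_ext tw _ => h _; by rewrite add0r.
- by rewrite lt_min !invr_gt0 r0.
move=> x x0; rewrite lt_min => /andP[xr xt].
have xr' : rho * cabs x < 1 by rewrite -(mulfV (lt0r_neq0 r0)) ltr_pM2l.
have xt' : tau * cabs x < 1 by rewrite -(mulfV (lt0r_neq0 t0)) ltr_pM2l.
have := wE x xt'; rewrite !add0r u0 => E.
rewrite /cth (uE x xr') e2pi0.
have -> : 1 - (1 + x * u x) = - (x * u x) by ring.
rewrite invrN invfM E realCM.
have p1 : pi%:C != 0 :> C by rewrite realC_eq0 gt_eqF ?pi_gt0.
have two : (2 : R)%:C = 2 :> C by exact: rmorph_nat.
by rewrite two; move: (pi%:C : C) p1 => P p1; field; rewrite x0 p1.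
Qed.

Definition ct (y : C) : R := if `[< half y >] then cS (Re y) else 0.

(** [pi] times the residue of [sigC \o g] at [x], when [x] is an isolated singularity at which [g]
    is analytic and not critical. *)
Definition res (g : C -> C) (x : C) : C := (ct (g x))%:C / cderiv g x.

Lemma resE g x : res g x = (ct (g x))%:C / cderiv g x. Proof. by []. Qed.

Lemma ct_half y : ct y != 0 -> half y /\ S (Re y).
Proof. by rewrite /ct; case: asboolP; rewrite ?eqxx// => hy /cS_S. Qed.

Lemma th_cth (y0 y : C) (s : R) : half y0 ->
  th (y - s%:C) = cth (y - y0 - (s - Re y0)%:C).
Proof.
move=> hy; have -> : y - s%:C = y0 + (y - y0 - s%:C) by ring.
rewrite th_half// /cth -e2pi_real -e2piD; congr (1 - 2 / (1 - e2pi _)).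
by rewrite realCB; ring.
Qed.

(** Injectivity bounds a divided difference below except at [h = k], and [k] may be [0]; continuity
    recovers a bound at [0] with half the constant. *)
Lemma divdiff_lower (Q : C -> C) (M rho a rr : R) (k : C) : tay Q M rho -> 0 < a ->
  0 < rr -> (forall h, h != k -> cabs h < rr -> a <= cabs (Q h)) -> a / 2 <= cabs (Q 0).
Proof.
move=> tQ a0 rr0 H; have r0 := tay_gt0 tQ; have M0 := tay_ge0 tQ.
have K0 : 0 <= 2 * M * rho by rewrite !mulr_ge0// ltW.
have r2 : 0 < Num.min (2 * rho)^-1 (rr / 2).
  by rewrite lt_min invr_gt0; apply/andP; split; lra.
have a2 : 0 < a / 2 by lra.
have [s [s0 sr Ks]] := small_radius K0 a2 r2.
have sr1 : s <= (2 * rho)^-1 by apply: le_trans sr _; rewrite ge_min lexx.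
have sr2 : s <= rr / 2 by apply: le_trans sr _; rewrite ge_min lexx orbT.
have [h [hs hk]] : exists h : C, cabs h <= s /\ h != k.
  have [k0|k0] := eqVneq k 0; last by exists 0; rewrite cabs0 eq_sym k0 ltW.
  exists s%:C; rewrite cabsC gtr0_norm// k0 realC_eq0 gt_eqF//.
have hr : cabs h <= (2 * rho)^-1 by lra.
have h2 : rho * cabs h <= 2^-1.
  have := ler_wpM2l (ltW r0) hr; rewrite invfM mulrCA mulfV ?gt_eqF// mulr1//.
have z2 : rho * cabs 0 <= 2^-1 by rewrite cabs0 mulr0 invr_ge0.
have := tay_lip tQ h2 z2; rewrite subr0 => lip.
have hr1 : cabs h < rr by lra.
have := H h hk hr1; have := cabsD_ge (Q h) (- (Q h - Q 0)); rewrite cabsN.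
have -> : Q h - (Q h - Q 0) = Q 0 by ring.
have : 2 * M * rho * cabs h <= 2 * M * rho * s by rewrite ler_wpM2l.
by lra.
Qed.

(* The poles of [sigC \o g] may accumulate at [p], so the sum is split pole by
   pole: if [g x] is the pole attached to [s], then
   [1 / (g z - g x) = 1 / (g' x * (z - x))] up to a function of [z] whose Taylor
   bounds are uniform in [x]. *)
Lemma local_expansion g p : analytic_at g p -> cderiv g p != 0 ->
  exists2 R0 : R, 0 < R0 & forall r0 : R, 0 < r0 -> r0 <= R0 ->
    exists h (r : R), [/\ analytic_at h p, 0 < r &
      forall z, cabs (z - p) < r -> reg S (g z) ->
        is_sum (fun x => (pi%:C)^-1 * (if cabs (x - p) < r0 then res g x else 0) / (z - x))
          (sigC (g z) - h z)].
Proof.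
move=> ag dg; have [hy|hy] := pselect (half (g p)); last first.
  have [d d0 Hd] := nhalf_nbhd hy; have [r r0 Hr] := analytic_continuous ag d0.
  have nh x : cabs (x - p) < r -> ~ half (g x).
    by move=> /Hr gx; apply: Hd; rewrite -ImB; apply: le_lt_trans (Im_le_cabs _) gx.
  exists r => // r1 r10 r1r; exists (fun z => sigC (g z)), 1; split=> //.
    by apply: analytic_comp ag _; apply: sigC_analytic => //; left.
  move=> z _ _; rewrite subrr; have := @is_sum0 R C; apply: is_sum_eq => x.
  case: ifPn => xr; last by rewrite mulr0 mul0r.
  rewrite /res /ct asboolF ?mul0r ?mulr0 ?mul0r//; apply: nh; lra.
have [L [ri [L0 ri0 inj sur]]] := inverse_function ag dg.
set y0 := g p in hy sur.
pose ga z := g z - y0.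
have [M [rho tg0]] := ag; have rho0 := tay_gt0 tg0.
have tg := tayD tg0 (tay_cst (- y0) rho0).
set Mg := M + _ in tg.
have Mg0 := tay_ge0 tg.
have aga : analytic_at ga p by apply: analyticB ag (analytic_cst _ _).
have [phi [rp [aphi rp0 phiE]]] := cth_pole.
have [Mp [rop tphi]] := aphi; have rop0 := tay_gt0 tphi.
pose a := L^-1; have a0 : 0 < a by rewrite invr_gt0.
pose a2 := a / 2; have a20 : 0 < a2 by rewrite /a2; lra.
have rho0' := ltW rho0; have a20' := ltW a20.
(* The rate that [tay_inv] yields for the inverse of a divided difference of [g] bounded below by
   [a2]; it is common to all poles. *)
pose ro2 := 4 * (1 + 2 * Mg * rho / a2) * (2 * rho) + 2 * (2 * rho).
have ro20 : 0 < ro2.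
  have : 0 <= 2 * Mg * rho / a2 * rho by rewrite !mulr_ge0 ?invr_ge0.
  by rewrite /ro2; lra.
have ro2r : 2 * (2 * rho) <= ro2.
  have : 0 <= 2 * Mg * rho / a2 * rho by rewrite !mulr_ge0 ?invr_ge0.
  by rewrite /ro2; lra.
pose em := Num.min (Num.min 1 (rp / 2)) (8 * rop)^-1.
have em0 : 0 < em by rewrite !lt_min ltr01 invr_gt0/=; apply/andP; split; lra.
have [rc rc0 Hc] := analytic_continuous aga em0.
have em1 : em <= 1 by rewrite !ge_min lexx.
have emp : em <= rp / 2 by rewrite !ge_min lexx orbT.
have em8 : em <= (8 * rop)^-1 by rewrite ge_min lexx orbT.
have gap : ga p = 0 by rewrite /ga subrr.
pose R0 := Num.min (Num.min rc (Num.min ri (rho + rho)^-1)) (2 * ro2)^-1.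
have R00 : 0 < R0 by rewrite !lt_min rc0 ri0 !invr_gt0/=; apply/andP; split; lra.
have R0c : R0 <= rc by rewrite !ge_min lexx.
have R0i : R0 <= ri by rewrite !ge_min lexx !orbT.
have R02 : R0 <= (2 * ro2)^-1 by rewrite ge_min lexx orbT.
exists R0 => // r0 r00 r0R.
(* The abscissas [s] whose point on the line of [y0] has a preimage within [r0] of [p], namely
   [xs s]. All others are at distance at least [dl] from [Re y0], and their terms add up to an
   analytic function. *)
pose A s := exists2 x, cabs (x - p) < r0 & ga x = (s - Re y0)%:C.
have /choice[xs Hxs] : forall s, exists x, A s -> cabs (x - p) < r0 /\ ga x = (s - Re y0)%:C.
  move=> s; have [[x ? ?]|nA] := pselect (A s); first by exists x.
  by exists 0.
have [K K0 sK] := cS_summable c_l1.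
pose dl := Num.min r0 ri / L.
have dl0 : 0 < dl by rewrite divr_gt0// lt_min r00.
have nA s : ~ A s -> dl <= `|s - Re y0|.
  move=> nAs; rewrite leNgt; apply/negP => sd; apply: nAs.
  have yE : cabs (y0 + (s - Re y0)%:C - y0) = `|s - Re y0| by rewrite addrC addKr cabsC.
  have Ls : L * `|s - Re y0| < Num.min r0 ri by rewrite mulrC -ltr_pdivlMr.
  have mi1 : Num.min r0 ri <= r0 by rewrite ge_min lexx.
  have mi2 : Num.min r0 ri <= ri by rewrite ge_min lexx orbT.
  have [|x xp xE] := sur (y0 + (s - Re y0)%:C); first by rewrite yE; lra.
  exists x; first by rewrite yE in xp; lra.
  by rewrite /ga xE addrC addKr.
have [M1 [r1 [M10 r10 Ht1]]] := tay_th (den_half_gt0 dl0).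
pose c1 s : C := (if `[< A s >] then 0 else cS s)%:C.
have sc1 : abs_summable c1 K.
  move=> B; apply: le_trans (sK B); apply: ler_sum => s _.
  by rewrite /c1; case: ifP => _; rewrite ?cabs0 ?cabs_ge0.
have tc1 s : c1 s != 0 -> tay (fun h => th (y0 - s%:C + h)) M1 r1.
  rewrite /c1; case: asboolP => [_|nAs _]; first by rewrite eqxx.
  apply: Ht1; apply: den_half => //; first exact/half_sub.
  by rewrite ReB/= distrC; exact: nA.
have [T1 sT1] := tay_csum r10 M10 tc1 sc1.
pose c2 s : C := (if `[< A s >] then cS s else 0)%:C.
have sc2 : abs_summable c2 K.
  move=> B; apply: le_trans (sK B); apply: ler_sum => s _.
  by rewrite /c2; case: ifP => _; rewrite ?cabs0 ?cabs_ge0.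
have c2A s : c2 s != 0 -> A s by rewrite /c2; case: asboolP => //; rewrite eqxx.
have gaem x : cabs (x - p) < r0 -> cabs (ga x) < em.
  by move=> xr; have := Hc x; rewrite gap subr0; apply; lra.
have tc2 s : c2 s != 0 -> tay (fun h => phi (- (s - Re y0)%:C + h)) (1 * (Mp * 2)) (16 * rop).
  move=> /c2A/Hxs[xr xE]; apply: (@tay_recenter _ phi).
    by apply: tay_ext tphi _ => h _; rewrite add0r.
  rewrite cabsN -xE; have h8 := le_trans (ltW (gaem _ xr)) em8.
  have := ler_wpM2l (ltW rop0) h8; rewrite invfM mulrCA mulfV ?gt_eqF// mulr1//.
have rop16 : 0 < 16 * rop by lra.
have Mp0 : 0 <= 1 * (Mp * 2) by rewrite mul1r mulr_ge0// (tay_ge0 tphi).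
have [T2 sT2] := tay_csum rop16 Mp0 tc2 sc2.
have gaxs s : A s -> g (xs s) = y0 + (s - Re y0)%:C.
  by move=> /Hxs[_ <-]; rewrite /ga addrC subrK.
(* [V s] is what remains of [1 / (g z - g (xs s))] without its principal part: with
   [g z - g (xs s) = (z - xs s) * Q], it is the divided difference of [1 / Q]. *)
have /choice[V HV] : forall s, exists V : C -> C, A s ->
    tay V (2 * (2 / a2) * ro2) (2 * ro2) /\
    (forall h, 2 * ro2 * cabs h < 1 -> p + h != xs s ->
      (ga (p + h) - (s - Re y0)%:C)^-1 = (cderiv g (xs s))^-1 / (p + h - xs s) + V h).
  move=> s; have [As|nAs] := pselect (A s); last by exists id.
  have [xr xE] := Hxs s As; pose k := xs s - p.
  have kE : p + k = xs s by rewrite /k addrC subrK.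
  have rk : rho * cabs k <= 2^-1.
    have : cabs k <= (2 * ro2)^-1 by rewrite /k; lra.
    move/(ler_wpM2l (ltW ro20)); rewrite invfM mulrCA mulfV ?gt_eqF// mulr1.
    by have := cabs_ge0 k; nra.
  have [Q tQ QE] := tay_divdiff tg rk.
  have r2k h : cabs h < (2 * rho)^-1 -> 2 * rho * cabs h < 1.
    by move=> hh; rewrite mulrC -ltr_pdivlMr ?div1r//; lra.
  have mrr : 0 < Num.min ri (2 * rho)^-1 by rewrite lt_min ri0 invr_gt0; lra.
  have Q0 : a2 <= cabs (Q 0).
    apply: (divdiff_lower (k := k) tQ a0 mrr) => h hk; rewrite lt_min => /andP[hi hr].
    have hp : p + h - p = h by rewrite addrC addKr.
    have kp : p + k - p = k by rewrite addrC addKr.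
    have kr : cabs k < ri by rewrite /k; lra.
    have := inj (p + h) (p + k); rewrite hp kp => /(_ hi kr).
    have -> : p + h - (p + k) = h - k by ring.
    have -> : g (p + h) - g (p + k) = (h - k) * Q h by rewrite -QE ?r2k//; ring.
    rewrite cabsM mulrCA -[X in X <= _]mulr1 ler_pM2l ?cabs_gt0 ?subr_eq0// => hL.
    by rewrite /a -div1r ler_pdivrMr// mulrC.
  have tI := tay_inv tQ a20 Q0; rewrite -/ro2 in tI.
  have rk2 : ro2 * cabs k <= 2^-1.
    have : cabs k <= (2 * ro2)^-1 by rewrite /k; lra.
    by move/(ler_wpM2l (ltW ro20)); rewrite invfM mulrCA mulfV ?gt_eqF// mulr1.
  have [V tV VE] := tay_divdiff tI rk2.
  have k0 := cabs_ge0 k.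
  have rk4 : 2 * rho * cabs k <= 4^-1 by have := ler_wpM2r k0 ro2r; lra.
  have Qk : cderiv g (xs s) = Q k.
    apply: cderivE => e e0.
    have KQ : 0 <= 2 * (2 * Mg * rho) * (2 * rho) by rewrite !mulr_ge0// ltW.
    have r8 : 0 < (8 * rho)^-1 by rewrite invr_gt0; lra.
    have [q [q0 qr Kq]] := small_radius KQ e0 r8.
    exists q => // z zq; pose h := z - p.
    have zE : z = p + h by rewrite /h addrC subrK.
    have hk : z - xs s = h - k by rewrite /h /k; ring.
    have rq : 2 * rho * q <= 4^-1.
      have := ler_wpM2l (ltW rho0) qr; rewrite invfM mulrCA mulfV ?gt_eqF// mulr1; lra.
    have h0 := cabs_ge0 h.
    have hb : cabs h <= cabs k + q.
      have := cabsD k (h - k); rewrite addrC subrK; rewrite hk in zq; lra.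
    have hh : 2 * rho * cabs h <= 2^-1.
      have := ler_wpM2l (ltW rho0) hb; lra.
    rewrite -kE zE.
    have -> : g (p + h) - g (p + k) = (h - k) * Q h by rewrite -QE; [ring|lra].
    have -> : p + h - (p + k) = h - k by ring.
    rewrite [Q k * _]mulrC -mulrBr cabsM mulrC ler_wpM2r ?cabs_ge0//.
    have kk : 2 * rho * cabs k <= 2^-1 by lra.
    apply: le_trans (tay_lip tQ hh kk) _; apply: le_trans Kq.
    by rewrite ler_wpM2l// -hk ltW.
  exists V => _; split=> // h hr hx.
  have h0 := cabs_ge0 h.
  have hk : h - k != 0 by rewrite subr_eq0; apply: contra hx => /eqP ->; rewrite kE.
  have h2 : 2 * rho * cabs h < 1 by have := ler_wpM2r h0 ro2r; lra.
  have -> : p + h - xs s = h - k by rewrite /k; ring.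
  rewrite -xE -kE /ga.
  have -> : g (p + h) - y0 - (g (p + k) - y0) = (h - k) * Q h by rewrite -QE.
  rewrite invfM; have := VE h hr => /eqP; rewrite subr_eq => /eqP ->.
  by rewrite kE Qk mulrDr mulKf// addrC [_^-1 * (Q k)^-1]mulrC.
pose c3 s : C := (pi%:C)^-1 * c2 s.
have sc3 : abs_summable c3 (cabs ((pi%:C)^-1 : C) * K).
  by apply: abs_summable_le sc2 => [|s]; rewrite ?cabs_ge0// /c3 cabsM.
have tc3 s : c3 s != 0 -> tay (V s) (2 * (2 / a2) * ro2) (2 * ro2).
  by rewrite mulf_eq0 => /norP[_ /c2A/HV[]].
have M30 : 0 <= 2 * (2 / a2) * ro2 by rewrite !mulr_ge0 ?invr_ge0// ltW.
have ro30 : 0 < 2 * ro2 by lra.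
have [T3 sT3] := tay_csum ro30 M30 tc3 sc3.
set F1 := (fun h => csum _) in T1 sT1; set F2 := (fun h => csum _) in T2 sT2.
set F3 := (fun h => csum _) in T3 sT3.
have at0 f M' r' : tay f M' r' -> analytic_at f 0.
  by move=> tf; exists M', r'; apply: tay_ext tf _ => h _; rewrite add0r.
pose q := Num.min (Num.min r1^-1 (16 * rop)^-1) (rp / 2).
have q0 : 0 < q by rewrite !lt_min !invr_gt0 r10 rop16/=; lra.
have [rq rq0 Hq] := analytic_continuous aga q0.
have q1 : q <= r1^-1 by rewrite !ge_min lexx.
have q2 : q <= (16 * rop)^-1 by rewrite !ge_min lexx !orbT.
have q3 : q <= rp / 2 by rewrite !ge_min lexx !orbT.
exists (fun z => C0%:C + F1 (ga z) + F2 (ga z) + F3 (z - p)), (Num.min rq (2 * ro2)^-1); split.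
- apply: analyticD; [apply: analyticD; [apply: analyticD|]|].
  + exact: analytic_cst.
  + by apply: analytic_comp aga _; rewrite gap; apply: at0 T1.
  + by apply: analytic_comp aga _; rewrite gap; apply: at0 T2.
  + apply: (analytic_comp (analyticB (analytic_id _) (analytic_cst p _))).
    by rewrite subrr; apply: at0 T3.
- by rewrite lt_min rq0 invr_gt0.
move=> z; rewrite lt_min => /andP[zq zr] rz.
have gz : cabs (ga z) < q by have := Hq z zq; rewrite gap subr0.
have lt1 (r : R) (w : C) : 0 < r -> cabs w < r^-1 -> r * cabs w < 1.
  by move=> r00'; rewrite -[r^-1]mul1r ltr_pdivlMr// mulrC.
have s1 := sT1 (ga z) (lt1 _ _ r10 (lt_le_trans gz q1)).
have s2 := sT2 (ga z) (lt1 _ _ rop16 (lt_le_trans gz q2)).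
have z3 := lt1 _ _ ro30 zr.
have s3 := sT3 (z - p) z3.
have s0 := sigC_is_sum c_l1 rz.
have := is_sumD s0 (is_sumZ (-1) (is_sumD s1 (is_sumD s2 s3))).
have -> : csum (fun s => (cS s)%:C * th (g z - s%:C)) +
    -1 * (F1 (ga z) + (F2 (ga z) + F3 (z - p))) =
    sigC (g z) - (C0%:C + F1 (ga z) + F2 (ga z) + F3 (z - p)).
  by rewrite sigC_def; ring.
(* Once the three analytic sums are subtracted, the terms are the bare principal parts at the points
   [xs s]. *)
have FE s : (cS s)%:C * th (g z - s%:C) + -1 * (c1 s * th (y0 - s%:C + ga z) +
    (c2 s * phi (- (s - Re y0)%:C + ga z) + c3 s * V s (z - p))) =
  if `[< A s >] then (pi%:C)^-1 * ((cS s)%:C / cderiv g (xs s)) / (z - xs s) else 0.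
  rewrite /c3 /c1 /c2; case: asboolP => [As|nAs]; last first.
    have -> : y0 - s%:C + ga z = g z - s%:C by rewrite /ga; ring.
    by ring.
  have [->|cs] := eqVneq (cS s) 0; first by ring.
  have zn : ga z != (s - Re y0)%:C.
    apply/eqP => E; have gE : g z = y0 + (s - Re y0)%:C by rewrite -E /ga; ring.
    case: rz => [|[d d0 Hd]].
      by apply; move: hy => [m Hm]; exists m; rewrite gE ImD/= addr0.
    have := Hd s (cS_S cs); rewrite gE ReD Re_real.
    have -> : Re y0 + (s - Re y0) - s = 0 by ring.
    by rewrite normr0; lra.
  have [xr xE] := Hxs s As.
  have zx : p + (z - p) != xs s.
    rewrite addrC subrK; apply: contra zn => /eqP ->; by rewrite xE.
  have [_ /(_ (z - p) z3 zx)] := HV s As; rewrite [p + (z - p)]addrC subrK => VE.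
  rewrite (th_cth (y0 := y0))// -/(ga z).
  rewrite phiE ?subr_eq0//; last first.
    apply: le_lt_trans (cabsB _ _) _; rewrite -xE.
    by have := gaem _ xr; lra.
  rewrite VE [- (s - _)%:C + _]addrC; ring.
move=> H; have {}H := is_sum_eq FE H.
apply: (is_sum_reindex (h := xs)) H.
- move=> s s'; case: asboolP; rewrite ?eqxx// => As _; case: asboolP; rewrite ?eqxx// => As' _ xx.
  have [_ e1] := Hxs s As; have [_ e2] := Hxs s' As'.
  have := congr1 (@complex.Re R) (etrans (esym e1) (etrans (congr1 ga xx) e2)).
  by rewrite !Re_real; lra.
- move=> s; case: asboolP; rewrite ?eqxx// => As _.
  have [xr xE] := Hxs s As; rewrite xr /res.
  have -> : ct (g (xs s)) = cS s.
    rewrite /ct gaxs// asboolT; last by move: hy => [m Hm]; exists m; rewrite ImD/= addr0.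
    by rewrite ReD/=; congr (cS _); ring.
  by [].
move=> x; case: ifPn; last by rewrite mulr0 mul0r eqxx.
move=> xr nz; have ctx : ct (g x) != 0.
  by apply: contraNneq nz => E; rewrite /res E mul0r mulr0 mul0r.
have hx : half (g x) by move: ctx; rewrite /ct; case: asboolP => //; rewrite eqxx.
have gE : ga x = (Re (g x) - Re y0)%:C.
  apply: complex_eq; first by rewrite /ga ReB.
  rewrite /ga ImB/= (half_discrete hy hx) ?subrr// -ImB.
  apply: le_lt_trans (Im_le_cabs _) _; have := gaem _ xr; rewrite /ga; lra.
have As : A (Re (g x)) by exists x.
have [xr' xE'] := Hxs _ As.
have xx : xs (Re (g x)) = x.
  apply/eqP; rewrite -subr_eq0 -cabs_eq0; apply/eqP/le_anti; rewrite cabs_ge0 andbT.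
  apply: le_trans (inj _ _ _ _) _; [lra|lra|].
  have -> : g (xs (Re (g x))) - g x = ga (xs (Re (g x))) - ga x by rewrite /ga; ring.
  by rewrite xE' gE subrr cabs0 mulr0.
exists (Re (g x)) => //; rewrite asboolT// xx; apply: contraNneq nz => E.
by rewrite /res /ct asboolT// E.
Qed.

End LocalExpansion.

(** * Connectedness of the domain of regularity *)

Section Critical.
Variable R : realType.
Local Notation C := R[i].
Implicit Types (f g : C -> C) (p z w : C).

Lemma is_cderivM f g p d e : is_cderiv f p d -> is_cderiv g p e ->
  is_cderiv (fun z => f z * g z) p (d * g p + f p * e).
Proof.
move=> Hf Hg x x0.
pose A := cabs (g p) + cabs e + 1; pose B := cabs d * (cabs e + 1).
have [[[g0 e0] d0] f0] := (cabs_ge0 (g p), cabs_ge0 e, cabs_ge0 d, cabs_ge0 (f p)).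
have A0 : 0 < 3 * A by rewrite /A; lra.
have F0 : 0 < 3 * (cabs (f p) + 1) by lra.
have B0 : 0 <= 3 * B by rewrite /B !mulr_ge0//; lra.
have [r1 r10 H1] := Hf (x / (3 * A)) (divr_gt0 x0 A0).
have [r2 r20 H2] := Hg (x / (3 * (cabs (f p) + 1))) (divr_gt0 x0 F0).
have [r3 r30 H3] := Hg 1 ltr01.
have m0 : 0 < Num.min (Num.min r1 r2) (Num.min r3 1) by rewrite !lt_min r10 r20 r30/=.
have [s [s0 sm Ks]] := small_radius B0 x0 m0.
move: sm; rewrite !le_min => /andP[/andP[s1 s2] /andP[s3 s4]].
exists s => // z zs; set h := cabs (z - p); have h0 : 0 <= h by exact: cabs_ge0.
have zs' : h < s := zs.
have {}H1 := H1 z (lt_le_trans zs s1); have {}H2 := H2 z (lt_le_trans zs s2).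
have {}H3 := H3 z (lt_le_trans zs s3); rewrite -/h in H1 H2 H3.
have gd : cabs (g z - g p) <= (cabs e + 1) * h.
  have := cabsD (g z - g p - e * (z - p)) (e * (z - p)).
  by rewrite subrK cabsM -/h; lra.
have gb : cabs (g z) <= A.
  have := cabsD (g z - g p) (g p); rewrite subrK.
  have : (cabs e + 1) * h <= (cabs e + 1) * 1 by rewrite ler_wpM2l//; lra.
  by rewrite /A; lra.
have -> : f z * g z - f p * g p - (d * g p + f p * e) * (z - p) =
  (f z - f p - d * (z - p)) * g z + d * (z - p) * (g z - g p) +
  f p * (g z - g p - e * (z - p)) by ring.
apply: le_trans (cabsD _ _) _; apply: le_trans (lerD (cabsD _ _) (lexx _)) _.
rewrite !cabsM -/h.
have b1 : cabs (f z - f p - d * (z - p)) * cabs (g z) <= x / 3 * h.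
  apply: le_trans (ler_pM (cabs_ge0 _) (cabs_ge0 _) H1 gb) _.
  by apply: le_of_eq; field; rewrite gt_eqF//; rewrite /A; lra.
have b2 : cabs d * h * cabs (g z - g p) <= x / 3 * h.
  have : cabs d * h * cabs (g z - g p) <= cabs d * h * ((cabs e + 1) * h).
    by rewrite ler_wpM2l// mulr_ge0.
  have B0' : 0 <= B by lra.
  have : B * h <= B * s by rewrite ler_wpM2l// ltW.
  move=> Bh Bd; apply: le_trans Bd _.
  have -> : cabs d * h * ((cabs e + 1) * h) = B * h * h by rewrite /B; ring.
  by rewrite ler_wpM2r//; lra.
have b3 : cabs (f p) * cabs (g z - g p - e * (z - p)) <= x / 3 * h.
  apply: le_trans (ler_wpM2l f0 H2) _.
  have -> : x / 3 * h = (cabs (f p) + 1) * (x / (3 * (cabs (f p) + 1)) * h).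
    by field; rewrite gt_eqF//; lra.
  rewrite ler_wpM2r//; last lra.
  by rewrite mulr_ge0// divr_ge0 ?ltW.
by lra.
Qed.

Lemma is_cderiv_id p : is_cderiv id p 1.
Proof. by move=> e e0; exists 1 => // z _; rewrite mul1r subrr cabs0 mulr_ge0 ?cabs_ge0// ltW. Qed.

Lemma is_cderiv_cst (a : C) p : is_cderiv (fun=> a) p 0.
Proof. by move=> e e0; exists 1 => // z _; rewrite mul0r subrr subrr cabs0 mulr_ge0 ?cabs_ge0// ltW. Qed.

Lemma is_cderivX f p d n : is_cderiv f p d ->
  is_cderiv (fun z => f z ^+ n) p (n%:R * f p ^+ n.-1 * d).
Proof.
move=> df; elim: n => [|[|n] IH].
- rewrite !mul0r; apply: (is_cderiv_near (is_cderiv_cst 1 p) ltr01) => z _.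
  by rewrite expr0.
- by rewrite expr0 !mul1r; apply: (is_cderiv_near df ltr01) => z _; rewrite expr1.
apply: (is_cderiv_near _ ltr01 (fun z _ => esym (exprS (f z) n.+1))).
suff -> : n.+2%:R * f p ^+ n.+2.-1 * d =
  d * f p ^+ n.+1 + f p * (n.+1%:R * f p ^+ n.+1.-1 * d) by exact: is_cderivM.
by rewrite /= -[n.+2%:R]natr1 exprS; ring.
Qed.

Lemma is_cderiv_subX (q : C) n p :
  is_cderiv (fun z => (z - q) ^+ n) p (n%:R * (p - q) ^+ n.-1).
Proof.
have := is_cderivD (is_cderiv_id p) (is_cderiv_cst (- q) p); rewrite addr0.
by move/(is_cderivX n); rewrite mulr1.
Qed.

(** If [g z - g p = (z - p) ^+ e * k z] with [k p != 0], then [cderiv g z] is [(z - p) ^+ e.-1]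
    times a function close to [e%:R * k p]. *)
Lemma critical_isolated g p : analytic_at g p ->
  ~ (exists2 r : R, 0 < r & forall z, cabs (z - p) < r -> g z = g p) ->
  exists2 r : R, 0 < r & forall z, z != p -> cabs (z - p) < r -> cderiv g z != 0.
Proof.
move=> ag nc; have agp := analyticB ag (analytic_cst (g p) p).
have [[r r0 H]|[e [k [ak k0 [r r0 H]]]]] := analytic_factor agp.
  by case: nc; exists r => // z /H/eqP; rewrite subr_eq0 => /eqP.
have e0 : (0 < e)%N.
  rewrite lt0n; apply/eqP => e0; have := H p; rewrite !subrr cabs0 e0 expr0 mul1r => /(_ r0).
  by move/esym/eqP; rewrite (negPf k0).
have kp : 0 < cabs (k p) / 2 by have := k0; rewrite -cabs_gt0; lra.
have [r1 r10 H1] := analytic_continuous ak kp.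
have [r2 r20 H2] := analytic_nearby ak.
have [r3 r30 H3] := cderiv_near ak ltr01.
pose B := cabs (cderiv k p) + 1; have B0 : 0 <= B by have := cabs_ge0 (cderiv k p); rewrite /B; lra.
have k4 : 0 < cabs (k p) / 4 by lra.
have m0 : 0 < Num.min (Num.min r r1) (Num.min r2 r3) by rewrite !lt_min r0 r10 r20 r30.
have [s [s0 sm Ks]] := small_radius B0 k4 m0.
move: sm; rewrite !le_min => /andP[/andP[sr s1] /andP[s2 s3]].
exists s => // z zp zs.
have akz := H2 z (lt_le_trans zs s2).
have dk := analytic_cderiv akz.
have dB : cabs (cderiv k z) <= B.
  have := H3 z (lt_le_trans zs s3) _ dk; have := cabsD (cderiv k z - cderiv k p) (cderiv k p).
  by rewrite subrK /B; lra.
have hz : 0 < s - cabs (z - p) by rewrite subr_gt0.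
have dd := is_cderivD (is_cderiv_cst (g p) z) (is_cderivM (is_cderiv_subX p e z) dk).
rewrite (cderivE (is_cderiv_near (g := g) dd hz _)); last first.
  move=> w wz; rewrite -H; first by rewrite addrC subrK.
  by apply: le_lt_trans (cabs_dist z _ _) _; lra.
rewrite add0r; have -> : e%:R * (z - p) ^+ e.-1 * k z + (z - p) ^+ e * cderiv k z =
   (z - p) ^+ e.-1 * (e%:R * k z + (z - p) * cderiv k z).
  by rewrite -{3}(prednK e0) exprS; ring.
rewrite mulf_neq0// ?expf_neq0 ?subr_eq0// -cabs_gt0.
apply: lt_le_trans (cabsD_ge _ _); rewrite !cabsM cabs_nat.
have b1 : cabs (k p) / 2 < cabs (k z).
  have := H1 z (lt_le_trans zs s1); have := cabsD_ge (k p) (k z - k p).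
  by rewrite [k p + _]addrC subrK; lra.
have b2 : cabs (z - p) * cabs (cderiv k z) <= cabs (k p) / 4.
  apply: le_trans Ks; rewrite mulrC ler_pM ?cabs_ge0// ltW//.
have : 1 * cabs (k z) <= e%:R * cabs (k z) by rewrite ler_wpM2r ?cabs_ge0// ler1n.
by lra.
Qed.

(** Points of one set may accumulate at a point of another, so a finite union of discrete sets need
    not be discrete; yet it has isolated points. If [w] in [A j] is not isolated, a small punctured
    disc around [w] avoids [A j], and induction applies there with one set fewer. *)
Lemma isolated_in_union (J : eqType) (s : seq J) (A : J -> C -> Prop) :
  (forall j z, A j z -> exists2 r : R, 0 < r &
     forall w, A j w -> cabs (w - z) < r -> w = z) ->
  forall (U X : C -> Prop), open_dom U ->
  (forall z, U z -> X z -> exists2 j, j \in s & A j z) ->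
  (exists2 z, U z & X z) ->
  exists p, [/\ U p, X p & exists2 r : R, 0 < r &
    forall w, X w -> cabs (w - p) < r -> w = p].
Proof.
move=> iA; elim: s => [|j s IH] U X oU XA [z Uz Xz].
  by have [] := XA z Uz Xz.
have [[w [Uw Xw Aw]]|none] := pselect (exists w, [/\ U w, X w & A j w]); last first.
  apply: IH => //; last by exists z.
  move=> w Uw Xw; have [k] := XA w Uw Xw.
  rewrite inE => /predU1P[->|sk] Ak; last by exists k.
  by exfalso; apply: none; exists w.
have [r1 r10 H1] := iA j w Aw; have [r2 r20 H2] := oU w Uw.
have m0 : 0 < Num.min r1 r2 by rewrite lt_min r10.
have [single|] := pselect (forall v, X v -> cabs (v - w) < Num.min r1 r2 -> v = w).
  by exists w; split=> //; exists (Num.min r1 r2).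
move=> /existsNP[v /not_implyP[Xv /not_implyP[vr /eqP vw]]].
have [|||p [[Up _] Xp Hp]] := IH (fun u => cabs (u - w) < Num.min r1 r2 /\ u != w) X.
- move=> u [ur uw].
  have m1 : 0 < Num.min (Num.min r1 r2 - cabs (u - w)) (cabs (u - w)).
    by rewrite lt_min subr_gt0 ur cabs_gt0 subr_eq0.
  exists (Num.min (Num.min r1 r2 - cabs (u - w)) (cabs (u - w))) => // t.
  rewrite lt_min => /andP[t1 t2]; split.
    by apply: le_lt_trans (cabs_dist u _ _) _; lra.
  by apply: contraTneq t2 => ->; rewrite cabsBC ltxx.
- move=> u [+ uw] Xu; rewrite lt_min => /andP[u1 u2].
  have [k] := XA u (H2 _ u2) Xu; rewrite inE => /predU1P[->|sk] Ak; last by exists k.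
  by move: uw; rewrite (H1 u Ak u1) eqxx.
- by exists v.
exists p; split=> //; apply: H2; apply: lt_le_trans Up _.
by rewrite ge_min lexx orbT.
Qed.

End Critical.

(** * Regular points: gaps of [S], small discs, preimages under functions without critical points *)

Section RegularDomain.
Variables (R : realType) (S : set R).
Hypothesis S_discrete : discrete_subset S.
Local Notation C := R[i].
Implicit Types (f g : C -> C) (p z w : C) (D : C -> Prop).

Lemma S_isolated s : S s -> exists2 d : R, 0 < d &
  forall s', S s' -> `|s' - s| < d -> s' = s.
Proof.
move=> Ss; have [_ [V]] := S_discrete Ss.
move=> /nbhs_ballP[d /= d0 dV] VS; exists d => // s' Ss' ds.
have : (V `&` S)%classic s' by split=> //; apply: dV; rewrite /ball/= distrC.
by rewrite VS.
Qed.

(** Just to the right of an isolated point of [S] there is an interval free of [S]; if no point of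
    [S] is close to [x], then [x] itself will do. *)
Lemma S_gap (x e : R) : 0 < e -> exists2 x', `|x' - x| < e &
  exists2 d : R, 0 < d & forall s, S s -> d <= `|x' - s|.
Proof.
move=> e0; have [[s [Ss sx]]|none] := pselect (exists s, S s /\ `|s - x| < e / 2); last first.
  exists x; first by rewrite subrr normr0.
  exists (e / 2); first lra.
  move=> s Ss; rewrite leNgt; apply/negP => xs; apply: none; exists s.
  by rewrite distrC.
have [d d0 Hd] := S_isolated Ss.
pose m := Num.min (d / 2) (e / 4).
have m0 : 0 < m by rewrite lt_min; apply/andP; split; lra.
have md : m <= d / 2 by rewrite ge_min lexx.
have me : m <= e / 4 by rewrite ge_min lexx orbT.
exists (s + m).
  have -> : s + m - x = (s - x) + m by ring.
  by apply: le_lt_trans (ler_normD _ _) _; rewrite (gtr0_norm m0); lra.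
exists m => // s' Ss'; have [->|ns] := eqVneq s' s.
  by rewrite addrC addKr gtr0_norm.
have : d <= `|s' - s|.
  by rewrite leNgt; apply/negP => /(Hd _ Ss') E; rewrite E eqxx in ns.
have := ler_normD (s' - (s + m)) m; rewrite (gtr0_norm m0).
have -> : s' - (s + m) + m = s' - s by ring.
by rewrite (distrC s' (s + m)); lra.
Qed.

Lemma reg_dense (y : C) (e : R) : 0 < e -> exists2 y', reg S y' & cabs (y' - y) < e.
Proof.
move=> e0; have [x' xe [d d0 H]] := S_gap (Re y) e0.
exists (y + (x' - Re y)%:C); last by rewrite addrC addKr cabsC.
right; exists d => // s Ss; rewrite ReD Re_real.
have -> : Re y + (x' - Re y) - s = x' - s by ring.
exact: H.
Qed.

(** A disc of radius at most [1/2] meets at most one line of [half]. Its upper and lower parts are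
    joined through a gap of [S] on that line; the remaining regular points are limits of points off
    the line. *)
Lemma connected_reg_ball (y0 : C) (d : R) : d <= 2^-1 ->
  connected_dom (fun y => cabs (y - y0) < d /\ reg S y).
Proof.
move=> d2; have [[y1 [y1d hy1]]|none] := pselect (exists y, cabs (y - y0) < d /\ half y); last first.
  apply: (connected_dense (@connected_ball _ y0 d)) => [z zd|p r [pd _] r0].
    by split=> //; left => hz; apply: none; exists z.
  by exists p => //; rewrite subrr cabs0.
have d0 : 0 < d by apply: le_lt_trans y1d; exact: cabs_ge0.
have line z : cabs (z - y0) < d -> half z -> Im z = Im y1.
  move=> zd hz; apply: half_discrete => //; rewrite -ImB.
  apply: le_lt_trans (Im_le_cabs _) _.
  by apply: le_lt_trans (cabs_dist y0 _ _) _; rewrite [cabs (y0 - _)]cabsBC; lra.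
have cU : connected_dom (fun y => cabs (y - y0) < d /\ 0 < Im y - Im y1).
  by apply: connected_half => z w t; rewrite ImD Im_scale ImB; ring.
have cL : connected_dom (fun y => cabs (y - y0) < d /\ 0 < - (Im y - Im y1)).
  by apply: connected_half => z w t; rewrite ImD Im_scale ImB; ring.
have e0 : 0 < d - cabs (y1 - y0) by rewrite subr_gt0.
have [x' xe [dx dx0 Hx]] := S_gap (Re y1) e0.
pose g0 := y1 + (x' - Re y1)%:C.
have g0d : cabs (g0 - y0) < d.
  apply: le_lt_trans (cabs_dist y1 _ _) _.
  have -> : g0 - y1 = (x' - Re y1)%:C by rewrite /g0 addrC addKr.
  by rewrite cabsC; lra.
have Ig0 : Im g0 = Im y1 by rewrite /g0 ImD/= addr0.
have Rg0 : reg S g0.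
  right; exists dx => // s Ss; rewrite /g0 ReD Re_real.
  have -> : Re y1 + (x' - Re y1) - s = x' - s by ring.
  exact: Hx.
have shift p (r : R) (sg : R) : cabs (p - y0) < d -> 0 < r -> `|sg| = 1 ->
    exists2 z, cabs (z - y0) < d /\ Im z - Im p = sg * `|Im z - Im p| /\ 0 < `|Im z - Im p| & cabs (z - p) < r.
  move=> pd r0 s1; pose m := Num.min r (d - cabs (p - y0)) / 2.
  have mm : 0 < Num.min r (d - cabs (p - y0)) by rewrite lt_min r0 subr_gt0.
  have m0 : 0 < m by rewrite /m; lra.
  have mr : Num.min r (d - cabs (p - y0)) <= r by rewrite ge_min lexx.
  have md : Num.min r (d - cabs (p - y0)) <= d - cabs (p - y0) by rewrite ge_min lexx orbT.
  have zm : cabs (p + (0 +i* (sg * m)) - p) = m.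
    by rewrite addrC addKr cabsE/= expr0n add0r sqrtr_sqr normrM s1 mul1r gtr0_norm.
  have im : Im (p + (0 +i* (sg * m))) - Im p = sg * m by rewrite ImD/= addrC addKr.
  exists (p + (0 +i* (sg * m))); last by rewrite zm /m; lra.
  rewrite im normrM s1 mul1r gtr0_norm//; split=> //.
  by apply: le_lt_trans (cabs_dist p _ _) _; rewrite zm /m; lra.
have cU' : connected_dom (fun y => (cabs (y - y0) < d /\ 0 < Im y - Im y1) \/ y = g0).
  apply: (connected_dense cU) => [z zU|p r pU r0]; first by left.
  case: pU => [pU|->]; first by exists p => //; rewrite subrr cabs0.
  have [z [zd [z1 z2]] zr] := shift g0 r 1 g0d r0 (normr1 _).
  by exists z => //; split=> //; rewrite -Ig0 z1 mul1r.
have cL' : connected_dom (fun y => (cabs (y - y0) < d /\ 0 < - (Im y - Im y1)) \/ y = g0).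
  apply: (connected_dense cL) => [z zU|p r pU r0]; first by left.
  case: pU => [pU|->]; first by exists p => //; rewrite subrr cabs0.
  have [z [zd [z1 z2]] zr] := shift g0 r (-1) g0d r0 (normrN1 _).
  by exists z => //; split=> //; rewrite -Ig0 z1 mulN1r opprK.
have cA : connected_dom (fun y => cabs (y - y0) < d /\ (Im y != Im y1 \/ y = g0)).
  apply: (connected_union (z := g0) cU' cL'); [by right|by right|].
  move=> w; split=> [[wd [/eqP wi|->]]|]; [|by left; right|].
    by have [?|?|//] := ltgtP (Im w) (Im y1); [right|left]; left; split=> //; lra.
  case=> -[[wd wi]|->]; split=> //; try (by right); left; apply/eqP; lra.
apply: (connected_dense cA) => [z [zd zi]|p r [pd rp] r0].
  split=> //; case: zi => [zi|->//]; left => hz.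
  by move: zi; rewrite (line z zd hz) eqxx.
have [pi1|pi1] := eqVneq (Im p) (Im y1); last first.
  by exists p; [split=> //; left|rewrite subrr cabs0].
have [z [zd [z1 z2]] zr] := shift p r 1 pd r0 (normr1 _).
exists z => //; split=> //; left; rewrite -pi1 -subr_eq0.
by rewrite -normr_eq0 gt_eqF.
Qed.

Lemma reg_preimage_dense D g : open_dom D ->
  (forall z, D z -> analytic_at g z) -> (forall z, D z -> cderiv g z != 0) ->
  forall p (r : R), D p -> 0 < r -> exists2 z, D z /\ reg S (g z) & cabs (z - p) < r.
Proof.
move=> oD ag dg p r Dp r0.
have [L [ri [L0 ri0 inj sur]]] := inverse_function (ag p Dp) (dg p Dp).
have [rd rd0 Hd] := oD p Dp.
have e0 : 0 < Num.min ri (Num.min r rd) / L by rewrite divr_gt0// !lt_min ri0 r0.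
have [y ry yp] := reg_dense (g p) e0.
rewrite ltr_pdivlMr// mulrC !lt_min in yp; move: yp => /andP[y1 /andP[y2 y3]].
have [z zp zE] := sur y y1; exists z; last exact: le_lt_trans zp y2.
by rewrite zE; split=> //; apply: Hd; exact: le_lt_trans zp y3.
Qed.

(** Near [p] a local inverse [psi] of [g] carries the predicate to a small disc around [g p], where
    [connected_reg_ball] applies. *)
Lemma connected_reg_preimage D g : open_dom D -> connected_dom D ->
  (forall z, D z -> analytic_at g z) -> (forall z, D z -> cderiv g z != 0) ->
  connected_dom (fun z => D z /\ reg S (g z)).
Proof.
move=> oD cD ag dg; apply: (connected_remove cD) => [z []//||].
  exact: reg_preimage_dense.
move=> X lX p Dp.
have [L [ri [L0 ri0 inj sur]]] := inverse_function (ag p Dp) (dg p Dp).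
have [rd rd0 Hd] := oD p Dp.
pose m := Num.min ri rd; have m0 : 0 < m by rewrite lt_min ri0.
have mi : m <= ri by rewrite ge_min lexx.
have md : m <= rd by rewrite ge_min lexx orbT.
pose d := Num.min 2^-1 (m / L).
have d0 : 0 < d by rewrite lt_min invr_gt0 ltr0n divr_gt0.
have d2 : d <= 2^-1 by rewrite ge_min lexx.
have dm : d <= m / L by rewrite ge_min lexx orbT.
have /choice[psi Hpsi] : forall y, exists z, cabs (y - g p) < d ->
    cabs (z - p) < m /\ g z = y.
  move=> y; have [yd|yd] := ltP (cabs (y - g p)) d; last by exists 0.
  have Lm : L * cabs (y - g p) < m by rewrite mulrC -ltr_pdivlMr//; lra.
  have [|z zp zE] := sur y; first lra.
  by exists z => _; split=> //; lra.
have lX' : locally_constant (fun y => cabs (y - g p) < d /\ reg S y) (fun y => X (psi y)).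
  move=> y [yd ry]; have [pm pE] := Hpsi y yd.
  have [|r r0 Hr] := lX (psi y).
    by rewrite pE; split=> //; apply: Hd; lra.
  exists (r / L); first by rewrite divr_gt0.
  move=> y' [y'd ry'] yy; have [pm' pE'] := Hpsi y' y'd.
  apply: Hr; first by rewrite pE'; split=> //; apply: Hd; lra.
  apply: le_lt_trans (inj _ _ _ _) _; [lra|lra|].
  by rewrite pE pE' mulrC -ltr_pdivlMr.
have cB := @connected_reg_ball (g p) d d2.
have [rc rc0 Hc] := analytic_continuous (ag p Dp) d0.
exists (Num.min rc m); first by rewrite lt_min rc0.
move=> z w [Dz rz] [Dw rw]; rewrite !lt_min => /andP[zc zm] /andP[wc wm].
have psig u : cabs (u - p) < rc -> cabs (u - p) < m -> psi (g u) = u.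
  move=> uc um; have [pm pE] := Hpsi _ (Hc u uc).
  apply/eqP; rewrite -subr_eq0 -cabs_eq0; apply/eqP/le_anti; rewrite cabs_ge0 andbT.
  apply: le_trans (inj _ _ _ _) _; [lra|lra|].
  by rewrite pE subrr cabs0 mulr0.
have := cB _ lX' (g z) (g w) (conj (Hc z zc) rz) (conj (Hc w wc) rw).
by rewrite /= psig ?psig// /m lt_min.
Qed.

Lemma connected_reg_family (J : eqType) (s : seq J) (g : J -> C -> C) D :
  open_dom D -> connected_dom D ->
  (forall j z, D z -> analytic_at (g j) z) -> (forall j z, D z -> cderiv (g j) z != 0) ->
  [/\ open_dom (fun z => D z /\ forall j, j \in s -> reg S (g j z)),
  connected_dom (fun z => D z /\ forall j, j \in s -> reg S (g j z)) &
  forall p (r : R), D p -> 0 < r ->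
    exists2 z, D z /\ (forall j, j \in s -> reg S (g j z)) & cabs (z - p) < r].
Proof.
move=> oD cD ag dg; elim: s => [|j s [IHo IHc IHd]].
  split; last by move=> p r Dp r0; exists p => //; rewrite subrr cabs0.
    by move=> p [Dp _]; have [r r0 H] := oD p Dp; exists r => // z /H.
  by apply: (connected_dense cD) => [//|p r [Dp _] r0]; exists p => //; rewrite subrr cabs0.
have E z : (D z /\ forall i, i \in j :: s -> reg S (g i z)) <->
    ((D z /\ forall i, i \in s -> reg S (g i z)) /\ reg S (g j z)).
  split=> [[Dz H]|[[Dz H] Hj]].
    split; last by apply: H; rewrite mem_head.
    by split=> // i si; apply: H; rewrite inE si orbT.
  by split=> // i; rewrite inE => /predU1P[->|/H].
have := connected_reg_preimage IHo IHc (fun z Dz => ag j z Dz.1) (fun z Dz => dg j z Dz.1).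
move=> cc; split.
  move=> p /E[Hp rp]; have [r r0 H] := IHo p Hp.
  have [d d0 Hd] := reg_open rp; have [q q0 Hq] := analytic_continuous (ag j p Hp.1) d0.
  exists (Num.min r q); first by rewrite lt_min r0.
  by move=> z; rewrite lt_min => /andP[/H zr /Hq/Hd zq]; apply/E.
  apply: (connected_dense cc) => [z /E//|p r /E Hp r0].
  by exists p => //; rewrite subrr cabs0.
move=> p r Dp r0; have r2 : 0 < r / 2 by lra.
have [z Hz zp] := IHd p _ Dp r2.
have [w Hw wz] := reg_preimage_dense IHo (fun z Dz => ag j z Dz.1) (fun z Dz => dg j z Dz.1) Hz r2.
by exists w; [apply/E|apply: le_lt_trans (cabs_dist z _ _) _; lra].
Qed.

End RegularDomain.

(** * Uniquely covered points of a self-avoiding set *)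

Section SelfAvoiding.
Variables (R : realType) (S : set R).
Hypothesis S_sa : self_avoiding S.

Definition oddz (w : int) : Prop := exists k : int, w = 2 * k + 1.

(** Membership of [t] in [(S - p.2) / p.1], multiplied out. *)
Definition covers (p : int * R) (t : R) : Prop := S (p.1%:~R * t + p.2).

Definition covers_once (L : seq (int * R)) (p : int * R) (t : R) : Prop :=
  covers p t /\ forall q, q \in L -> q != p -> ~ covers q t.

Lemma oddz_neq0 w : oddz w -> w%:~R != 0 :> R.
Proof. by move=> [k ->]; rewrite intr_eq0; lia. Qed.

Lemma oddzM u v : oddz u -> oddz v -> oddz (u * v).
Proof. by move=> [k ->] [m ->]; exists (2 * k * m + k + m); ring. Qed.

Lemma self_avoiding_seq (L : seq (int * R)) : uniq L -> L != [::] ->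
  (forall p, p \in L -> oddz p.1) ->
  exists p t, p \in L /\ covers_once L p t.
Proof.
move=> uL L0 oL; pose x0 := nth (0, 0) L 0.
have Li (j : 'I_(size L)) : nth x0 L j \in L by rewrite mem_nth.
have covE p t : p \in L -> [set (s - p.2) / p.1%:~R | s in S]%classic t <-> covers p t.
  move=> pL; have p0 := oddz_neq0 (oL p pL); rewrite /covers; split.
    by move=> [s Ss <-]; rewrite mulrC divfK// subrK.
  by move=> St; exists (p.1%:~R * t + p.2) => //; rewrite addrK mulrC mulKf.
have [||j [t [tj tn]]] := S_sa (w := fun j : 'I_(size L) => (nth x0 L j).1)
   (th := fun j : 'I_(size L) => (nth x0 L j).2) _ (fun j => oL _ (Li j)).
- by rewrite lt0n size_eq0.
- move=> i j /=; rewrite -!surjective_pairing => /eqP.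
  by rewrite nth_uniq// => /eqP/val_inj.
exists (nth x0 L j), t; split=> //; split; first exact/covE.
move=> q /(nthP x0)[k kL <-] neq; have := tn (Ordinal kL).
rewrite (_ : _ != j) => [/(_ isT) H|].
  by move=> /(covE _ _ (mem_nth x0 kL)).
by apply: contra neq => /eqP <-.
Qed.

(* Suppose only finitely many points [e] are covered once. Then the shifts of
   the collection by the [e / q] together with its [q]-fold contractions
   shifted by the [e] cover every point [e + e' / q] twice, which contradicts
   self-avoidance of the enlarged collection. *)
Lemma covers_once_infinite (L : seq (int * R)) (X : seq R) : uniq L -> L != [::] ->
  (forall p, p \in L -> oddz p.1) ->
  exists p t, [/\ p \in L, t \notin X & covers_once L p t].
Proof.
move=> uL L0 oL; apply: contrapT => none.
pose E := [seq t <- X | `[< exists2 p, p \in L & covers_once L p t >]].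
have inE' p t : p \in L -> covers_once L p t -> t \in E.
  move=> pL pt; rewrite mem_filter; apply/andP; split.
    by apply/asboolP; exists p.
  by apply: contrapT => /negP tX; apply: none; exists p, t.
have Ecov e : e \in E -> exists2 p, p \in L & covers p e.
  by rewrite mem_filter => /andP[/asboolP[p pL [pe _]] _]; exists p.
(* Odd and larger than every slope in absolute value, so that [q] times a slope is never a slope: a
   shifted and a contracted copy in [L'] cannot coincide. *)
pose q : int := 2 * (\sum_(p <- L) `|p.1|%N)%:Z + 1.
have oq : oddz q by eexists.
have q0 : q%:~R != 0 :> R := oddz_neq0 oq.
have big w v : (exists th, (w, th) \in L) -> (exists th, (v, th) \in L) -> w != q * v.
  move=> [th wL] [th' vL]; have : (`|w|%N <= \sum_(p <- L) `|p.1|%N)%N.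
    by rewrite (big_rem _ wL)/= leq_addr.
  have [k kE] := oL _ vL; simpl in kE.
  move=> le; apply/eqP => wE; move: le; rewrite wE abszM kE.
  have v1 : (0 < `|(2 * k + 1)%R|)%N by lia.
  have -> : `|q|%N = (2 * \sum_(p <- L) `|p.1|%N).+1 by rewrite /q; lia.
  by move: v1; move: `|(2 * k + 1)%R|%N (\sum_(p <- L) `|p.1|)%N => a b; nia.
pose sh (pe : (int * R) * R) : int * R := (pe.1.1, pe.1.2 - pe.1.1%:~R * (pe.2 / q%:~R)).
pose sc (pe : (int * R) * R) : int * R :=
  (q * pe.1.1, pe.1.2 - (q * pe.1.1)%:~R * pe.2).
have shE p e t : covers (sh (p, e)) t <-> covers p (t - e / q%:~R).
  by rewrite /covers /sh/=; have -> : p.1%:~R * t + (p.2 - p.1%:~R * (e / q%:~R)) =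
    p.1%:~R * (t - e / q%:~R) + p.2 by ring.
have scE p e t : covers (sc (p, e)) t <-> covers p (q%:~R * (t - e)).
  by rewrite /covers /sc/= intrM; have -> : q%:~R * p.1%:~R * t + (p.2 - q%:~R * p.1%:~R * e) =
    p.1%:~R * (q%:~R * (t - e)) + p.2 by ring.
pose L' := undup ([seq sh (p, e) | p <- L, e <- E] ++ [seq sc (p, e) | p <- L, e <- E]).
have shL p e : p \in L -> e \in E -> sh (p, e) \in L'.
  move=> pL eE; rewrite mem_undup mem_cat; apply/orP; left.
  by apply/allpairsP; exists (p, e).
have scL p e : p \in L -> e \in E -> sc (p, e) \in L'.
  move=> pL eE; rewrite mem_undup mem_cat; apply/orP; right.
  by apply/allpairsP; exists (p, e).
have L'P P : P \in L' -> exists p e, [/\ p \in L, e \in E & P = sh (p, e) \/ P = sc (p, e)].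
  rewrite mem_undup mem_cat => /orP[] /allpairsP[[p e]/= [pL eE ->]];
    exists p, e; split=> //; [by left|by right].
have [p0 [e0 [p0L p0e0]]] := self_avoiding_seq uL L0 oL.
have L'0 : L' != [::].
  apply/eqP => L'0; have := shL p0 e0 p0L (inE' _ _ p0L p0e0).
  by rewrite L'0 in_nil.
have oL' P : P \in L' -> oddz P.1.
  move=> /L'P[p [e [pL eE [->|->]]]] /=; first exact: oL.
  by apply: oddzM => //; exact: oL.
have [P [t [PL' [Pt Pn]]]] := self_avoiding_seq (undup_uniq _) L'0 oL'.
have [p [e [pL eE [PE|PE]]]] := L'P P PL'.
(* The point [t - e / q] is covered once by [L], hence lies in [E]; so a contracted copy attached to
   it covers [t] as well. The other case exchanges the two roles. *)
- move: Pt; rewrite PE => /shE pt.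
  have xE : t - e / q%:~R \in E.
    apply: (inE' p) => //; split=> // p' p'L p'p /shE p't.
    apply: Pn (shL _ _ p'L eE) _ p't; apply: contra p'p; rewrite PE /sh/= => /eqP[wE].
    rewrite wE => /addIr thE; apply/eqP.
    by rewrite (surjective_pairing p') (surjective_pairing p) wE thE.
  have [p2 p2L p2e] := Ecov e eE.
  have c2 : covers (sc (p2, t - e / q%:~R)) t.
    apply/scE; have -> : q%:~R * (t - (t - e / q%:~R)) = e by field.
    by [].
  apply: Pn (scL _ _ p2L xE) _ c2; rewrite PE; apply/eqP => -[wE _].
  suff : p.1 != q * p2.1 by rewrite wE eqxx.
  by apply: big; [exists p.2|exists p2.2]; rewrite -surjective_pairing.
- move: Pt; rewrite PE => /scE pt.
  have xE : q%:~R * (t - e) \in E.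
    apply: (inE' p) => //; split=> // p' p'L p'p /scE p't.
    apply: Pn (scL _ _ p'L eE) _ p't; apply: contra p'p; rewrite PE /sc/= => /eqP[wE].
    rewrite wE => /addIr thE; apply/eqP.
    rewrite (surjective_pairing p') (surjective_pairing p) thE; congr (_, _).
    by apply: (mulfI _ wE); rewrite -(intr_eq0 R).
  have [p2 p2L p2e] := Ecov e eE.
  have c2 : covers (sh (p2, q%:~R * (t - e))) t.
    apply/shE; have -> : t - q%:~R * (t - e) / q%:~R = e by field.
    by [].
  apply: Pn (shL _ _ p2L xE) _ c2; rewrite PE; apply/eqP => -[wE _].
  suff : p2.1 != q * p.1 by rewrite wE eqxx.
  by apply: big; [exists p2.2|exists p.2]; rewrite -surjective_pairing.
Qed.

End SelfAvoiding.

(** * Points with a non-vanishing residue near a simple pole *)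

Section NearPole.
Variable R : realType.
Local Notation C := R[i].
Implicit Types (f g h b k : C -> C) (z w A Y : C).

Lemma is_cderiv_mulid k : analytic_at k 0 -> is_cderiv (fun z => z * k z) 0 (k 0).
Proof.
move=> /analytic_cderiv dk; have := is_cderivM (is_cderiv_id 0) dk.
by rewrite mul1r mul0r addr0.
Qed.

Lemma is_cderiv_inv z : z != 0 -> is_cderiv (fun w => w^-1) z (- z ^- 2).
Proof.
move=> z0 e e0; have zp : 0 < cabs z by rewrite cabs_gt0.
pose K := 2 / (cabs z ^+ 3).
have K0 : 0 <= K by rewrite divr_ge0// exprn_ge0// ltW.
have z2 : 0 < cabs z / 2 by lra.
have [s [s0 sz Ks]] := small_radius K0 e0 z2.
exists s => // w ws.
have wz : cabs z / 2 <= cabs w.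
  have := cabsD_ge z (w - z); rewrite [z + _]addrC subrK; lra.
have w0 : w != 0 by rewrite -cabs_gt0; lra.
have -> : w^-1 - z^-1 - - z ^- 2 * (w - z) = (w - z) * ((w - z) / (w * z ^+ 2)).
  by field; rewrite z0 w0.
rewrite cabsM mulrC ler_wpM2r ?cabs_ge0//; apply: le_trans Ks.
rewrite cabsM cabsV cabsM cabsX mulrC ler_pM ?cabs_ge0 ?invr_ge0 ?mulr_ge0 ?exprn_ge0 ?cabs_ge0//.
  rewrite /K -[2 / _]invf_div lef_pV2 ?posrE ?divr_gt0 ?exprn_gt0//; last first.
    by rewrite mulr_gt0 ?exprn_gt0//; lra.
  by rewrite exprS mulrAC ler_wpM2r// exprn_ge0// ltW.
exact: ltW.
Qed.

Lemma pole_deriv A b z : z != 0 -> analytic_at b z ->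
  cderiv (fun w => A / w + b w) z = - A / z ^+ 2 + cderiv b z.
Proof.
move=> z0 ab; apply: cderivE.
have := is_cderivD (is_cderivZ A (is_cderiv_inv z0)) (analytic_cderiv ab).
by rewrite mulrN mulNr.
Qed.

Lemma pole_deriv_est A b (e : R) : analytic_at b 0 -> 0 < e ->
  exists2 d : R, 0 < d & forall z, z != 0 -> cabs z < d ->
    cabs (z ^+ 2 * cderiv (fun w => A / w + b w) z + A) <= e.
Proof.
move=> ab e0; have [r1 r10 H1] := analytic_nearby ab.
have [r2 r20 H2] := cderiv_near ab ltr01.
pose B := cabs (cderiv b 0) + 1; have B0 : 0 <= B by have := cabs_ge0 (cderiv b 0); rewrite /B; lra.
have m0 : 0 < Num.min 1 (Num.min r1 r2) by rewrite !lt_min ltr01 r10.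
have [s [s0 sm Bs]] := small_radius B0 e0 m0.
move: sm; rewrite !le_min => /and3P[s1 s2 s3].
exists s => // z z0 zs; have abz : analytic_at b z by apply: H1; rewrite subr0; lra.
rewrite pole_deriv//.
have -> : z ^+ 2 * (- A / z ^+ 2 + cderiv b z) + A = z * (z * cderiv b z) by field.
have dB : cabs (cderiv b z) <= B.
  have zr : cabs (z - 0) < r2 by rewrite subr0; lra.
  have := H2 z zr _ (analytic_cderiv abz).
  have := cabsD (cderiv b z - cderiv b 0) (cderiv b 0); rewrite subrK /B; lra.
rewrite !cabsM; have z1 := cabs_ge0 z; have d0 := cabs_ge0 (cderiv b z).
have : cabs z * (cabs z * cabs (cderiv b z)) <= 1 * (s * B).
  apply: ler_pM => //; [by rewrite mulr_ge0|lra|apply: ler_pM => //; lra].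
by lra.
Qed.

(** The reciprocal [z / (A + z * b z)] is analytic at [0] with derivative [1 / A]; invert it there
    and solve for [1 / Y]. *)
Lemma pole_solve A b (d : R) : A != 0 -> analytic_at b 0 -> 0 < d ->
  exists2 B : R, 0 < B & forall Y, B < cabs Y ->
    exists z, [/\ z != 0, cabs z < d & A / z + b z = Y].
Proof.
move=> A0 ab d0.
have ak : analytic_at (fun z => (A + z * b z)^-1) 0.
  apply: analytic_inv; last by rewrite mul0r addr0.
  by apply: analyticD (analytic_cst _ _) (analyticM (analytic_id _) ab).
have af : analytic_at (fun z => z * (A + z * b z)^-1) 0 := analyticM (analytic_id _) ak.
have df := cderivE (is_cderiv_mulid ak).
have df0 : cderiv (fun z => z * (A + z * b z)^-1) 0 != 0.
  by rewrite df mul0r addr0 invr_eq0.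
have [L [r [L0 r0 _ sur]]] := inverse_function af df0.
have m0 : 0 < Num.min r d by rewrite lt_min r0.
exists (L / Num.min r d); first by rewrite divr_gt0.
move=> Y; rewrite ltr_pdivrMr// => LY.
have Y0 : 0 < cabs Y.
  by have := cabs_ge0 Y; rewrite le_eqVlt => /orP[/eqP E|//]; move: LY; rewrite -E mul0r; lra.
have : L * cabs Y^-1 < Num.min r d by rewrite cabsV ltr_pdivrMr// mulrC.
rewrite lt_min => /andP[Lr Ld].
have [|z] := sur Y^-1; first by rewrite mul0r subr0.
rewrite mul0r !subr0 => zL zE; exists z; split; last first.
- have z0 : z != 0.
    by apply: contra_eq_neq zE => ->; rewrite mul0r eq_sym invr_eq0 -cabs_gt0.
  have := congr1 (fun u => u^-1) zE; rewrite invrK invfM invrK => <-.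
  by field.
- exact: le_lt_trans zL Ld.
by apply: contra_eq_neq zE => ->; rewrite mul0r eq_sym invr_eq0 -cabs_gt0.
Qed.

(* Along the solutions of [A / z + b z = t + T i] with [T] large, a non-constant
   analytic function keeps the imaginary part of its value at [0] for at most
   one [t]: expand [T ^ e * (g z - g 0)] to second order, using that [T z]
   tends to [- i A]. *)
Lemma exceptional_abscissa A b g : A != 0 -> analytic_at b 0 -> analytic_at g 0 ->
  ~ (exists2 r : R, 0 < r & forall z, cabs (z - 0) < r -> g z = g 0) ->
  exists kap : R, forall t : R, t != kap -> exists2 d : R, 0 < d &
    forall z (T : R), z != 0 -> cabs z < d -> T != 0 ->
      A / z + b z = t +i* T -> Im (g z) != Im (g 0).
Proof.
move=> A0 ab ag nc; have agp := analyticB ag (analytic_cst (g 0) 0).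
have [[r r0 H]|[e [k [ak k0 [r r0 H]]]]] := analytic_factor agp.
  by case: nc; exists r => // z /H/eqP; rewrite subr_eq0 => /eqP.
have e0 : (0 < e)%N.
  rewrite lt0n; apply/eqP => e0; have := H 0; rewrite !subrr cabs0 e0 expr0 mul1r => /(_ r0).
  by move/esym/eqP; rewrite (negPf k0).
(* Along the solutions [x] is the limit of [T * z], and [ga] that of [T ^+ e * (g z - g 0)]. *)
pose x : C := - 'i%C * A; pose ga := x ^+ e * k 0.
have i0 : 'i%C != 0 :> C by apply/eqP => -[/eqP]; rewrite oner_eq0.
have x0 : x != 0 by rewrite /x mulf_neq0// oppr_eq0.
have ga0 : ga != 0 by rewrite mulf_neq0// expf_neq0.
pose al := Im (x ^+ e.+1 * cderiv k 0).
(* The only [t] at which the second-order term [Im (D * x)] vanishes when [ga] is real. *)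
pose kap := Re (b 0) - al / (e%:R * Re ga).
exists kap => t tk.
pose m z : C := 'i%C * (t%:C - b z).
have am : analytic_at m 0 by apply/analyticZ/analyticB => //; exact: analytic_cst.
pose D := e%:R * x ^+ e.-1 * m 0 * k 0 + x ^+ e * cderiv k 0.
(* On the solutions [Phi z = T ^+ e * (g z - g 0)], so [Im (Phi z) = 0] if [g] keeps the imaginary
   part of its value at [0]. *)
pose Phi z := (x + z * m z) ^+ e * k z.
have dPhi : is_cderiv Phi 0 D.
  have d1 := is_cderivD (is_cderiv_cst x 0) (is_cderiv_mulid am).
  have := is_cderivM (is_cderivX e d1) (analytic_cderiv ak).
  by rewrite mul0r addr0 add0r.
have Phi0 : Phi 0 = ga by rewrite /Phi mul0r addr0.
have Dx : D * x = ga * (e%:R * m 0) + x ^+ e.+1 * cderiv k 0.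
  have xe : x ^+ e = x * x ^+ e.-1 by rewrite -exprS prednK.
  by rewrite /D /ga [x ^+ e.+1]exprS xe; ring.
have main : Im ga != 0 \/ Im ga = 0 /\ Im (D * x) != 0.
  have [iga|] := eqVneq (Im ga) 0; [right; split=> //|by left].
  have gaR : ga = (Re ga)%:C by apply: complex_eq.
  have rga : Re ga != 0 by apply: contra ga0 => /eqP E; rewrite gaR E.
  rewrite Dx ImD -/al gaR Im_scale.
  have eC : e%:R = (e%:R)%:C :> C by rewrite rmorph_nat.
  rewrite eC Im_scale /m Im_mul/= mul0r mul1r add0r ReB/=.
  have e1 : e%:R != 0 :> R by rewrite pnatr_eq0 -lt0n.
  apply: contra tk => /eqP E; apply/eqP; rewrite /kap.
  have : e%:R * Re ga * (t - Re (b 0)) = - al by lra.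
  move=> E2; have : t - Re (b 0) = - al / (e%:R * Re ga).
    by rewrite -E2; field; rewrite e1 rga.
  by rewrite mulNr; lra.
have solve z (T : R) : z != 0 -> cabs (z - 0) < r -> T != 0 -> A / z + b z = t +i* T ->
    Im (g z) = Im (g 0) -> Im (Phi z) = 0 /\ T%:C * z = x + z * m z.
  move=> z0 zr T0 E iE.
  have Tz : T%:C * z = x + z * m z.
    have tT : t +i* T = t%:C + 'i%C * T%:C by rewrite [LHS]complexE.
    have AE : A = z * (t%:C + 'i%C * T%:C - b z) by rewrite -tT -E; field.
    have ii : 'i%C * 'i%C = -1 :> C by apply: complex_eq; rewrite ?Re_mul ?Im_mul/=; ring.
    rewrite /x /m {1}AE.
    have -> : - 'i%C * (z * (t%:C + 'i%C * T%:C - b z)) + z * ('i%C * (t%:C - b z)) =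
      - ('i%C * 'i%C) * z * T%:C by ring.
    by rewrite ii; ring.
  have TX : T%:C ^+ e = (T ^+ e)%:C :> C by rewrite rmorphXn.
  have zk : z ^+ e * k z = g z - g 0 by rewrite H// subr0.
  by split=> //; rewrite /Phi -Tz exprMn -mulrA zk TX Im_scale ImB iE subrr mulr0.
pose B := cabs (m 0) + 1.
have B0 : 0 < B by have := cabs_ge0 (m 0); rewrite /B; lra.
have [rm rm0 Hm] := analytic_continuous am ltr01.
have mB z : cabs (z - 0) < rm -> cabs (m z) <= B.
  move=> /Hm; have := cabsD (m z - m 0) (m 0); rewrite subrK /B; lra.
case: main => [iga|[iga iD]].
  have ig : 0 < `|Im ga| by rewrite normr_gt0.
  have [r1 r10 H1] := dPhi 1 ltr01.
  have K0 : 0 <= cabs D + 1 by have := cabs_ge0 D; lra.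
  have ig2 : 0 < `|Im ga| / 2 by lra.
  have m0 : 0 < Num.min r r1 by rewrite lt_min r0.
  have [s [s0]] := small_radius K0 ig2 m0; rewrite le_min => /andP[sr s1] Ks.
  exists s => // z T z0 zs T0 E; apply/eqP => iE.
  have zr : cabs (z - 0) < r by rewrite subr0; lra.
  have [iP _] := solve z T z0 zr T0 E iE.
  have := H1 z; rewrite !subr0 Phi0 => /(_ ltac:(lra)) h1.
  have h2 : `|Im ga| <= cabs (Phi z - ga - D * z) + cabs (D * z).
    have -> : Im ga = - Im (Phi z - ga - D * z + D * z) by rewrite subrK ImB iP; ring.
    by rewrite normrN; apply: le_trans (Im_le_cabs _) (cabsD _ _).
  have h3 : (cabs D + 1) * cabs z <= (cabs D + 1) * s by rewrite ler_wpM2l// ltW.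
  by move: h2 h3; rewrite cabsM; lra.
(* Multiplying the first-order expansion of [Phi] by [T] replaces [D * z] by [D * (T * z)], which
   tends to [D * x]. *)
have iD0 : 0 < `|Im (D * x)| by rewrite normr_gt0.
have xp : 0 < cabs x by rewrite cabs_gt0.
pose ep := `|Im (D * x)| / (4 * (cabs x + 1)).
have ep0 : 0 < ep by rewrite divr_gt0//; lra.
have [r1 r10 H1] := dPhi ep ep0.
have K0 : 0 <= cabs D * B + B by rewrite addr_ge0 ?mulr_ge0 ?cabs_ge0// ltW.
have m0 : 0 < Num.min (Num.min r r1) rm by rewrite !lt_min r0 r10.
pose q := Num.min 1 (`|Im (D * x)| / 4).
have q0 : 0 < q by rewrite lt_min ltr01; lra.
have q1 : q <= 1 by rewrite ge_min lexx.
have q4 : q <= `|Im (D * x)| / 4 by rewrite ge_min lexx orbT.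
have [s [s0]] := small_radius K0 q0 m0; rewrite !le_min => /andP[/andP[sr s1] sm] Ks.
exists s => // z T z0 zs T0 E; apply/eqP => iE.
have zr : cabs (z - 0) < r by rewrite subr0; lra.
have [iP Tz] := solve z T z0 zr T0 E iE.
have := H1 z; rewrite !subr0 Phi0 => /(_ ltac:(lra)) h1.
have h2 : `|Im (D * z)| <= ep * cabs z.
  have -> : Im (D * z) = - Im (Phi z - ga - D * z) by rewrite !ImB iP iga; ring.
  by rewrite normrN; apply: le_trans (Im_le_cabs _) h1.
have h3 : `|Im (D * (T%:C * z))| <= ep * cabs (T%:C * z).
  rewrite mulrCA Im_scale normrM cabsM cabsC [ep * _]mulrCA ler_wpM2l//.
have zB : cabs (z * m z) <= s * B.
  by rewrite cabsM ler_pM ?cabs_ge0 ?mB ?subr0//; lra.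
have DB : 0 <= cabs D * B by rewrite mulr_ge0 ?cabs_ge0// ltW.
have sB : 0 <= s * B by rewrite mulr_ge0// ltW.
have sDB : 0 <= cabs D * B * s by rewrite mulr_ge0// ltW.
have sB1 : s * B <= 1 by lra.
have DzB : cabs (D * (z * m z)) <= `|Im (D * x)| / 4.
  rewrite cabsM; apply: le_trans (ler_wpM2l (cabs_ge0 D) zB) _; lra.
have h4 : `|Im (D * x)| <= `|Im (D * (T%:C * z))| + cabs (D * (z * m z)).
  have -> : D * x = D * (T%:C * z) - D * (z * m z) by rewrite Tz; ring.
  rewrite ImB; apply: le_trans (ler_normB _ _) _; rewrite lerD2l; exact: Im_le_cabs.
have h5 : cabs (T%:C * z) <= cabs x + 1.
  by rewrite Tz; apply: le_trans (cabsD _ _) _; lra.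
have h6 : ep * cabs (T%:C * z) <= `|Im (D * x)| / 4.
  apply: le_trans (ler_wpM2l (ltW ep0) h5) _.
  by apply: le_of_eq; rewrite /ep; field; rewrite gt_eqF//; lra.
by lra.
Qed.

End NearPole.

(** * A point with non-zero combined residue near a common singularity *)

Section ResiduePoint.
Variables (R : realType) (S : set R) (c : R -> R).
Hypotheses (S_sa : self_avoiding S) (c_neq0 : forall s, S s -> c s != 0)
  (c_l1 : summable S (fun s => (c s)%:E)).
Local Notation C := R[i].
Local Notation cS := (cS S c).
Local Notation ct := (ct S c).
Local Notation res := (res S c).

Definition near0 (P : C -> Prop) : Prop :=
  exists2 r : R, 0 < r & forall z, z != 0 -> cabs z < r -> P z.

Lemma near0_mono (P Q : C -> Prop) : (forall z, P z -> Q z) -> near0 P -> near0 Q.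
Proof. by move=> PQ [r r0 H]; exists r => // z z0 zr; apply/PQ/H. Qed.

Lemma near0I (P Q : C -> Prop) : near0 P -> near0 Q -> near0 (fun z => P z /\ Q z).
Proof.
move=> [r r0 H] [s s0 K]; exists (Num.min r s); first by rewrite lt_min r0.
by move=> z z0; rewrite lt_min => /andP[zr zs]; split; [exact: H|exact: K].
Qed.

Lemma cS_large_finite (e : R) : 0 < e ->
  exists F : seq R, forall s, e <= `|cS s| -> s \in F.
Proof.
move=> e0; have [K K0 sK] := cS_summable c_l1.
pose X := [set s | e <= `|cS s|]%classic.
have [fX|/(infinite_set_fset (Num.bound (K / e)).+1)[A AX cA]] := pselect (finite_set X).
  by exists (fset_set X) => s sX; rewrite in_fset_set// inE.
exfalso; have := sK A; apply/negP; rewrite -ltNge.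
apply: lt_le_trans (_ : \sum_(s <- A) e <= _); last first.
  rewrite big_seq [leRHS]big_seq; apply: ler_sum => s sA; rewrite cabsC.
  exact: AX.
rewrite big_const_seq count_predT iter_addr_0 -mulr_natl -ltr_pdivrMr//.
apply: lt_le_trans (_ : (Num.bound (K / e))%:R <= _).
  by rewrite archi_boundP// divr_ge0// ltW.
by rewrite ler_nat; exact: leq_trans cA.
Qed.

Variables (J : finType) (G : J -> C -> C) (A : J -> C) (b : J -> C -> C) (r0 : R).
Hypotheses (r00 : 0 < r0)
  (GE : forall j z, z != 0 -> cabs z < r0 -> G j z = A j / z + b j z)
  (ab : forall j, analytic_at (b j) 0)
  (G_distinct : forall i j, near0 (fun z => G i z = G j z) -> i = j)
  (G_nonconst : forall j k, ~ near0 (fun z => G j z = k))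
  (G_real : forall i j (q : R) k,
     near0 (fun z => G i z - q%:C * G j z = k) -> Im k = 0).
Variable j0 : J.
Hypothesis Aj0 : A j0 != 0.

(** The relations under which poles can coincide systematically: odd factors preserve half-integer
    ordinates, and a real shift moves only abscissas. *)
Definition commensurable (i : J) : Prop := exists (p q : int) (t : R),
  [/\ oddz p, oddz q & near0 (fun z => q%:~R * G i z = p%:~R * G j0 z + t%:C)].

Lemma oddzC (q : int) : oddz q -> (q%:~R : C) != 0.
Proof.
move=> /(oddz_neq0 R); apply: contra => /eqP E; rewrite -(realC_eq0).
by rewrite -E rmorph_int.
Qed.

(** A common odd denominator [Q] turns the rational factors into the odd integers that
    self-avoidance speaks of. *)
Lemma common_scale (s : seq J) : exists Q : int, oddz Q /\
  forall i, i \in s -> commensurable i -> exists (w : int) (t : R),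
    oddz w /\ near0 (fun z => G i z = w%:~R * (G j0 z / Q%:~R) + t%:C).
Proof.
elim: s => [|j s [Q [oQ IH]]]; first by exists 1; split=> //; exists 0.
have [[p [q [t [op oq E]]]]|nK] := pselect (commensurable j); last first.
  exists Q; split=> // i; rewrite inE => /predU1P[->//|]; exact: IH.
have [q0 Q0] := (oddzC oq, oddzC oQ).
exists (Q * q); split; first exact: oddzM.
move=> i; rewrite inE => /predU1P[->|si] Ki.
  exists (p * Q), (t / q%:~R); split; first exact: oddzM.
  apply: near0_mono E => z E; apply: (mulfI q0); rewrite E realCM realCV !intrM.
  have -> : (q%:~R : R)%:C = q%:~R by rewrite rmorph_int.
  by field; rewrite q0 Q0.
have [w [u [ow {}E]]] := IH i si Ki.
exists (w * q), u; split; first exact: oddzM.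
apply: near0_mono E => z ->; rewrite !intrM; field.
by rewrite q0 Q0.
Qed.

(* [t] is the common abscissa of the candidate poles, [Ah / z + bh z] the common
   unit of the commensurable functions. *)
Section Scale.
Variables (Ah : C) (bh : C -> C) (t e : R).
Hypotheses (Ah0 : Ah != 0) (abh : analytic_at bh 0) (e0 : 0 < e).

Definition pole_ordinate (n : nat) : R := n%:R + 2^-1.

Definition sol (d : R) (n : nat) (z : C) : Prop :=
  [/\ z != 0, cabs z < d & Ah / z + bh z = t +i* pole_ordinate n].

(** Commensurable functions are left to self-avoidance. The residues of the others must be
    negligible against the main one, which is of order [cabs z ^+ 2]. If [A i != 0], the derivative
    of [G i] grows like [z ^- 2] too, and a small coefficient suffices; if [A i = 0] this gain is
    missing and the coefficient must vanish. *)
Definition quiet (i : J) (z : C) : Prop :=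
  commensurable i \/ (if A i == 0 then ct (G i z) = 0 else `|ct (G i z)| < e).

Lemma quiet_nhalf i z : ~ half (G i z) -> quiet i z.
Proof. by move=> nh; right; rewrite /ct asboolF//; case: ifP; rewrite ?normr0. Qed.

(** Here [G i] stays near [b i 0], so a pole would have the ordinate of [b i 0], which the choice of
    [t] excludes. *)
Lemma quiet_regular i (kap : R) : A i = 0 -> t != kap ->
  (t != kap -> exists2 d : R, 0 < d & forall z (T : R), z != 0 -> cabs z < d -> T != 0 ->
      Ah / z + bh z = t +i* T -> Im (b i z) != Im (b i 0)) ->
  exists2 d : R, 0 < d & forall n z, sol d n z -> quiet i z.
Proof.
move=> Ai tk /(_ tk)[d d0 Hd].
have Gb z : z != 0 -> cabs z < r0 -> G i z = b i z.
  by move=> z0 zr; rewrite GE// Ai mul0r add0r.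
have [hb|nhb] := pselect (half (b i 0)).
  have [r rp Hr] := analytic_continuous (ab i) ltr01.
  exists (Num.min (Num.min d r) r0); first by rewrite !lt_min d0 rp.
  move=> n z [z0]; rewrite !lt_min => /andP[/andP[zd zr] zr0] E; apply: quiet_nhalf.
  rewrite Gb// => hz.
  have T0 : pole_ordinate n != 0 by rewrite gt_eqF// ltr_wpDl// invr_gt0.
  have /eqP := Hd z _ z0 zd T0 E; apply; apply: half_discrete => //.
  rewrite -ImB; apply: le_lt_trans (Im_le_cabs _) _; apply: Hr; rewrite subr0//.
have [q q0 Hq] := nhalf_nbhd nhb; have [r rp Hr] := analytic_continuous (ab i) q0.
exists (Num.min r r0); first by rewrite lt_min rp.
move=> n z [z0]; rewrite lt_min => /andP[zr zr0] _; apply: quiet_nhalf.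
rewrite Gb//; apply: Hq; rewrite -ImB; apply: le_lt_trans (Im_le_cabs _) _.
by apply: Hr; rewrite subr0.
Qed.

(** If the ratio of the leading coefficients is not real, the real part of [G i] leaves the finite
    set of abscissas with coefficient at least [e] as [n] grows. *)
Lemma quiet_transverse i : Im (A i / Ah) != 0 ->
  exists (d : R) (n0 : nat), 0 < d /\ forall n z, (n0 <= n)%N -> sol d n z -> quiet i z.
Proof.
move=> im; have [F HF] := cS_large_finite e0; set rho := A i / Ah in im.
have Ai : A i != 0 by apply: contraNneq im => E; rewrite /rho E mul0r.
pose phi z := b i z - rho * bh z.
have aphi : analytic_at phi 0 by apply: analyticB (ab i) (analyticZ _ abh).
have [r rp Hr] := analytic_continuous aphi ltr01.
pose B := \sum_(s <- F) `|s| + `|Re rho * t| + cabs (phi 0) + 1.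
have ip : 0 < `|Im rho| by rewrite normr_gt0.
exists (Num.min r r0), (Num.bound (`|B| / `|Im rho|)).
split; first by rewrite lt_min rp.
move=> n z n0 [z0]; rewrite lt_min => /andP[zr zr0] E; right.
rewrite (negPf Ai) ltNge; apply/negP => big.
have hz : half (G i z).
  by apply: contrapT => nh; move: big; rewrite /ct asboolF// normr0 leNgt e0.
have sF : Re (G i z) \in F by apply: HF; move: big; rewrite /ct asboolT.
have GzE : G i z = rho * (t +i* pole_ordinate n) + phi z.
  by rewrite GE// -E /phi /rho; field; rewrite z0 Ah0.
have RE : Re (G i z) = Re rho * t - Im rho * pole_ordinate n + Re (phi z).
  by rewrite GzE ReD Re_mul.
have sB : `|Re (G i z)| <= \sum_(s <- F) `|s|.
  by rewrite (big_rem _ sF)/= lerDl sumr_ge0.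
have pb : `|Re (phi z)| <= cabs (phi 0) + 1.
  apply: le_trans (Re_le_cabs _) _; have := Hr z; rewrite subr0 => /(_ zr).
  by have := cabsD (phi z - phi 0) (phi 0); rewrite subrK; lra.
have : `|Im rho| * pole_ordinate n <= B.
  have -> : `|Im rho| * pole_ordinate n = `|Im rho * pole_ordinate n|.
    by rewrite normrM (ger0_norm (_ : 0 <= pole_ordinate n))// addr_ge0// invr_ge0.
  have -> : Im rho * pole_ordinate n = Re rho * t - Re (G i z) + Re (phi z) by rewrite RE; ring.
  apply: le_trans (ler_normD _ _) _; apply: le_trans (lerD (ler_normB _ _) (lexx _)) _.
  by rewrite /B; lra.
apply/negP; rewrite -ltNge mulrC -ltr_pdivrMr//.
apply: le_lt_trans (_ : `|B| / `|Im rho| < _); first by rewrite ler_pM2r ?invr_gt0// ler_norm.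
apply: lt_le_trans (archi_boundP _) _; first by rewrite divr_ge0.
by apply: le_trans (_ : n%:R <= _); rewrite ?ler_nat// lerDl invr_ge0.
Qed.

(** Along the solutions [Im (G i z)] is nearly [q * n] plus a constant. Half-integer values at both
    [n] and [n'] would bring [(n' - n) * q] closer than [eta] to an integer. *)
Lemma quiet_irrational i (q : R) (m : nat) : A i / Ah = q%:C -> A i != 0 ->
  (forall (d : nat) (k : int), (0 < d)%N -> d%:R * q != k%:~R) ->
  exists2 dl : R, 0 < dl & forall n n' z z', (n < n')%N -> (n' <= n + m)%N ->
    sol dl n z -> sol dl n' z' -> quiet i z \/ quiet i z'.
Proof.
move=> rq Ai irr; pose phi z := b i z - q%:C * bh z.
have aphi : analytic_at phi 0 by apply: analyticB (ab i) (analyticZ _ abh).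
have [eta eta0 Heta] : exists2 eta : R, 0 < eta & forall (d : nat) (k : int),
    (0 < d <= m)%N -> eta <= `|d%:R * q - k%:~R|.
  elim: (m) => [|n [eta eta0 IH]]; first by exists 1 => // -[|d] k.
  pose x := n.+1%:R * q; pose k0 := Num.floor x.
  have /andP[x0 x1] := floor_itv x; rewrite -/k0 intrD in x0 x1.
  have xk : k0%:~R != x by rewrite eq_sym; exact: irr.
  pose u := Num.min (x - k0%:~R) (k0%:~R + 1 - x).
  have u0 : 0 < u by rewrite lt_min !subr_gt0 lt_def eq_sym xk x0.
  have u1 : u <= x - k0%:~R by rewrite ge_min lexx.
  have u2 : u <= k0%:~R + 1 - x by rewrite ge_min lexx orbT.
  exists (Num.min eta u); first by rewrite lt_min eta0.
  move=> d k /andP[d0]; rewrite leq_eqVlt => /predU1P[->|]; last first.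
    by rewrite ltnS => dn; rewrite ge_min IH ?d0.
  rewrite ge_min; apply/orP; right; rewrite -/x.
  have [kk|kk] := leP k k0.
    have : k%:~R <= k0%:~R :> R by rewrite ler_int.
    by have := ler_norm (x - k%:~R); lra.
  have : k0%:~R + 1 <= k%:~R :> R by rewrite -[1]/(1%:~R) -intrD ler_int lezD1.
  by have := ler_norm (- (x - k%:~R)); rewrite normrN; lra.
have e2 : 0 < eta / 2 by lra.
have [r rp Hr] := analytic_continuous aphi e2.
exists (Num.min r r0); first by rewrite lt_min rp.
move=> n n' z z' nn n'm [z0]; rewrite lt_min => /andP[zr zr0] E.
move=> [z'0]; rewrite lt_min => /andP[z'r z'r0] E'.
have [[k hk]|nh] := pselect (half (G i z)); last by left; exact: quiet_nhalf.
have [[k' hk']|nh] := pselect (half (G i z')); last by right; exact: quiet_nhalf.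
exfalso.
have AE : A i = q%:C * Ah by rewrite -rq divfK.
have GzE w l : w != 0 -> cabs w < r0 -> Ah / w + bh w = t +i* pole_ordinate l ->
    Im (G i w) = q * pole_ordinate l + Im (phi w).
  move=> w0 wr Ew; have -> : G i w = q%:C * (t +i* pole_ordinate l) + phi w.
    by rewrite GE// -Ew /phi AE; field.
  by rewrite ImD Im_scale.
rewrite (GzE z n) // in hk; rewrite (GzE z' n') // in hk'.
have dm : (0 < n' - n <= m)%N by rewrite subn_gt0 nn leq_subLR.
have := Heta (n' - n)%N (k' - k) dm.
have -> : (n' - n)%:R * q - (k' - k)%:~R = Im (phi z) - Im (phi z').
  rewrite intrB natrB 1?ltnW//.
  by move: hk hk'; rewrite /pole_ordinate; lra.
have h1 := Hr z; have h2 := Hr z'; rewrite !subr0 in h1 h2.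
have {}h1 := h1 zr; have {}h2 := h2 z'r; rewrite -ImB.
have -> : phi z - phi z' = (phi z - phi 0) - (phi z' - phi 0) by ring.
by have := Im_le_cabs (phi z - phi 0 - (phi z' - phi 0));
  have := cabsB (phi z - phi 0) (phi z' - phi 0); lra.
Qed.

(** Near [0], a point that is not quiet forces [phi z = phi 0]. If [phi] is not constant, this fails
    close to [0]. Otherwise [G i] is affine in [G j0]: [G_real] makes the constant real, one such
    point makes [q] a quotient of odd integers, and so [i] is commensurable after all. *)
Lemma quiet_rational i (q : R) (Q : int) (N : nat) (k : int) : oddz Q ->
  Ah = A j0 / Q%:~R -> (forall z, bh z = b j0 z / Q%:~R) ->
  A i / Ah = q%:C -> A i != 0 -> (0 < N)%N -> N%:R * q = k%:~R ->
  exists2 dl : R, 0 < dl & forall n z, sol dl n z -> quiet i z.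
Proof.
move=> oQ AhE bhE rq Ai N0 Nq; have [F HF] := cS_large_finite e0.
have [Ki|nK] := pselect (commensurable i); first by exists 1 => // n z _; left.
pose phi z := b i z - q%:C * bh z.
have aphi : analytic_at phi 0 by apply: analyticB (ab i) (analyticZ _ abh).
have AE : A i = q%:C * Ah by rewrite -rq divfK.
have GzE w : w != 0 -> cabs w < r0 -> G i w = q%:C * (Ah / w + bh w) + phi w.
  by move=> w0 wr; rewrite GE// /phi AE; field.
(* finitely many real parts and a lattice of imaginary parts are available *)
have [e1 e10 He1] : exists2 e1 : R, 0 < e1 & forall s, s \in F ->
    s - q * t != Re (phi 0) -> e1 <= `|s - q * t - Re (phi 0)|.
  elim: (F) => [|s F' [e1 e10 IH]]; first by exists 1.
  have [E|E] := eqVneq (s - q * t) (Re (phi 0)).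
    exists e1 => // s'; rewrite inE => /predU1P[->|]; last exact: IH.
    by rewrite E eqxx.
  exists (Num.min e1 `|s - q * t - Re (phi 0)|).
    by rewrite lt_min e10 normr_gt0 subr_eq0.
  move=> s'; rewrite inE => /predU1P[->|s'F] nE; rewrite ge_min ?lexx ?orbT//.
  by rewrite IH.
have Np : 0 < N%:R :> R by rewrite ltr0n.
have [e2 e20 He2] : exists2 e2 : R, 0 < e2 & forall l : int,
    l%:~R / (2 * N%:R) != Im (phi 0) -> e2 <= `|l%:~R / (2 * N%:R) - Im (phi 0)|.
  pose x := Im (phi 0) * (2 * N%:R); pose k0 := Num.floor x.
  have /andP[x0 x1] := floor_itv x; rewrite -/k0 intrD in x0 x1.
  pose u := if x == k0%:~R then 1 else Num.min (x - k0%:~R) (k0%:~R + 1 - x).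
  have u0 : 0 < u.
    by rewrite /u; case: eqP => // /eqP xk; rewrite lt_min !subr_gt0 lt_def xk x0.
  have N2 : 0 < 2 * N%:R :> R by lra.
  exists (u / (2 * N%:R)); first by rewrite divr_gt0.
  move=> l nl; have -> : l%:~R / (2 * N%:R) - Im (phi 0) = (l%:~R - x) / (2 * N%:R).
    by rewrite /x; field; rewrite gt_eqF.
  rewrite normrM (gtr0_norm (_ : 0 < (2 * N%:R)^-1)) ?invr_gt0// ler_pM2r ?invr_gt0//.
  have lx : l%:~R != x.
    by apply: contra nl => /eqP ->; rewrite /x mulfK// gt_eqF.
  have [ll|ll] := ltP k0 l.
    have : k0%:~R + 1 <= l%:~R :> R by rewrite -[1]/(1%:~R) -intrD ler_int lezD1.
    have := ler_norm (l%:~R - x); rewrite /u; case: eqP => [->|_]; first lra.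
    have : Num.min (x - k0%:~R) (k0%:~R + 1 - x) <= k0%:~R + 1 - x by rewrite ge_min lexx orbT.
    by lra.
  have : l%:~R <= k0%:~R :> R by rewrite ler_int.
  have := ler_norm (- (l%:~R - x)); rewrite normrN /u; case: eqP => [xk|_]; last first.
    have : Num.min (x - k0%:~R) (k0%:~R + 1 - x) <= x - k0%:~R by rewrite ge_min lexx.
    by lra.
  have : (l < k0)%R by rewrite lt_def ll andbT eq_sym; apply: contra lx => /eqP ->; rewrite xk.
  by rewrite -lezD1 -(ler_int R) intrD; lra.
have m0 : 0 < Num.min e1 e2 by rewrite lt_min e10.
have [r rp Hr] := analytic_continuous aphi m0.
have bad n z : sol (Num.min r r0) n z -> ~ quiet i z ->
    phi z = phi 0 /\ exists k' : int, q * pole_ordinate n + Im (phi z) = k'%:~R + 2^-1.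
  move=> [z0]; rewrite lt_min => /andP[zr zr0] E nq.
  have hz : half (G i z) by apply: contrapT => /quiet_nhalf.
  have big : e <= `|cS (Re (G i z))|.
    rewrite leNgt; apply/negP => lt; apply: nq; right.
    by rewrite (negPf Ai) /ct asboolT.
  have sF := HF _ big.
  have [k' hk'] := hz; rewrite GzE// E ImD Im_scale/= in hk'.
  rewrite GzE// E ReD Re_scale/= in sF.
  have pz : cabs (phi z - phi 0) < Num.min e1 e2 by apply: Hr; rewrite subr0.
  rewrite lt_min in pz; move: pz => /andP[pz1 pz2].
  split; last by exists k'.
  apply: complex_eq.
    apply/eqP/negPn/negP => nE; have := He1 _ sF.
    have -> : q * t + Re (phi z) - q * t = Re (phi z) by ring.
    move/(_ nE); rewrite -ReB; have := Re_le_cabs (phi z - phi 0); lra.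
  apply/eqP/negPn/negP => nE.
  have lE : ((2 * k' + 1) * N%:Z - k * (2 * n%:Z + 1))%:~R / (2 * N%:R) = Im (phi z).
    rewrite intrB !intrM !intrD !intrM -Nq -!pmulrn.
    have -> : Im (phi z) = k'%:~R + 2^-1 - q * pole_ordinate n by lra.
    by rewrite /pole_ordinate; field; rewrite gt_eqF.
  have := He2 ((2 * k' + 1) * N%:Z - k * (2 * n%:Z + 1)); rewrite lE => /(_ nE).
  by rewrite -ImB; have := Im_le_cabs (phi z - phi 0); lra.
have [[s s0 cst]|[s s0 ncst]] := analytic_zeros (analyticB aphi (analytic_cst (phi 0) 0)); last first.
  exists (Num.min (Num.min r r0) s); first by rewrite !lt_min rp r00.
  move=> n z [z0]; rewrite lt_min => /andP[zr zs] E; apply: contrapT => nq.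
  have [pz _] := bad n z (And3 z0 zr E) nq.
  by have := ncst z z0; rewrite subr0 => /(_ zs); rewrite pz subrr eqxx.
exists (Num.min r r0); first by rewrite lt_min rp.
move=> n z sz; apply: contrapT => nq; apply: nK.
have [pz [k' hk']] := bad n z sz nq.
have [Q0 QR] := (oddzC oQ, oddz_neq0 R oQ).
have QC : (Q%:~R : C) = (Q%:~R : R)%:C by rewrite rmorph_int.
have hE w : w != 0 -> cabs w < r0 -> Ah / w + bh w = G j0 w / Q%:~R.
  by move=> w0 wr; rewrite GE// AhE bhE; field; rewrite w0 Q0.
have nc : near0 (fun w => G i w = q%:C * (G j0 w / Q%:~R) + phi 0).
  exists (Num.min s r0); first by rewrite lt_min s0.
  move=> w w0; rewrite lt_min => /andP[ws wr]; rewrite GzE// hE//.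
  by have := cst w; rewrite subr0 => /(_ ws)/eqP; rewrite subr_eq0 => /eqP ->.
have re : Im (phi 0) = 0.
  apply: (@G_real i j0 (q / Q%:~R)); apply: near0_mono nc => w ->.
  by rewrite realCM realCV QC; ring.
rewrite pz re addr0 in hk'.
have n21 : (2 * n%:Z + 1)%:~R != 0 :> R by apply: oddz_neq0; exists n%:Z.
have qE : q = (2 * k' + 1)%:~R / (2 * n%:Z + 1)%:~R.
  rewrite !intrD !intrM -!pmulrn; move: hk'; rewrite /pole_ordinate => hk'.
  rewrite intrD intrM -pmulrn in n21.
  have -> : 2%:~R * k'%:~R + 1%:~R = q * (2 * n%:R + 1) :> R by lra.
  by rewrite mulfK.
have pR : phi 0 = (Re (phi 0))%:C by apply: complex_eq.
exists (2 * k' + 1), ((2 * n%:Z + 1) * Q), ((2 * n%:Z + 1)%:~R * Q%:~R * Re (phi 0)); split.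
- by exists k'.
- by apply: oddzM => //; exists n%:Z.
apply: near0_mono nc => w ->; rewrite {1}pR qE !realCM realCV intrM QC.
have cC (l : int) : (l%:~R : C) = (l%:~R : R)%:C by rewrite rmorph_int.
rewrite !cC; set X := ((2 * n%:Z + 1)%:~R : R)%:C; set Y := (Q%:~R : R)%:C.
have X0 : X != 0 by rewrite realC_eq0.
have Y0 : Y != 0 by rewrite realC_eq0.
by move: X0 Y0; move: X Y => X Y X0 Y0; field; rewrite X0 Y0.
Qed.

End Scale.

Lemma cderiv_eq (f g : C -> C) z (r : R) : 0 < r ->
  (forall w, cabs (w - z) < r -> f w = g w) -> cderiv f z = cderiv g z.
Proof.
move=> rp fg; rewrite /cderiv; congr (xget _ _); apply/seteqP; split=> d /= H.
  exact: is_cderiv_near H rp fg.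
by apply: is_cderiv_near H rp _ => w /fg.
Qed.

Lemma finite_lower (s : seq J) (f : J -> R) : (forall i, 0 < f i) ->
  exists2 d : R, 0 < d & forall i, i \in s -> d <= f i.
Proof.
move=> f0; elim: s => [|i s [d d0 IH]]; first by exists 1.
exists (Num.min d (f i)); first by rewrite lt_min d0 f0.
by move=> k; rewrite inE => /predU1P[->|/IH h]; rewrite ge_min ?lexx ?orbT// h.
Qed.

Lemma punctured_ball z (r : R) : z != 0 -> cabs z < r ->
  exists2 q : R, 0 < q & forall w, cabs (w - z) < q -> w != 0 /\ cabs w < r.
Proof.
move=> z0 zr; exists (Num.min (cabs z) (r - cabs z)).
  by rewrite lt_min cabs_gt0 z0 subr_gt0.
move=> w; rewrite lt_min => /andP[wz wr]; split.
  by apply: contraTneq wz => ->; rewrite sub0r cabsN ltxx.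
by have := cabsD (w - z) z; rewrite subrK; lra.
Qed.

Lemma pole_analytic (A' : C) (b' : C -> C) : analytic_at b' 0 ->
  near0 (analytic_at (fun w => A' / w + b' w)).
Proof.
move=> /analytic_nearby[r rp H]; exists r => // z z0 zr.
apply: analyticD; last by apply: H; rewrite subr0.
by apply: analyticZ; apply: analytic_inv z0; exact: analytic_id.
Qed.

(* Among the commensurable [G j], self-avoidance yields an abscissa [t] at which
   exactly one has poles. Following the points where [Ah / z + bh z] takes the
   values [t + (n + 1/2) i], the other [G j] contribute residues that are
   negligible for at least one of any [#|J| + 1] consecutive large [n]. *)
Lemma residue_point (I : Type) (a : I -> J -> R) : (forall j, exists i, a i j != 0) ->
  forall d : R, 0 < d -> exists z i,
    [/\ z != 0, cabs z < d & \sum_j (a i j)%:C * res (G j) z != 0].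
Proof.
move=> a0 d d0; have [Q [oQ HQ]] := common_scale (enum J).
have Q0 := oddzC oQ.
pose Ah := A j0 / Q%:~R; pose bh z := b j0 z / Q%:~R.
have Ah0 : Ah != 0 by rewrite mulf_neq0// invr_eq0.
have abh : analytic_at bh 0 by apply: analyticM (ab j0) (analytic_cst _ _).
have hE z : z != 0 -> cabs z < r0 -> Ah / z + bh z = G j0 z / Q%:~R.
  by move=> z0 zr; rewrite GE// /Ah /bh; field; rewrite z0 Q0.
have /choice[om Hom] : forall i, exists wt : int * R, commensurable i -> oddz wt.1 /\
    near0 (fun z => G i z = wt.1%:~R * (Ah / z + bh z) + wt.2%:C).
  move=> i; have [Ki|] := pselect (commensurable i); last by exists (0, 0).
  have [w [u [ow E]]] := HQ i (mem_enum _ i) Ki; exists (w, u) => _; split=> //=.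
  have n0 : near0 (fun z => Ah / z + bh z = G j0 z / Q%:~R) by exists r0.
  by apply: near0_mono (near0I E n0) => z [-> ->].
pose L := [seq om i | i <- enum J & `[< commensurable i >]].
have omL i : commensurable i -> om i \in L.
  by move=> Ki; apply: map_f; rewrite mem_filter mem_enum andbT; apply/asboolP.
have om_inj i j : commensurable i -> commensurable j -> om i = om j -> i = j.
  move=> Ki Kj E; apply: G_distinct; have [_ Ei] := Hom i Ki; have [_ Ej] := Hom j Kj.
  by apply: near0_mono (near0I Ei Ej) => z [-> ->]; rewrite E.
have uL : uniq L.
  rewrite map_inj_in_uniq; first by rewrite filter_uniq// enum_uniq.
  move=> i j.
  by rewrite !mem_filter => /andP[/asboolP Ki _] /andP[/asboolP Kj _]; exact: om_inj.
have Kj0 : commensurable j0.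
  exists 1, 1, 0; split; [by exists 0|by exists 0|].
  by exists r0 => // z _ _; rewrite addr0.
have L0 : L != [::] by apply/eqP => L0; have := omL _ Kj0; rewrite L0.
have oL p : p \in L -> oddz p.1.
  by move=> /mapP[k]; rewrite mem_filter => /andP[/asboolP Kk _] ->; have [] := Hom k Kk.
have /choice[kap Hkap] : forall i, exists k : R, A i = 0 -> forall t : R, t != k ->
    exists2 d : R, 0 < d & forall z (T : R), z != 0 -> cabs z < d -> T != 0 ->
      Ah / z + bh z = t +i* T -> Im (b i z) != Im (b i 0).
  move=> i; have [Ai|Ai] := eqVneq (A i) 0; last by exists 0 => E; rewrite E eqxx in Ai.
  have [|k Hk] := exceptional_abscissa Ah0 abh (ab i); last by exists k.
  move=> [r rp H]; apply: (@G_nonconst i (b i 0)).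
  exists (Num.min r r0); first by rewrite lt_min rp.
  move=> z z0; rewrite lt_min => /andP[zr zr0].
  by rewrite GE// Ai mul0r add0r H// subr0.
(* This is where infinitely many points covered once are needed: [t] has to avoid the exceptional
   abscissas. *)
have [p [t [pL tX [pt pn]]]] := covers_once_infinite S_sa [seq kap i | i <- enum J] uL L0 oL.
have tk i : t != kap i by apply: contra tX => /eqP ->; apply: map_f; rewrite mem_enum.
move: pL => /mapP[js]; rewrite mem_filter => /andP[/asboolP Kjs _] pE.
rewrite {}pE in pt pn.
pose st := (om js).1%:~R * t + (om js).2.
have Sst : S st by exact: pt.
have [i0 ai0] := a0 js.
have ojs := oddz_neq0 R (Hom js Kjs).1.
(* Multiplied by [cderiv hh z], the main term has modulus [W], and the quotient of derivatives in
   the term of a non-commensurable [j] with [A j != 0] is at most [Cj j]; [e] is chosen so that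
   these terms add up to less than [W]. *)
pose W := `|a i0 js * c st / (om js).1%:~R|.
have W0 : 0 < W by rewrite normr_gt0 !mulf_neq0 ?invr_eq0 ?c_neq0.
pose Cj j := 4 * cabs Ah / cabs (A j).
have Cj0 j : 0 <= Cj j by rewrite divr_ge0 ?mulr_ge0 ?cabs_ge0.
pose Sg := \sum_j `|a i0 j| * Cj j.
have Sg0 : 0 <= Sg by apply: sumr_ge0 => j _; rewrite mulr_ge0.
pose e := W / (2 * (Sg + 1)).
have S2 : 0 < 2 * (Sg + 1) by lra.
have e0 : 0 < e by rewrite divr_gt0.
pose m := #|J|.
have /choice[dn Hdn] : forall i, exists dn : R * nat, 0 < dn.1 /\
    forall n n' z z', (dn.2 <= n)%N -> (n < n')%N -> (n' <= n + m)%N ->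
      sol Ah bh t dn.1 n z -> sol Ah bh t dn.1 n' z' -> quiet e i z \/ quiet e i z'.
  move=> i; have [Ki|nK] := pselect (commensurable i).
    by exists (1, 0%N); split=> // *; left; left.
  have [Ai|Ai] := eqVneq (A i) 0.
    have [dl dl0 H] := quiet_regular e0 Ai (tk i) (Hkap i Ai t).
    by exists (dl, 0%N); split=> // n n' z z' _ _ _ /H; left.
  have [im|im] := eqVneq (Im (A i / Ah)) 0; last first.
    have [dl [n0 [dl0 H]]] := quiet_transverse t Ah0 abh e0 im.
    by exists (dl, n0); split=> // n n' z z' nn _ _ /(H _ _ nn); left.
  have rq : A i / Ah = (Re (A i / Ah))%:C by apply: complex_eq.
  have [[N [k [N0 Nq]]]|irr] := pselect (exists (N : nat) (k : int),
      (0 < N)%N /\ N%:R * Re (A i / Ah) = k%:~R).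
    have [dl dl0 H] := @quiet_rational Ah bh t e Ah0 abh e0 i _ Q N k oQ erefl (fun=> erefl) rq Ai N0 Nq.
    by exists (dl, 0%N); split=> // n n' z z' _ _ _ /H; left.
  have [|dl dl0 H] := @quiet_irrational Ah bh t e Ah0 abh e0 i _ m rq Ai.
    by move=> N k N0; apply/eqP => E; apply: irr; exists N, k.
  by exists (dl, 0%N); split=> // n n' z z' _ nn nm; exact: H.
pose hh := fun w : C => Ah / w + bh w.
have /choice[rd Hrd] : forall i, exists r : R, 0 < r /\ forall z, z != 0 -> cabs z < r ->
    (commensurable i -> G i z = (om i).1%:~R * hh z + (om i).2%:C /\
       cderiv (G i) z = (om i).1%:~R * cderiv hh z) /\
    (A i != 0 -> cabs (A i) / 2 <= cabs (z ^+ 2 * cderiv (G i) z)).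
  move=> i.
  have [r1 r10 H1] : exists2 r : R, 0 < r & forall z, z != 0 -> cabs z < r ->
      commensurable i -> G i z = (om i).1%:~R * hh z + (om i).2%:C /\
       cderiv (G i) z = (om i).1%:~R * cderiv hh z.
    have [Ki|nK] := pselect (commensurable i); last by exists 1.
    have [_ [r rp E]] := Hom i Ki; have [r' r'p ah] := pole_analytic Ah abh.
    exists (Num.min r r'); first by rewrite lt_min rp.
    move=> z z0; rewrite lt_min => /andP[zr zr'] _; split; first exact: E.
    have [q q0 Hq] := punctured_ball z0 zr.
    rewrite (cderiv_eq (g := fun w => (om i).1%:~R * hh w + (om i).2%:C) q0); last first.
      by move=> w /Hq[w0 wr]; exact: E.
    have dh := analytic_cderiv (ah z z0 zr').
    rewrite (cderivE (is_cderivD (is_cderivZ _ dh) (is_cderiv_cst _ _))).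
    by rewrite addr0.
  have [Ai|Ai] := eqVneq (A i) 0.
    exists r1; split=> // z z0 zr; split=> //; exact: H1.
  have Ap : 0 < cabs (A i) / 2 by rewrite divr_gt0// cabs_gt0.
  have [r2 r20 H2] := pole_deriv_est (A i) (ab i) Ap.
  exists (Num.min r1 (Num.min r2 r0)); split; first by rewrite !lt_min r10 r20.
  move=> z z0; rewrite !lt_min => /and3P[zr1 zr2 zr0]; split; first exact: H1.
  move=> _; have := H2 z z0 zr2.
  have [q q0 Hq] := punctured_ball z0 zr0.
  rewrite (cderiv_eq (f := G i) (g := fun w => A i / w + b i w) q0); last first.
    by move=> w /Hq[w0 wr]; exact: GE.
  set X := z ^+ 2 * _ => hX; have := cabsB_ge (A i) (X + A i); rewrite opprD addrCA subrr addr0 cabsN.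
  by lra.
have Ahp : 0 < cabs Ah / 2 by rewrite divr_gt0// cabs_gt0.
have [rh rh0 Hrh] := pole_deriv_est Ah abh Ahp.
have [d1 d10 Hd1] := finite_lower (enum J) (fun i => (Hdn i).1).
have [d2 d20 Hd2] := finite_lower (enum J) (fun i => (Hrd i).1).
pose D := Num.min (Num.min d d1) (Num.min d2 rh).
have D0 : 0 < D by rewrite !lt_min d0 d10 d20.
have Dd : D <= d by rewrite !ge_min lexx.
have Dd1 : D <= d1 by rewrite !ge_min lexx !orbT.
have Dd2 : D <= d2 by rewrite !ge_min lexx !orbT.
have Drh : D <= rh by rewrite !ge_min lexx !orbT.
have [B B0 HB] := pole_solve Ah0 abh D0.
pose n0 := (\max_(i : J) (dn i).2 + Num.bound B)%N.
have /choice[zf Hzf] : forall k, exists z, sol Ah bh t D (n0 + k) z.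
  move=> k; have [|z [z0 zD E]] := HB (t +i* pole_ordinate (n0 + k)); last by exists z.
  apply: lt_le_trans (Im_le_cabs _); rewrite /= ger0_norm ?addr_ge0 ?invr_ge0//.
  apply: lt_le_trans (archi_boundP (ltW B0)) _.
  apply: le_trans (_ : (n0 + k)%:R <= _); last by rewrite lerDl invr_ge0.
  by rewrite ler_nat /n0 -addnA addnCA leq_addr.
have solW i n z : sol Ah bh t D n z -> sol Ah bh t (dn i).1 n z.
  move=> [z0 zD E]; split=> //; apply: lt_le_trans zD _; apply: le_trans Dd1 _.
  by apply: Hd1; rewrite mem_enum.
(* Pigeonhole: each [i] fails to be quiet for at most one of [#|J| + 1] consecutive indices. *)
have [k Hk] : exists k, forall i, quiet e i (zf k).
  apply: contrapT => none.
  have /choice[f Hf] : forall k : 'I_m.+1, exists i, ~ quiet e i (zf k).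
    by move=> k; apply/existsNP => all; apply: none; exists k.
  have finj : injective f.
    suff lt (k k' : 'I_m.+1) : (k < k')%N -> f k = f k' -> False.
      move=> k k' E; apply/val_inj; have [kk|kk|//] := ltngtP k k'.
        by exfalso; exact: lt kk E.
      by exfalso; exact: lt kk (esym E).
    move=> kk E; have [_ /(_ (n0 + k)%N (n0 + k')%N (zf k) (zf k'))] := Hdn (f k).
    have h1 : ((dn (f k)).2 <= n0 + k)%N.
      by rewrite /n0 -addnA; apply: leq_trans (leq_addr _ _); exact: leq_bigmax.
    have h2 : (n0 + k' <= n0 + k + m)%N.
      by rewrite -addnA leq_add2l; apply: leq_trans (leq_addl _ _); rewrite -ltnS.
    move=> /(_ h1 _ h2 (solW _ _ _ (Hzf k)) (solW _ _ _ (Hzf k'))).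
    by rewrite ltn_add2l => /(_ kk)[/Hf//|]; rewrite E; exact: Hf.
  by have := leq_card f finj; rewrite card_ord ltnn.
have [z0 zD zE] := Hzf k; set z := zf k in Hk z0 zD zE.
set y := pole_ordinate (n0 + k) in zE.
exists z, i0; split=> //; first exact: lt_le_trans zD Dd.
have zrd i : cabs z < rd i.
  by apply: lt_le_trans zD _; apply: le_trans Dd2 _; apply: Hd2; rewrite mem_enum.
have hz : hh z = t +i* y by exact: zE.
have hd := Hrh z z0 (lt_le_trans zD Drh); rewrite -/hh in hd.
set hp := cderiv hh z in hd.
have z2 : 0 < cabs (z ^+ 2) by rewrite cabs_gt0 expf_neq0.
have hp1 : cabs Ah / 2 <= cabs (z ^+ 2 * hp).
  have := cabsB_ge Ah (z ^+ 2 * hp + Ah); rewrite opprD addrCA subrr addr0 cabsN; lra.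
have hp2 : cabs (z ^+ 2 * hp) <= 2 * cabs Ah.
  have := cabsD (z ^+ 2 * hp + Ah) (- Ah); rewrite addrK cabsN; lra.
have hp0 : hp != 0.
  by apply: contraTneq hp1 => ->; rewrite mulr0 cabs0 -ltNge.
have ctK j : commensurable j -> ct (G j z) = cS ((om j).1%:~R * t + (om j).2).
  move=> Kj; have [oj _] := Hom j Kj; have [/(_ Kj)[-> _] _] := (Hrd j).2 z z0 (zrd j).
  have wC : ((om j).1%:~R : C) = ((om j).1%:~R : R)%:C by rewrite rmorph_int.
  rewrite hz wC /ct asboolT; first by rewrite ReD Re_scale.
  rewrite /half ImD Im_scale/= addr0; have [l ->] := oj.
  exists (2 * l * (n0 + k)%:Z + (n0 + k)%:Z + l).
  by rewrite /y /pole_ordinate !intrD !intrM -!pmulrn; field.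
apply/eqP => sum0.
have : hp * (\sum_j (a i0 j)%:C * res (G j) z) = 0 by rewrite sum0 mulr0.
rewrite mulr_sumr; under eq_bigr do rewrite mulrCA.
rewrite (bigD1 js)//= => E.
have mainE : (a i0 js)%:C * (hp * res (G js) z) = (a i0 js * c st / (om js).1%:~R)%:C.
  rewrite /res ctK// -/st cS_in//.
  have [/(_ Kjs)[_ ->] _] := (Hrd js).2 z z0 (zrd js).
  rewrite -/hp !realCM realCV.
  have -> : ((om js).1%:~R : R)%:C = (om js).1%:~R by rewrite rmorph_int.
  by field; rewrite hp0 oddzC//; have [] := Hom js Kjs.
have : W <= e * Sg.
  rewrite /W -cabsC -mainE; move/eqP: E; rewrite addr_eq0 => /eqP ->; rewrite cabsN.
  apply: le_trans (cabs_sum _ _ _) _; rewrite /Sg mulr_sumr.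
  rewrite [leRHS](bigD1 js)//= -[leLHS]add0r; apply: lerD.
    by apply: mulr_ge0 (ltW e0) _; apply: mulr_ge0.
  apply: ler_sum => j njs; rewrite cabsM cabsC.
  have -> : e * (`|a i0 j| * Cj j) = `|a i0 j| * (e * Cj j) by ring.
  rewrite ler_wpM2l// /res mulrCA cabsM cabsC.
  have eC : 0 <= e * Cj j by rewrite mulr_ge0// ltW.
  have [Kj|nK] := pselect (commensurable j).
    rewrite ctK// cS_out ?normr0 ?mul0r//.
    apply: (pn (om j) (omL _ Kj)); apply: contra njs => /eqP.
    by move=> /(om_inj _ _ Kj Kjs)/eqP.
  have [//|] := Hk j; case: eqP => [_ ->|/eqP Aj lt]; first by rewrite normr0 mul0r.
  have [_ /(_ Aj) dj] := (Hrd j).2 z z0 (zrd j).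
  apply: (ler_pM (normr_ge0 _) (cabs_ge0 _) (ltW lt)).
  have Ajp : 0 < cabs (A j) by rewrite cabs_gt0.
  have dj0 : 0 < cabs (cderiv (G j) z).
    by rewrite -(pmulr_rgt0 _ z2) -cabsM; lra.
  rewrite cabsM cabsV /Cj ler_pdivrMr// mulrAC ler_pdivlMr//.
  rewrite cabsM in hp2; rewrite cabsM in dj; rewrite -(ler_pM2l z2).
  have := ler_wpM2r (ltW Ajp) hp2; have := ler_wpM2l (cabs_ge0 Ah) dj.
  by lra.
apply/negP; rewrite -ltNge /e mulrAC ltr_pdivrMr// ltr_pM2l//; lra.
Qed.

End ResiduePoint.

(** * Propagation of poles through the nonlinearity *)

Section Polar.
Variables (R : realType) (C0 : R) (S : set R) (c : R -> R).
Hypotheses (S_discrete : discrete_subset S) (S_sa : self_avoiding S)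
  (c_neq0 : forall s, S s -> c s != 0) (c_l1 : summable S (fun s => (c s)%:E)).
Local Notation C := R[i].
Local Notation sigC := (sigC C0 S c).
Local Notation sigma := (tanh_series C0 S c).
Local Notation res := (res S c).

Definition germ_eq (f g : R -> R) : Prop :=
  exists2 e : R, 0 < e & forall x, `|x - 1| < e -> f x = g x.

(* The germs at [1] of the [f i] continue to meromorphic functions on a common
   connected domain whose only singularity is a simple pole at [z0] of at least
   one of them. *)
Definition polar (I : finType) (f : I -> R -> R) : Prop :=
  exists (D : C -> Prop) (z0 : C) (F : I -> C -> C) (A : I -> C) (h : I -> C -> C),
  [/\ open_dom D, connected_dom D, D 1 /\ 1 != z0 & D z0] /\
  [/\ forall z, D z -> z != z0 -> z != 0,
      forall i z, D z -> z != z0 -> analytic_at (F i) z,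
      forall i, exists2 e : R, 0 < e &
        forall x : R, `|x - 1| < e -> F i x%:C = (f i x)%:C,
      forall i, analytic_at (h i) z0 /\ exists2 r : R, 0 < r &
        forall z, z != z0 -> cabs (z - z0) < r -> F i z = A i / (z - z0) + h i z &
      exists i, A i != 0].

(** The zeros on the real interval accumulate at [1], and the identity theorem spreads them over
    [D]. *)
Lemma germ_identity (D : C -> Prop) (F : C -> C) (e : R) :
  connected_dom D -> (forall z, D z -> analytic_at F z) -> D 1 -> 0 < e ->
  (forall x : R, `|x - 1| < e -> F x%:C = 0) ->
  forall p, D p -> exists2 s : R, 0 < s & forall z, cabs (z - p) < s -> F z = 0.
Proof.
move=> cD aF D1 e0 F0 p Dp.
have [[r r0 H]|[r r0 H]] := analytic_zeros (aF 1 D1); last first.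
  exfalso; pose x := 1 + Num.min r e / 2.
  have m0 : 0 < Num.min r e by rewrite lt_min r0.
  have mr : Num.min r e <= r by rewrite ge_min lexx.
  have me : Num.min r e <= e by rewrite ge_min lexx orbT.
  have x1 : x%:C - 1 = (Num.min r e / 2)%:C :> C by rewrite /x realCD addrC addKr.
  have xa : cabs (x%:C - 1 : C) = Num.min r e / 2 by rewrite x1 cabsC ger0_norm//; lra.
  have : F x%:C != 0.
    by apply: H; rewrite ?xa; [rewrite -subr_eq0 -cabs_gt0 xa|]; lra.
  rewrite F0 ?eqxx// /x addrC addKr ger0_norm; lra.
exact: (identity_theorem cD aF D1 r0 H).
Qed.

Lemma connected_punctured_dom (D : C -> Prop) (z0 : C) : open_dom D -> connected_dom D ->
  open_dom (fun z => D z /\ z != z0) /\ connected_dom (fun z => D z /\ z != z0).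
Proof.
move=> oD cD; split.
  move=> p [Dp pz]; have [r r0 H] := oD p Dp.
  have p0 : 0 < cabs (p - z0) by rewrite cabs_gt0 subr_eq0.
  exists (Num.min r (cabs (p - z0))); first by rewrite lt_min r0.
  move=> z; rewrite lt_min => /andP[/H zr zp]; split=> //.
  by apply: contraTneq zp => ->; rewrite cabsBC ltxx.
apply: (connected_remove_isolated cD) => [z []//|p Dp].
have [r r0 H] := oD p Dp; have [E|pz] := eqVneq p z0.
  by exists r => // z zp zr; split; [exact: H|rewrite -E].
have p0 : 0 < cabs (p - z0) by rewrite cabs_gt0 subr_eq0.
exists (Num.min r (cabs (p - z0))); first by rewrite lt_min r0.
move=> z _; rewrite lt_min => /andP[/H zr zp]; split=> //.
by apply: contraTneq zp => ->; rewrite cabsBC ltxx.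
Qed.

Lemma polar_nonconst (f : R -> R) (k : R) : polar (fun _ : unit => f) -> ~ germ_eq f (fun=> k).
Proof.
move=> [D [z0 [F [A [h [[oD cD [D1 z01] Dz0] [_ aF Ff FA [[] Ai]]]]]]]] [e e0 fk].
have [oD' cD'] := connected_punctured_dom z0 oD cD.
have [e1 e10 H1] := Ff tt.
have [ah [r r0 HA]] := FA tt.
have m0 : 0 < Num.min e e1 by rewrite lt_min e0.
have aG z : D z /\ z != z0 -> analytic_at (fun z => F tt z - k%:C) z.
  by move=> [Dz zz]; apply: analyticB (aF tt z Dz zz) (analytic_cst _ _).
have G0 x : `|x - 1| < Num.min e e1 -> F tt x%:C - k%:C = 0.
  by rewrite lt_min => /andP[xe xe1]; rewrite H1// fk// subrr.
have zero := germ_identity cD' aG (conj D1 z01) m0 G0.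
have [rD rD0 HD] := oD z0 Dz0.
(* [F tt] is constant near [z0], hence [A tt / (z - z0)] is bounded there *)
have e10' : 0 < 1 :> R by exact: ltr01.
have [rc rc0 Hc] := analytic_continuous ah e10'.
pose B := cabs k%:C + cabs (h tt z0) + 1.
have B0 : 0 <= B by have := cabs_ge0 (h tt z0); have := cabs_ge0 (k%:C : C); rewrite /B; lra.
have Ap : 0 < cabs (A tt) / 2 by rewrite divr_gt0// cabs_gt0.
have mm : 0 < Num.min (Num.min r rc) rD by rewrite !lt_min r0 rc0.
have [s [s0 sm Bs]] := small_radius B0 Ap mm.
move: sm; rewrite !le_min => /andP[/andP[sr sc] sD].
pose z := z0 + (s / 2)%:C.
have zE : z - z0 = (s / 2)%:C by rewrite /z addrC addKr.
have za : cabs (z - z0) = s / 2 by rewrite zE cabsC ger0_norm//; lra.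
have zz0 : z != z0 by rewrite -subr_eq0 -cabs_gt0 za; lra.
have Dz : D z by apply: HD; rewrite za; lra.
have [q q0 Hq] := zero z (conj Dz zz0).
have := Hq z; rewrite subrr cabs0 => /(_ q0) /eqP; rewrite subr_eq0 => /eqP Fk.
have := HA z zz0; rewrite za Fk => /(_ ltac:(lra)) E.
have AE : A tt = (z - z0) * (k%:C - h tt z) by rewrite E; field; rewrite subr_eq0.
have hz := Hc z; rewrite za in hz.
have : cabs (A tt) <= s / 2 * B.
  rewrite AE cabsM za ler_wpM2l//; first lra.
  apply: le_trans (cabsB _ _) _; have := hz ltac:(lra).
  have := cabsD (h tt z - h tt z0) (h tt z0); rewrite subrK /B; lra.
by move: Bs; lra.
Qed.

Lemma cderiv_shift (g : C -> C) (z0 z : C) : cderiv (fun w => g (z0 + w)) z = cderiv g (z0 + z).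
Proof.
rewrite /cderiv; congr (xget _ _).
apply/seteqP; split=> d /= H e e0; have [r r0 Hr] := H e e0; exists r => // w wr.
  have := Hr (w - z0); have -> : w - z0 - z = w - (z0 + z) by ring.
  have -> : z0 + (w - z0) = w by ring.
  exact.
have := Hr (z0 + w); have -> : z0 + w - (z0 + z) = w - z by ring.
exact.
Qed.

Lemma res_shift (g : C -> C) (z0 z : C) : res (fun w => g (z0 + w)) z = res g (z0 + z).
Proof.
by rewrite !resE cderiv_shift.
Qed.

(* The new pole is an isolated point [p] of the set near [z0] where some [f i]
   has a non-zero residue; at [p] the poles of the [f i] at other points cancel,
   and the new domain is the old one minus the singularities, plus a disc at
   [p]. *)
Lemma polar_step (I J : finType) (g : J -> R -> R) (f : I -> R -> R)
    (a : I -> J -> R) (w b : I -> R) :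
  polar g ->
  (forall i j, germ_eq (g i) (g j) -> i = j) ->
  (forall j k, ~ germ_eq (g j) (fun=> k)) ->
  (forall j, exists i, a i j != 0) ->
  (forall i, germ_eq (f i) (fun x => \sum_j a i j * sigma (g j x) + w i / x + b i)) ->
  polar f.
Proof.
move=> [D [z0 [G [A [h [[oD cD [D1 z01] Dz0] [Dn0 aG Gg GA [j0 Aj0]]]]]]]] gd gnc a0 fE.
have [oD0 cD0] := connected_punctured_dom z0 oD cD.
(* Relations near [z0] continue to the base point [1], where they can be compared with the
   hypotheses on the real germs [g]. *)
have lift (P : C -> C) : (forall z, D z /\ z != z0 -> analytic_at P z) ->
    (exists2 r : R, 0 < r & forall z, z != z0 -> cabs (z - z0) < r -> P z = 0) ->
    exists2 e : R, 0 < e & forall x : R, `|x - 1| < e -> P x%:C = 0.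
  move=> aP [r r0 P0]; have [rD rD0 HD] := oD z0 Dz0.
  have m0 : 0 < Num.min r rD by rewrite lt_min r0.
  have mr : Num.min r rD <= r by rewrite ge_min lexx.
  have mD : Num.min r rD <= rD by rewrite ge_min lexx orbT.
  pose z := z0 + (Num.min r rD / 2)%:C.
  have zE : z - z0 = (Num.min r rD / 2)%:C by rewrite /z addrC addKr.
  have za : cabs (z - z0) = Num.min r rD / 2 by rewrite zE cabsC ger0_norm//; lra.
  have zz0 : z != z0 by rewrite -subr_eq0 -cabs_gt0 za; lra.
  have Dz : D z by apply: HD; rewrite za; lra.
  have za0 : 0 < cabs (z - z0) by rewrite za; lra.
  have [s s0 Hs] := identity_theorem cD0 aP (conj Dz zz0) za0 (fun u uz => P0 u
    ltac:(by apply: contraTneq uz => ->; rewrite cabsBC ltxx)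
    ltac:(have := cabs_dist z u z0; lra)) (conj D1 z01).
  exists s => // x xs; apply: Hs.
  have -> : x%:C - 1 = (x - 1)%:C :> C by rewrite realCB.
  by rewrite cabsC.
have aGs j z : D z /\ z != z0 -> analytic_at (G j) z by move=> [Dz zz]; exact: aG.
have Gdist i j : (exists2 r : R, 0 < r & forall z, z != z0 -> cabs (z - z0) < r -> G i z = G j z) -> i = j.
  move=> [r r0 H]; apply: gd.
  have [||e e0 He] := lift (fun z => G i z - G j z).
  - by move=> z Dz; apply: analyticB; exact: aGs.
  - by exists r => // z z1 z2; rewrite H// subrr.
  have [e1 e10 H1] := Gg i; have [e2 e20 H2] := Gg j.
  exists (Num.min e (Num.min e1 e2)); first by rewrite !lt_min e0 e10.
  move=> x; rewrite !lt_min => /and3P[xe x1 x2]; apply: realC_inj.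
  rewrite -[LHS]/((g i x)%:C) -[RHS]/((g j x)%:C) -H1// -H2//.
  by have := He x xe => /eqP; rewrite subr_eq0 => /eqP.
have Gnc j k : ~ (exists2 r : R, 0 < r & forall z, z != z0 -> cabs (z - z0) < r -> G j z = k).
  move=> [r r0 H]; have [||e e0 He] := lift (fun z => G j z - k).
  - by move=> z Dz; apply: analyticB (aGs _ _ Dz) (analytic_cst _ _).
  - by exists r => // z z1 z2; rewrite H// subrr.
  have [e1 e10 H1] := Gg j; apply: (gnc j (Re k)).
  exists (Num.min e e1); first by rewrite lt_min e0.
  move=> x; rewrite lt_min => /andP[xe x1].
  have := He x xe => /eqP; rewrite subr_eq0 => /eqP; rewrite H1// => <-.
  by [].
have Greal i j (q : R) k :
    (exists2 r : R, 0 < r & forall z, z != z0 -> cabs (z - z0) < r -> G i z - q%:C * G j z = k) -> Im k = 0.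
  move=> [r r0 H]; have [||e e0 He] := lift (fun z => G i z - q%:C * G j z - k).
  - move=> z Dz; apply: analyticB (analytic_cst _ _).
    by apply: analyticB (aGs _ _ Dz) (analyticZ _ (aGs _ _ Dz)).
  - by exists r => // z z1 z2; rewrite H// subrr.
  have [e1 e10 H1] := Gg i; have [e2 e20 H2] := Gg j.
  have x1 (d : R) : 0 < d -> `|1 - 1 : R| < d by rewrite subrr normr0.
  have := He 1 (x1 _ e0) => /eqP; rewrite subr_eq0 => /eqP <-.
  by rewrite H1 ?x1// H2 ?x1// -realCM -realCB.
have GcritD j p : D p -> exists2 r : R, 0 < r & forall z, z != p -> cabs (z - p) < r ->
    [/\ D z, z != z0 & cderiv (G j) z != 0].
  move=> Dp; have [rD rD0 HD] := oD p Dp.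
  have [pz|pz] := eqVneq p z0; last first.
    have pz0 : 0 < cabs (p - z0) by rewrite cabs_gt0 subr_eq0.
    have nc : ~ (exists2 r : R, 0 < r & forall z, cabs (z - p) < r -> G j z = G j p).
      move=> [r r0 H]; apply: (Gnc j (G j p)).
      have aP z : D z /\ z != z0 -> analytic_at (fun z => G j z - G j p) z.
        by move=> Dz; apply: analyticB (aGs _ _ Dz) (analytic_cst _ _).
      have P0 z : cabs (z - p) < r -> G j z - G j p = 0 by move=> /H ->; rewrite subrr.
      have zero := identity_theorem cD0 aP (conj Dp pz) r0 P0.
      have [rz rz0 Hz] := oD z0 Dz0; exists rz => // z zz zr.
      have [q q0 Hq] := zero z (conj (Hz _ zr) zz).
      by have := Hq z; rewrite subrr cabs0 => /(_ q0)/eqP; rewrite subr_eq0 => /eqP.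
    have [r r0 H] := critical_isolated (aG j p Dp pz) nc.
    exists (Num.min (Num.min r rD) (cabs (p - z0))); first by rewrite !lt_min r0 rD0.
    move=> z zp; rewrite !lt_min => /andP[/andP[zr zD] zz]; split; [exact: HD| |exact: H].
    by apply: contraTneq zz => ->; rewrite cabsBC ltxx.
  have [ah [r r0 HA]] := GA j; rewrite -pz in ah HA.
  have dE z : z != p -> cabs (z - p) < r ->
      cderiv (G j) z = cderiv (fun u => A j / (u - p) + h j u) z.
    move=> zp zr; have q0 : 0 < Num.min (cabs (z - p)) (r - cabs (z - p)).
      by rewrite lt_min cabs_gt0 subr_eq0 zp subr_gt0.
    apply: (cderiv_eq q0) => u; rewrite lt_min => /andP[u1 u2]; apply: HA.
      by apply: contraTneq u1 => ->; rewrite cabsBC ltxx.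
    by apply: le_lt_trans (cabs_dist z _ _) _; lra.
  have [Aj|Aj] := eqVneq (A j) 0.
    have nc : ~ (exists2 q : R, 0 < q & forall z, cabs (z - p) < q -> h j z = h j p).
      move=> [q q0 H]; apply: (Gnc j (h j p)); exists (Num.min r q); first by rewrite lt_min r0.
      rewrite -pz => z zp; rewrite lt_min => /andP[zr zq].
      by rewrite HA// Aj mul0r add0r; exact: H.
    have [q q0 H] := critical_isolated ah nc.
    exists (Num.min (Num.min r rD) q); first by rewrite !lt_min r0 rD0.
    move=> z zp; rewrite !lt_min => /andP[/andP[zr zD] zq].
    split; [exact: HD|by rewrite -pz|].
    rewrite dE// (cderiv_eq (g := h j) ltr01) ?H// => u _.
    by rewrite Aj mul0r add0r.
  have abz : analytic_at (fun u => h j (p + u)) 0.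
    apply: (analytic_comp (f := fun u => p + u)); last by rewrite addr0.
    exact: analyticD (analytic_cst _ _) (analytic_id _).
  have Ap : 0 < cabs (A j) / 2 by rewrite divr_gt0// cabs_gt0.
  have [q q0 H] := pole_deriv_est (A j) abz Ap.
  exists (Num.min (Num.min r rD) q); first by rewrite !lt_min r0 rD0.
  move=> z zp; rewrite !lt_min => /andP[/andP[zr zD] zq].
  split; [exact: HD|by rewrite -pz|].
  have zp0 : z - p != 0 by rewrite subr_eq0.
  apply/eqP => d0; have := H _ zp0 zq.
  have -> : cderiv (fun w0 => A j / w0 + h j (p + w0)) (z - p) = cderiv (G j) z.
    rewrite dE// -[in RHS](subrK p z) [z - p + p]addrC.
    rewrite -(cderiv_shift (fun u => A j / (u - p) + h j u)); apply: (cderiv_eq ltr01) => u _.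
    by rewrite [p + u - p]addrC addKr.
  by rewrite d0 mulr0 add0r; lra.
have Gcrit p : D p -> exists2 r : R, 0 < r & forall z, z != p -> cabs (z - p) < r ->
    [/\ D z, z != z0 & forall j, cderiv (G j) z != 0].
  move=> Dp; have /choice[rr Hrr] : forall j, exists r : R, 0 < r /\
      forall z, z != p -> cabs (z - p) < r -> [/\ D z, z != z0 & cderiv (G j) z != 0].
    by move=> j; have [r r0 H] := GcritD j p Dp; exists r.
  have [r r0 Hr] := finite_lower (enum J) (fun j => (Hrr j).1).
  exists r => // z zp zr.
  have H j : [/\ D z, z != z0 & cderiv (G j) z != 0].
    by apply: (Hrr j).2 => //; apply: lt_le_trans zr _; apply: Hr; rewrite mem_enum.
  by have [] := H j0; split=> // j; have [] := H j.
(* Critical points are removed first because preimages are controlled only where the [G j] are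
   locally invertible. The regular ones return in [D'], which stays connected by density. *)
pose Nc z := [/\ D z, z != z0 & forall j, cderiv (G j) z != 0].
have cN : connected_dom Nc by apply: (connected_remove_isolated cD) => // z [].
have oN : open_dom Nc.
  move=> p [Dp pz dp]; have [r r0 Hr] := oD0 p (conj Dp pz).
  have /choice[rr Hrr] : forall j, exists r' : R, 0 < r' /\ forall z, cabs (z - p) < r' ->
      D z /\ z != z0 -> cderiv (G j) z != 0.
    move=> j; have dj : 0 < cabs (cderiv (G j) p) / 2 by rewrite divr_gt0// cabs_gt0.
    have [q q0 H] := cderiv_near (aG j p Dp pz) dj; exists q; split=> // z zq Dz.
    have := H z zq _ (analytic_cderiv (aGs j z Dz)); apply: contraTneq => ->.
    by rewrite sub0r cabsN -ltNge; lra.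
  have [q q0 Hq] := finite_lower (enum J) (fun j => (Hrr j).1).
  exists (Num.min r q); first by rewrite lt_min r0.
  move=> z; rewrite lt_min => /andP[zr zq]; have Dz := Hr z zr.
  split; [by case: Dz|by case: Dz|move=> j; apply: (Hrr j).2 => //].
  by apply: lt_le_trans zq _; apply: Hq; rewrite mem_enum.
have aN j z : Nc z -> analytic_at (G j) z by move=> [Dz zz _]; exact: aG.
have [_ cR dR] := connected_reg_family S_discrete (enum J) oN cN aN
  (fun j z (Nz : Nc z) => let: And3 _ _ H := Nz in H j).
pose D' z := (D z /\ z != z0) /\ forall j, reg S (G j z).
have oD' : open_dom D'.
  move=> p [Dp rp]; have [r r0 Hr] := oD0 p Dp.
  have /choice[rr Hrr] : forall j, exists r' : R, 0 < r' /\ forall z, cabs (z - p) < r' ->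
      reg S (G j z).
    move=> j; have [q q0 H] := reg_open (rp j).
    have [s s0 Hs] := analytic_continuous (aGs j p Dp) q0.
    by exists s; split=> // z /Hs/H.
  have [q q0 Hq] := finite_lower (enum J) (fun j => (Hrr j).1).
  exists (Num.min r q); first by rewrite lt_min r0.
  move=> z; rewrite lt_min => /andP[zr zq]; split; first exact: Hr.
  by move=> j; apply: (Hrr j).2; apply: lt_le_trans zq _; apply: Hq; rewrite mem_enum.
have D'1 : D' 1.
  split=> // j; have [e e0 He] := Gg j.
  have := He 1; rewrite subrr normr0 => /(_ e0) GE; rewrite [G j 1]GE; exact: (real_reg c_l1).
have cD' : connected_dom D'.
  apply: (connected_dense cR) => [z [[Dz zz _] H]|p r [[Dp pz] rp] r0].
    by split=> // j; apply: H; rewrite mem_enum.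
  have [r1 r10 H1] := Gcrit p Dp; have [r2 r20 H2] := oD' p (conj (conj Dp pz) rp).
  pose m := Num.min r (Num.min r1 r2).
  have m0 : 0 < m by rewrite !lt_min r0 r10.
  have [mr [m1 m2]] : m <= r /\ m <= r1 /\ m <= r2 by rewrite /m !ge_min !lexx !orbT.
  have hm : cabs ((m / 2)%:C : C) = m / 2 by rewrite cabsC ger0_norm//; lra.
  have zE : p + (m / 2)%:C - p = (m / 2)%:C by rewrite addrC addKr.
  exists (p + (m / 2)%:C); last by rewrite zE hm; lra.
  have zp : p + (m / 2)%:C != p by rewrite -subr_eq0 zE -cabs_gt0 hm; lra.
  split; first by apply: H1 => //; rewrite zE hm; lra.
  by move=> j _; have [|_ H] := H2 (p + (m / 2)%:C); [rewrite zE hm; lra|exact: H].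
have [rU rU0 HU] := Gcrit z0 Dz0.
have /choice[rA HrA] : forall j, exists r : R, 0 < r /\
    forall z, z != z0 -> cabs (z - z0) < r -> G j z = A j / (z - z0) + h j z.
  by move=> j; have [_ [r r0 H]] := GA j; exists r.
have [rB rB0 HrB] := finite_lower (enum J) (fun j => (HrA j).1).
pose al i z := \sum_j (a i j)%:C * res (G j) z.
(* The radius is at most the distance from [z0] to [1], so that the new pole differs from the base
   point. *)
have d10 : 0 < Num.min rU (cabs (1 - z0)) by rewrite lt_min rU0 cabs_gt0 subr_eq0.
have near0E (P : C -> Prop) : near0 (fun z => P (z0 + z)) ->
    exists2 r : R, 0 < r & forall z, z != z0 -> cabs (z - z0) < r -> P z.
  move=> [r r0 H]; exists r => // z zz zr; have := H (z - z0).
  by rewrite subr_eq0 [z0 + _]addrC subrK; apply.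
have [z1 [i1 [z10 z1d z1al]]] : exists z i,
    [/\ z != 0, cabs z < Num.min rU (cabs (1 - z0)) & al i (z0 + z) != 0].
  have [|||||z [i [zz zd zal]]] := @residue_point R S c S_sa c_neq0 c_l1 J
    (fun j z => G j (z0 + z)) A (fun j z => h j (z0 + z)) rB rB0 _ _ _ _ _ j0 Aj0 I a a0 _ d10.
  - move=> j z z0' zr; rewrite (HrA j).2.
    + by rewrite [z0 + z - z0]addrC addKr.
    + by rewrite -subr_eq0 addrC addKr.
    + by rewrite addrC addKr; apply: lt_le_trans zr _; apply: HrB; rewrite mem_enum.
  - move=> j; apply: (analytic_comp (f := fun u => z0 + u)).
      exact: analyticD (analytic_cst _ _) (analytic_id _).
    by rewrite addr0; case: (GA j).
  - by move=> i j H; apply: Gdist; apply: near0E (fun z => G i z = G j z) H.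
  - by move=> j k H; apply: (Gnc j k); apply: near0E (fun z => G j z = k) H.
  - by move=> i j q k H; apply: (Greal i j q); apply: near0E (fun z => G i z - q%:C * G j z = k) H.
  exists z, i; split=> //; apply: contra zal => /eqP E; apply/eqP; rewrite -[RHS]E.
  by apply: eq_bigr => j _; rewrite res_shift.
pose U z := z != z0 /\ cabs (z - z0) < Num.min rU (cabs (1 - z0)).
have UN z : U z -> Nc z by move=> [zz]; rewrite lt_min => /andP[zr _]; exact: HU.
have oU : open_dom U.
  move=> p [pz pr]; have q0 : 0 < Num.min (cabs (p - z0)) (Num.min rU (cabs (1 - z0)) - cabs (p - z0)).
    by rewrite lt_min cabs_gt0 subr_eq0 pz subr_gt0.
  exists (Num.min (cabs (p - z0)) (Num.min rU (cabs (1 - z0)) - cabs (p - z0))) => // z.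
  rewrite lt_min => /andP[u1 u2]; split.
    by apply: contraTneq u1 => ->; rewrite cabsBC ltxx.
  by apply: le_lt_trans (cabs_dist p _ _) _; lra.
(* For each [j] these poles are isolated from one another, but they may accumulate at poles of
   another [j], hence [isolated_in_union]. *)
pose At j z := [/\ U z, half (G j z) & S (Re (G j z))].
have iso j z : At j z -> exists2 r : R, 0 < r & forall u, At j u -> cabs (u - z) < r -> u = z.
  move=> [Uz hz Sz]; have Nz := UN z Uz; have [_ _ dz] := Nz.
  have [L [ri [L0 ri0 inj _]]] := inverse_function (aN j z Nz) (dz j).
  have [ds ds0 Hs] := S_isolated S_discrete Sz.
  have m0 : 0 < Num.min 1 ds by rewrite lt_min ltr01.
  have [rc rc0 Hc] := analytic_continuous (aN j z Nz) m0.
  exists (Num.min ri rc); first by rewrite lt_min ri0.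
  move=> u [Uu hu Su]; rewrite lt_min => /andP[ui uc].
  have := Hc u uc; rewrite lt_min => /andP[g1 gs].
  have E : G j u = G j z.
    apply: complex_eq.
      by apply: Hs => //; rewrite -ReB; apply: le_lt_trans (Re_le_cabs _) gs.
    by apply: half_discrete => //; rewrite -ImB; apply: le_lt_trans (Im_le_cabs _) g1.
  apply/eqP; rewrite -subr_eq0 -cabs_eq0; apply/eqP/le_anti; rewrite cabs_ge0 andbT.
  have := inj u z ui; rewrite E [G j z - _]subrr cabs0 mulr0; apply.
  by rewrite subrr cabs0.
have [|||p [Up Xp [rX rX0 HX]]] := isolated_in_union (s := enum J) iso (U := U)
    (X := fun z => U z /\ exists i, al i z != 0).
- exact: oU.
- move=> z Uz [_ [k alk]]; apply: contrapT => none; move/eqP: alk; apply.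
  apply: big1 => j _; rewrite resE; have [->|/ct_half[hz Sz]] := eqVneq (ct S c (G j z)) 0.
    by rewrite mul0r mulr0.
  by exfalso; apply: none; exists j; rewrite ?mem_enum.
- exists (z0 + z1); last split; last by exists i1.
    by split; [rewrite -subr_eq0|]; rewrite addrC addKr.
  by split; [rewrite -subr_eq0|]; rewrite addrC addKr.
have [_ [i2 al2]] := Xp.
have Np := UN p Up; have [Dp pz dp] := Np.
have [rO rO0 HO] := oU p Up.
have /choice[RL HRL] : forall j, exists R0 : R, 0 < R0 /\ forall r0 : R, 0 < r0 -> r0 <= R0 ->
    exists k (r : R), [/\ analytic_at k p, 0 < r &
      forall z, cabs (z - p) < r -> reg S (G j z) ->
        is_sum (fun x => (pi%:C)^-1 * (if cabs (x - p) < r0 then res (G j) x else 0) / (z - x))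
          (sigC (G j z) - k z)].
  by move=> j; have [R0 R00 H] := local_expansion C0 c_l1 (aN j p Np) (dp j); exists R0.
have [rL rL0 HrL] := finite_lower (enum J) (fun j => (HRL j).1).
(* Within [rr] of [p] no other point has a non-zero combined residue, so the sums of principal parts
   collapse to the term at [p]. *)
pose rr := Num.min (Num.min rX rL) rO.
have rr0 : 0 < rr by rewrite !lt_min rX0 rL0.
have rrX : rr <= rX by rewrite !ge_min lexx.
have rrL : rr <= rL by rewrite !ge_min lexx orbT.
have rrO : rr <= rO by rewrite !ge_min lexx orbT.
have /choice[kk Hkk] : forall j, exists kr : (C -> C) * R, [/\ analytic_at kr.1 p, 0 < kr.2 &
      forall z, cabs (z - p) < kr.2 -> reg S (G j z) ->
        is_sum (fun x => (pi%:C)^-1 * (if cabs (x - p) < rr then res (G j) x else 0) / (z - x))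
          (sigC (G j z) - kr.1 z)].
  move=> j; have rj : rr <= RL j by apply: le_trans rrL _; apply: HrL; rewrite mem_enum.
  by have [k [r H]] := (HRL j).2 rr rr0 rj; exists (k, r).
have kk0 j : 0 < (kk j).2 by have [] := Hkk j.
have [rk rk0 Hrk] := finite_lower (enum J) kk0.
pose form i z := \sum_j (a i j)%:C * sigC (G j z) + (w i)%:C / z + (b i)%:C.
pose H i z := \sum_j (a i j)%:C * (kk j).1 z + (w i)%:C / z + (b i)%:C.
pose B i := (pi%:C)^-1 * al i p.
have p0 : p != 0 by exact: Dn0.
have expand i z : cabs (z - p) < rk -> (forall j, reg S (G j z)) ->
    form i z = B i / (z - p) + H i z.
  move=> zr rz.
  have s1 : is_sum (fun x => \sum_j (a i j)%:C *
      ((pi%:C)^-1 * (if cabs (x - p) < rr then res (G j) x else 0) / (z - x)))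
      (\sum_j (a i j)%:C * (sigC (G j z) - (kk j).1 z)).
    apply: is_sum_bigfin => j; apply: is_sumZ; have [_ _ Hj] := Hkk j; apply: Hj => //.
    by apply: lt_le_trans zr _; apply: Hrk; rewrite mem_enum.
  have sE x : \sum_j (a i j)%:C *
      ((pi%:C)^-1 * (if cabs (x - p) < rr then res (G j) x else 0) / (z - x)) =
      if cabs (x - p) < rr then (pi%:C)^-1 * al i x / (z - x) else 0.
    case: ifP => xr; last by apply: big1 => j _; rewrite mulr0 mul0r mulr0.
    by rewrite /al mulr_sumr mulr_suml; apply: eq_bigr => j _; rewrite mulrA mulrCA mulrA.
  have := is_sum_eq sE s1 => s2.
  have s3 := @is_sum_point R C (fun x => if cabs (x - p) < rr then (pi%:C)^-1 * al i x / (z - x) else 0) p _.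
  have E := is_sum_unique s2 (s3 _).
  rewrite subrr cabs0 rr0 in E; rewrite /form /B -E; last first.
    move=> x xp; case: ifP => // xr; have [->|alx] := eqVneq (al i x) 0.
      by rewrite mulr0 mul0r.
    have Ux : U x by apply: HO; lra.
    by move: xp; rewrite (HX x) ?eqxx//; [split=> //; exists i|lra].
  rewrite /H; under [in RHS]eq_bigr do rewrite mulrBr.
  by rewrite sumrB; ring.
have aH i : analytic_at (H i) p.
  apply: analyticD (analytic_cst _ _); apply: analyticD.
    by apply: analytic_sum => j; apply: analyticZ; have [] := Hkk j.
  by apply: analyticZ; apply: analytic_inv p0; exact: analytic_id.
have /choice[rh Hrh] : forall i, exists r : R, 0 < r /\ forall z, cabs (z - p) < r -> analytic_at (H i) z.
  by move=> i; have [r r0 K] := analytic_nearby (aH i); exists r.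
have [rH rH0 HrH] := finite_lower (enum I) (fun i => (Hrh i).1).
pose q := Num.min (Num.min rk rH) rO.
have q0 : 0 < q by rewrite !lt_min rk0 rH0.
have qk : q <= rk by rewrite !ge_min lexx.
have qH : q <= rH by rewrite !ge_min lexx orbT.
have qO : q <= rO by rewrite !ge_min lexx orbT.
pose D2 z := D' z \/ cabs (z - p) < q.
(* Inside the disc, single terms of [form] may be singular at points whose combined residue is zero;
   the cancelled expansion takes over there, and [expand] gives agreement on the overlap. *)
pose F2 i z := if cabs (z - p) < q then B i / (z - p) + H i z else form i z.
have F2D' i z : D' z -> F2 i z = form i z.
  by move=> [_ rz]; rewrite /F2; case: ifP => // zq; rewrite expand//; lra.
have ball_open z : cabs (z - p) < q -> forall u, cabs (u - z) < q - cabs (z - p) -> cabs (u - p) < q.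
  by move=> zq u uz; apply: le_lt_trans (cabs_dist z _ _) _; lra.
exists D2, p, F2, B, H; split; [split|split].
- move=> z [D'z|zq].
    by have [r r0 Hr] := oD' z D'z; exists r => // u /Hr; left.
  by exists (q - cabs (z - p)); [rewrite subr_gt0|move=> u /(ball_open z zq); right].
- have [u [Nu ru] uq] := dR p q Np q0.
  apply: (connected_union (z := u) cD' (@connected_ball _ p q)) => //.
  by have [Du uz _] := Nu; split=> // j; apply: ru; rewrite mem_enum.
- split; first by left.
  have [_] := Up; rewrite lt_min => /andP[_]; apply: contraTneq => <-.
  by rewrite ltxx.
- by right; rewrite subrr cabs0.
- move=> z [[[Dz zz] _]|zq] zp; first exact: Dn0.
  have [Dz zz _] := UN z (HO z (lt_le_trans zq qO)); exact: Dn0.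
- move=> i z D2z zp; have [zq|zq] := ltP (cabs (z - p)) q.
    have dq : 0 < q - cabs (z - p) by rewrite subr_gt0.
    apply: (analytic_near_eq (f := fun z => B i / (z - p) + H i z) _ dq).
      apply: analyticD.
        apply: analyticZ; apply: analytic_inv; last by rewrite subr_eq0.
        exact: analyticB (analytic_id _) (analytic_cst _ _).
      apply: (Hrh i).2; apply: lt_le_trans zq _; apply: le_trans qH _.
      by apply: HrH; rewrite mem_enum.
    by move=> u /(ball_open z zq) uq; rewrite /F2 uq.
  have D'z : D' z by case: D2z => //; rewrite ltNge zq.
  have [r r0 Hr] := oD' z D'z; have [[Dz zz] rz] := D'z.
  apply: (analytic_near_eq (f := form i) _ r0); last by move=> u /Hr/F2D' ->.
  apply: analyticD (analytic_cst _ _); apply: analyticD.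
    apply: analytic_sum => j; apply: analyticZ; apply: analytic_comp (aG j z Dz zz) _.
    exact: sigC_analytic.
  by apply: analyticZ; apply: analytic_inv (Dn0 z Dz zz); exact: analytic_id.
- move=> i; have [e e0 He] := fE i; have [r r0 Hr] := oD' 1 D'1.
  have /choice[eg Heg] : forall j, exists e : R, 0 < e /\
      forall x : R, `|x - 1| < e -> G j x%:C = (g j x)%:C.
    by move=> j; have [e' e'0 H'] := Gg j; exists e'.
  have [d d0 Hd] := finite_lower (enum J) (fun j => (Heg j).1).
  exists (Num.min (Num.min e r) d); first by rewrite !lt_min e0 r0.
  move=> x; rewrite !lt_min => /andP[/andP[xe xr] xd].
  have x1 : cabs (x%:C - 1 : C) < r.
    have -> : x%:C - 1 = (x - 1)%:C :> C by rewrite realCB.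
    by rewrite cabsC.
  rewrite F2D'; last exact: Hr.
  rewrite He// /form !realCD realC_sum realCM realCV; congr (_ + _ + _).
  apply: eq_bigr => j _; rewrite (Heg j).2; last first.
    by apply: lt_le_trans xd _; apply: Hd; rewrite mem_enum.
  by rewrite sigC_real// realCM.
- move=> i; split; first exact: aH.
  by exists q => // z _ zq; rewrite /F2 zq.
- by exists i2; apply: mulf_neq0 al2; rewrite invr_eq0 realC_eq0 gt_eqF// pi_gt0.
Qed.

(** The start of the induction: the domain is the whole plane and the pole is [0]. *)
Lemma polar_affine (I : finType) (f : I -> R -> R) (w b : I -> R) (i0 : I) :
  w i0 != 0 -> (forall i, germ_eq (f i) (fun x => w i / x + b i)) -> polar f.
Proof.
move=> wi fE.
exists (fun=> True), 0, (fun i z => (w i)%:C / z + (b i)%:C), (fun i => (w i)%:C),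
  (fun i _ => (b i)%:C); split; [split|split] => //.
- by move=> p _; exists 1.
- by apply: connected_convex.
- move=> i z _ z0; apply: analyticD (analytic_cst _ _).
  by apply: analyticZ; apply: analytic_inv z0; exact: analytic_id.
- move=> i; have [e e0 H] := fE i; exists e => // x xe.
  by rewrite H// realCD realCM realCV.
- move=> i; split; first exact: analytic_cst.
  by exists 1 => // z _ _; rewrite subr0.
- by exists i0; rewrite realC_eq0.
Qed.

End Polar.

(** * Linear independence of the activations of a network *)

Section Network.
Variables (R : realType) (C0 : R) (S : set R) (c : R -> R).
Hypotheses (S_discrete : discrete_subset S) (S_sa : self_avoiding S)
  (c_neq0 : forall s, S s -> c s != 0) (c_l1 : summable S (fun s => (c s)%:E)).
Local Notation sigma := (tanh_series C0 S c).

Lemma germ_eq_sym (f g : R -> R) : germ_eq f g -> germ_eq g f.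
Proof. by move=> [e e0 H]; exists e => // x /H. Qed.

Lemma germ_eq_trans (f g h : R -> R) : germ_eq f g -> germ_eq g h -> germ_eq f h.
Proof.
move=> [e e0 H] [d d0 K]; exists (Num.min e d); first by rewrite lt_min e0.
by move=> x; rewrite lt_min => /andP[xe xd]; rewrite H// K.
Qed.

Lemma germ_eq_fin (I : finType) (f g : I -> R -> R) : (forall i, germ_eq (f i) (g i)) ->
  exists2 e : R, 0 < e & forall i x, `|x - 1| < e -> f i x = g i x.
Proof.
move=> H; have /choice[e He] : forall i, exists e : R, 0 < e /\
    forall x, `|x - 1| < e -> f i x = g i x.
  by move=> i; have [e e0 K] := H i; exists e.
have [d d0 Hd] := finite_lower (enum I) (fun i => (He i).1).
exists d => // i x xd; apply: (He i).2; apply: lt_le_trans xd _; apply: Hd.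
by rewrite mem_enum.
Qed.

(* The non-input nodes of several networks, [net v] being the network of [v],
   fed by inputs proportional to [1 / x]: [w v] collects the weights of the
   edges from the inputs to [v], [A v u] is the weight of the edge from [u] to
   [v], and [pre v] is the argument of the nonlinearity at [v]. *)
Variables (V : finType) (net : V -> bool) (lev : V -> nat) (A : V -> V -> R).
Variables (w b : V -> R) (pre : V -> R -> R).
Hypotheses (A_net : forall v u, A v u != 0 -> net u = net v)
  (A_lev : forall v u, A v u != 0 -> (lev u < lev v)%N)
  (preE : forall v, germ_eq (pre v)
     (fun x => \sum_u A v u * sigma (pre u x) + w v / x + b v))
  (driven : forall v, w v = 0 -> exists u, A v u != 0)
  (no_clones : forall v v', net v = net v' -> (forall u, A v u = A v' u) ->
     w v = w v' -> b v = b v' -> v = v').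

Definition eqv (u u' : V) : bool := `[< germ_eq (pre u) (pre u') >].

Lemma eqv_refl u : eqv u u.
Proof. by apply/asboolP; exists 1. Qed.

Lemma eqv_sym u u' : eqv u u' = eqv u' u.
Proof. by apply/asboolP/asboolP; exact: germ_eq_sym. Qed.

Lemma eqv_trans u v t : eqv u v -> eqv v t -> eqv u t.
Proof. by move=> /asboolP uv /asboolP vt; apply/asboolP; exact: germ_eq_trans uv vt. Qed.

Lemma eqv_left u v t : eqv u v -> eqv u t = eqv v t.
Proof.
move=> uv; apply/idP/idP; apply: eqv_trans => //; by rewrite eqv_sym.
Qed.

(** A canonical representative: the predicate given to [pick] is the same for all members of a
    class, hence so is the choice. *)
Definition rep (n : nat) (u : V) : V := odflt u [pick u' | (lev u' < n)%N && eqv u u'].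

Lemma repP n u : (lev u < n)%N -> (lev (rep n u) < n)%N && eqv u (rep n u).
Proof.
by move=> un; rewrite /rep; case: pickP => //= /(_ u); rewrite un eqv_refl.
Qed.

Lemma rep_eqv n u u' : (lev u < n)%N -> eqv u u' -> rep n u = rep n u'.
Proof.
move=> un uu'; rewrite /rep.
have E : (fun t => (lev t < n)%N && eqv u t) =1 (fun t => (lev t < n)%N && eqv u' t).
  by move=> t; rewrite (eqv_left _ uu').
rewrite (eq_pick E); case: pickP => //= /(_ u).
by rewrite un eqv_sym uu'.
Qed.

Definition polar_below (n : nat) : Prop := forall (I : finType) (v : I -> V),
  (exists i : I, true) -> (forall i, (lev (v i) < n)%N) -> polar (fun i => pre (v i)).

Definition distinct_below (n : nat) : Prop := forall u u', (lev u < n)%N -> (lev u' < n)%N ->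
  net u = net u' -> eqv u u' -> u = u'.

(** Below level [n], a class contains at most one node of each network, so nothing can cancel the
    coefficient of [u]. *)
Lemma class_sum n (a : V -> R) (u : V) : distinct_below n ->
  (forall u', a u' != 0 -> (lev u' < n)%N /\ net u' = net u) -> (lev u < n)%N ->
  \sum_(u' | rep n u' == rep n u) a u' = a u.
Proof.
move=> dn an un; rewrite (bigD1 u) ?eqxx//= big1 ?addr0// => u' /andP[/eqP E u'u].
apply/eqP; apply: contraNT u'u => /an[u'n nu]; apply/eqP; apply: (dn) => //.
have /andP[_ e1] := repP u'n; have /andP[_ e2] := repP un.
by apply: eqv_trans e1 _; rewrite E eqv_sym.
Qed.

(** [polar_step] wants pairwise distinct germs, each of them in use: nodes with the same germ are
    merged into their representative, and classes on which every total vanishes are dropped. If no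
    class remains, the germs are affine in [1 / x]. *)
Lemma polar_combination n (I : finType) (a : I -> V -> R) (w' b' : I -> R)
    (f : I -> R -> R) (i0 : I) : polar_below n ->
  (forall i u, a i u != 0 -> (lev u < n)%N) ->
  (forall i, germ_eq (f i) (fun x => \sum_u a i u * sigma (pre u x) + w' i / x + b' i)) ->
  w' i0 != 0 \/ (exists r, \sum_(u | rep n u == r) a i0 u != 0) -> polar f.
Proof.
move=> Pn an fE i0P.
pose A' i r := \sum_(u | rep n u == r) a i u.
pose Q (r : V) := [exists i, A' i r != 0].
have supp i r : A' i r != 0 -> exists2 u, (lev u < n)%N & rep n u = r.
  move=> Ar; apply: contrapT => none; move/eqP: Ar; apply.
  apply: big1 => u /eqP ur; apply/eqP; apply: contrapT => /negP/an un.
  by apply: none; exists u.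
have QP r : Q r -> exists2 u, (lev u < n)%N & rep n u = r.
  by move=> /existsP[i /supp].
have Qn r : Q r -> (lev r < n)%N.
  by move=> /QP[u un <-]; have /andP[] := repP un.
have [e1 e10 He1] := germ_eq_fin fE.
have grp : exists2 e : R, 0 < e & forall u x, `|x - 1| < e -> (lev u < n)%N ->
    pre u x = pre (rep n u) x.
  have [|e e0 He] := @germ_eq_fin V (fun u => if (lev u < n)%N then pre u else 0)
     (fun u => if (lev u < n)%N then pre (rep n u) else 0).
    move=> u; case: ifP => un; last by exists 1.
    by have /andP[_ /asboolP] := repP un.
  by exists e => // u x xe un; have := He u x xe; rewrite un.
have [e2 e20 He2] := grp.
have m0 : 0 < Num.min e1 e2 by rewrite lt_min e10.
have sumE i x : `|x - 1| < e2 ->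
    \sum_u a i u * sigma (pre u x) = \sum_(r | Q r) A' i r * sigma (pre r x).
  move=> xe; transitivity (\sum_u a i u * sigma (pre (rep n u) x)).
    apply: eq_bigr => u _; have [->|/an un] := eqVneq (a i u) 0; first by rewrite !mul0r.
    by rewrite (He2 u).
  rewrite (partition_big (rep n) predT)//= [RHS]big_mkcond/=; apply: eq_bigr => r _.
  transitivity (A' i r * sigma (pre r x)).
    by rewrite mulr_suml; apply: eq_bigr => u /eqP ->.
  case: ifPn => // nQ; suff -> : A' i r = 0 by rewrite mul0r.
  by apply/eqP; apply: contraNT nQ => Ar; apply/existsP; exists i.
have [/existsP[r Qr]|/existsPn noQ] := boolP [exists r, Q r]; last first.
  apply: (@polar_affine R I f w' b' i0) => [|i].
    case: i0P => // -[r Ar]; have := noQ r; rewrite /Q negb_exists => /forallP/(_ i0).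
    by rewrite Ar.
  exists (Num.min e1 e2) => // x; rewrite lt_min => /andP[x1 x2].
  by rewrite He1// sumE// big_pred0 ?add0r// => r; apply/negbTE/noQ.
pose J := {r : V | Q r}.
apply: (@polar_step R C0 S c S_discrete S_sa c_neq0 c_l1 I J (fun j => pre (val j)) f
  (fun i j => A' i (val j)) w' b').
- by apply: Pn => [|j]; [exists (exist _ r Qr)|apply: Qn; exact: (valP j)].
- move=> j k jk; apply/val_inj.
  have [u un uj] := QP _ (valP j); have [u' u'n uk] := QP _ (valP k).
  rewrite -uj -uk; apply: rep_eqv => //.
  have /andP[_ e3] := repP un; have /andP[_ e4] := repP u'n.
  apply: eqv_trans e3 _; rewrite uj eqv_sym; apply: eqv_trans e4 _; rewrite uk.
  by rewrite eqv_sym; apply/asboolP.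
- move=> j k; apply: polar_nonconst; apply: (Pn unit (fun=> val j)) => [|_].
    by exists tt.
  exact: Qn (valP j).
- by move=> j; have /existsP := valP j.
move=> i; exists (Num.min e1 e2) => // x; rewrite lt_min => /andP[x1 x2].
rewrite He1// sumE//; congr (_ + _ + _).
rewrite (reindex_omap (fun j : J => val j) insub)/=; last first.
  by move=> t Qt; rewrite insubT.
by apply: eq_bigl => j; rewrite (valP j) valK eqxx.
Qed.

(** Otherwise the constant germ [0] would be polar. *)
Lemma combination_eq0 n (a : V -> R) (w' b' : R) : polar_below n ->
  (forall u, a u != 0 -> (lev u < n)%N) ->
  germ_eq (fun=> 0) (fun x => \sum_u a u * sigma (pre u x) + w' / x + b') ->
  w' = 0 /\ forall r, \sum_(u | rep n u == r) a u = 0.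
Proof.
move=> Pn an E.
suff : ~ (w' != 0 \/ exists r, \sum_(u | rep n u == r) a u != 0).
  move=> H; split; first by apply/eqP; apply: contrapT => /negP w0; apply: H; left.
  by move=> r; apply/eqP; apply: contrapT => /negP w0; apply: H; right; exists r.
move=> H.
have := @polar_combination n unit (fun=> a) (fun=> w') (fun=> b') (fun _ _ => 0) tt Pn
  (fun=> an) (fun=> E) H.
by move/(@polar_nonconst R (fun=> 0) 0); apply; exists 1.
Qed.

Lemma germ_diff v v' : eqv v v' -> germ_eq (fun=> 0) (fun x =>
  \sum_u (A v u - A v' u) * sigma (pre u x) + (w v - w v') / x + (b v - b v')).
Proof.
move=> /asboolP[e e0 H]; have [e1 e10 H1] := preE v; have [e2 e20 H2] := preE v'.
exists (Num.min e (Num.min e1 e2)); first by rewrite !lt_min e0 e10.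
move=> x; rewrite !lt_min => /and3P[xe x1 x2].
have := H x xe; rewrite H1// H2// => /eqP; rewrite -subr_eq0 => /eqP E; rewrite -[LHS]E.
under [in RHS]eq_bigr do rewrite mulrBl.
by rewrite sumrB mulrBl; ring.
Qed.

(** The two properties need each other. Distinctness below [n] prevents cancellation between
    parents, which makes the next level polar; polarity below [n] gives the independence that
    recovers the incoming weights of two nodes with equal germs, and [no_clones] then identifies
    them. *)
Lemma polar_distinct_below n : polar_below n /\ distinct_below n.
Proof.
elim: n => [|n [Pn Dn]]; first by split=> [I v [i _] /(_ i)|u u'].
have An v u : (lev v < n.+1)%N -> A v u != 0 -> (lev u < n)%N.
  by rewrite ltnS => vn /A_lev uv; exact: leq_trans uv vn.
split=> [I v [i0 _] vn|v v' vn v'n nv vv'].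
  apply: (@polar_combination n I (fun i => A (v i)) (fun i => w (v i)) (fun i => b (v i)) _ i0) => //.
    by move=> i u; exact: An.
  have [w0|] := eqVneq (w (v i0)) 0; last by left.
  have [u Au] := driven w0; right; exists (rep n u); rewrite class_sum//.
    move=> u' Au'; split; first exact: An Au'.
    by rewrite (A_net Au') (A_net Au).
  exact: An Au.
pose a u := A v u - A v' u.
have aP u : a u != 0 -> (lev u < n)%N /\ net u = net v.
  move=> au; have [Au|Au] := eqVneq (A v u) 0; last by split; [exact: An Au|exact: A_net].
  have Au' : A v' u != 0 by apply: contra au; rewrite /a Au sub0r oppr_eq0.
  by rewrite nv; split; [exact: An Au'|exact: A_net].
have [/eqP w0 r0] := combination_eq0 Pn (fun u au => (aP u au).1) (germ_diff vv').
have a0 u : A v u = A v' u.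
  apply/eqP; rewrite -subr_eq0 -/(a u); apply: contrapT => /negP au; have [un nu] := aP u au.
  move/eqP: au; apply; rewrite -(r0 (rep n u)) class_sum// => u' /aP[]; rewrite nu.
  by [].
apply: no_clones => //; first by apply/eqP; rewrite -subr_eq0.
(* Weights and slopes being equal, the value at [x = 1] compares the biases. *)
have [e e0 /(_ 1)] := germ_diff vv'; rewrite subrr normr0 => /(_ e0)/esym.
rewrite big1 ?add0r; last by move=> u _; rewrite a0 subrr mul0r.
by rewrite (eqP w0) mul0r add0r => /eqP; rewrite subr_eq0 => /eqP.
Qed.

Let top := (\max_u lev u).+1.

Lemma lev_top u : (lev u < top)%N.
Proof. by rewrite ltnS; exact: leq_bigmax. Qed.

Lemma node_germ_inj v v' : net v = net v' -> eqv v v' -> v = v'.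
Proof. by have [_ D] := polar_distinct_below top; apply: D; exact: lev_top. Qed.

Lemma eqv_rep u u' : (rep top u == rep top u') = eqv u u'.
Proof.
apply/eqP/idP => [E|]; last by apply: rep_eqv; exact: lev_top.
have /andP[_ e1] := repP (lev_top u); have /andP[_ e2] := repP (lev_top u').
by apply: eqv_trans e1 _; rewrite E eqv_sym.
Qed.

Lemma independent (a : V -> R) (w' b' : R) :
  germ_eq (fun=> 0) (fun x => \sum_u a u * sigma (pre u x) + w' / x + b') ->
  w' = 0 /\ forall u, \sum_(u' | eqv u' u) a u' = 0.
Proof.
move=> E; have [P _] := polar_distinct_below top.
have [w0 H] := combination_eq0 P (fun u _ => lev_top u) E; split=> // u.
by rewrite -[RHS](H (rep top u)); apply: eq_bigl => u'; rewrite eqv_rep.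
Qed.

(** Independence applied to the difference of the indicators of [v] and [v']; [sigma] itself need
    not be injective. *)
Lemma activation_inj v v' :
  germ_eq (fun x => sigma (pre v x)) (fun x => sigma (pre v' x)) -> eqv v v'.
Proof.
move=> [e e0 H]; apply: contrapT => /negP nvv'.
have [|_ /(_ v)] := @independent (fun u => (u == v)%:R - (u == v')%:R) 0 0.
  exists e => // x xe; rewrite mul0r !addr0; under eq_bigr do rewrite mulrBl.
  rewrite sumrB (bigD1 v)//= big1; last by move=> u /negPf ->; rewrite mul0r.
  rewrite [X in _ - X](bigD1 v')//= [X in _ - (_ + X)]big1; last first.
    by move=> u /negPf ->; rewrite mul0r.
  by rewrite !eqxx !mul1r !addr0 H// subrr.
rewrite (bigD1 v) ?eqv_refl//= big1; last first.
  move=> u /andP[uv nu]; rewrite (negPf nu).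
  have [E|_] := eqVneq u v'; last by rewrite subr0.
  by rewrite -E eqv_sym uv in nvv'.
rewrite eqxx addr0; have [E|_] := eqVneq v v'; first by rewrite -E eqv_refl in nvv'.
by rewrite subr0 => /eqP; rewrite oner_eq0.
Qed.

Lemma class_weight v u : A v u != 0 -> \sum_(u' | eqv u' u) A v u' = A v u.
Proof.
move=> Au; rewrite (bigD1 u) ?eqv_refl//= big1 ?addr0// => u' /andP[E u'u].
apply/eqP; apply: contraNT u'u => Au'; apply/eqP; apply: node_germ_inj => //.
by rewrite (A_net Au) (A_net Au').
Qed.

Lemma germ_slope v v' : eqv v v' -> w v = w v'.
Proof.
by move=> /germ_diff/independent[/eqP w0 _]; apply/eqP; rewrite -subr_eq0.
Qed.

(** For each class of germs the total weights into [v] and [v'] agree, and each network has at most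
    one node in a class, so these totals are single weights. *)
Lemma germ_parent v v' u : eqv v v' -> A v u != 0 ->
  exists2 u', A v' u' = A v u & eqv u u'.
Proof.
move=> /germ_diff/independent[_ /(_ u)]; rewrite sumrB => /eqP; rewrite subr_eq0 => /eqP E Au.
rewrite class_weight// in E.
have [/existsP[u' /andP[uu' Au']]|/existsPn none] := boolP [exists u', eqv u' u && (A v' u' != 0)].
  exists u'; last by rewrite eqv_sym.
  rewrite E -(class_weight Au'); apply: eq_bigl => t.
  by rewrite ![eqv t _]eqv_sym (eqv_left _ uu').
exfalso; move/eqP: Au; apply; rewrite E; apply: big1 => u' uu'.
by have := none u'; rewrite uu' negbK => /eqP.
Qed.

Lemma germ_bias v v' : eqv v v' -> b v = b v'.
Proof.
move=> vv'; have [e e0 /(_ 1)] := germ_diff vv'; rewrite subrr normr0 => /(_ e0)/esym.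
rewrite (germ_slope vv') subrr mul0r addr0.
suff -> : \sum_u (A v u - A v' u) * sigma (pre u 1) = 0.
  by rewrite add0r => /eqP; rewrite subr_eq0 => /eqP.
have [_ H] := independent (germ_diff vv').
rewrite (partition_big (rep top) predT)//= big1// => r _.
have [/existsP[u /eqP ur]|/existsPn none] := boolP [exists u, rep top u == r]; last first.
  by rewrite big_pred0// => u; apply/negbTE/none.
transitivity (\sum_(u' | eqv u' u) (A v u' - A v' u') * sigma (pre u 1)); last first.
  by rewrite -mulr_suml H mul0r.
apply: eq_big => [u'|u']; first by rewrite -ur eqv_rep.
rewrite -ur eqv_rep => /asboolP[d d0 /(_ 1)]; rewrite subrr normr0 => /(_ d0) ->.
by [].
Qed.

End Network.

(** * Comparison of two networks *)

(** Avoids finitely many hyperplanes, one coordinate at a time: the new coordinate [y] exceeds the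
    modulus of every value at which a form involving it vanishes. *)
Lemma generic_direction (R : realType) (K : finType) (T : eqType) (s : seq T)
    (q : K -> T -> R) : uniq s ->
  exists d : T -> R, forall k, \sum_(u <- s) q k u * d u = 0 ->
    forall u, u \in s -> q k u = 0.
Proof.
elim: s => [|x s IH] /=; first by exists (fun=> 0).
move=> /andP[xs /IH[d Hd]].
pose z k := (\sum_(u <- s) q k u * d u) / q k x.
pose y := 1 + \sum_k `|z k|.
have yz k : `|z k| < y.
  rewrite /y (bigD1 k)//= addrCA ltrDl ltr_pwDl// sumr_ge0//.
exists (fun u => if u == x then y else d u) => k; rewrite big_cons eqxx.
have -> : \sum_(u <- s) q k u * (if u == x then y else d u) = \sum_(u <- s) q k u * d u.
  rewrite !big_seq; apply: eq_bigr => u us; case: eqP => // ux.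
  by rewrite -ux us in xs.
have [q0|q0] := eqVneq (q k x) 0.
  rewrite q0 mul0r add0r => /Hd H u; rewrite inE => /predU1P[->//|]; exact: H.
move=> E; exfalso; have yE : y = - z k.
  apply: (mulfI q0); rewrite mulrN /z mulrCA mulfV// mulr1.
  by apply/eqP; rewrite -addr_eq0 E.
by have := yz k; rewrite yE -normrN ltNge ler_norm.
Qed.

Section Comparison.
Variables (R : realType) (T : choiceType) (N : bool -> gfnn R T) (Vi Vo : {fset T}).
Variables (C0 : R) (S : set R) (c : R -> R).
Local Notation sigma := (tanh_series C0 S c).
Hypotheses (S_discrete : discrete_subset S) (S_sa : self_avoiding S)
  (c_neq0 : forall s, S s -> c s != 0) (c_l1 : summable S (fun s => (c s)%:E)).
Hypotheses (VinE : forall s, Vin (N s) = Vi) (VoutE : forall s, Vout (N s) = Vo)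
  (nd : forall s, non_degenerate (N s)) (cf : forall s, clones_free (N s))
  (eq_map : forall t w, w \in Vo ->
     node_map (N true) sigma t w = node_map (N false) sigma t w).

Definition hidden (s : bool) : {fset T} := (nodes (N s) `\` Vi)%fset.

(** As weights on edges are non-zero, this one function encodes both the edges and their weights. *)
Definition wt (s : bool) (v u : T) : R := if edge (N s) u v then weight (N s) v u else 0.

Definition all_nodes : {fset bool * T} :=
  [fset p in [seq (true, v) | v <- hidden true] ++ [seq (false, v) | v <- hidden false]]%fset.

Lemma all_nodesE (p : bool * T) : (p \in all_nodes) = (p.2 \in hidden p.1).
Proof.
rewrite !inE /=; case: p => s v /=; apply/orP/idP.
  by move=> [|] /mapP[u]; rewrite in_fsetD => uh [-> ->].
by case: s => vh; [left|right]; apply: map_f; rewrite in_fsetD.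
Qed.

Lemma edge_nodes s u v : edge (N s) u v -> u \in nodes (N s) /\ v \in nodes (N s).
Proof. exact: (edges_sub (gfnnP (N s))). Qed.

Lemma parE s u v : (u \in par (N s) v) = edge (N s) u v.
Proof.
rewrite !inE /=; apply/andP/idP => [[]//|uv]; split=> //.
by have [] := edge_nodes uv.
Qed.

Lemma edge_hidden s u v : edge (N s) u v -> v \in hidden s.
Proof.
move=> uv; have [_ vN] := edge_nodes uv.
rewrite in_fsetD vN andbT -(VinE s) !inE vN /=; apply/eqP => p0.
by have := parE s u v; rewrite p0 uv inE.
Qed.

Lemma wt_neq0 s v u : (wt s v u != 0) = edge (N s) u v.
Proof.
rewrite /wt; case: ifP => uv; last by rewrite eqxx.
exact: (weight_neq0 (gfnnP (N s))).
Qed.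

Lemma level_edge s u v : edge (N s) u v -> (level (N s) u < level (N s) v)%N.
Proof.
move=> uv; have [_ vN] := edge_nodes uv; have up : u \in par (N s) v by rewrite parE.
rewrite (levelE vN); case: eqP => [p0|_]; first by rewrite p0 inE in up.
by rewrite ltnS; apply: leq_bigmax_seq.
Qed.

Lemma par_sum s v (X : T -> R) : \sum_(u <- par (N s) v) weight (N s) v u * X u =
  \sum_(u <- Vi) wt s v u * X u + \sum_(u <- hidden s) wt s v u * X u.
Proof.
have -> : \sum_(u <- par (N s) v) weight (N s) v u * X u =
    \sum_(u <- nodes (N s)) wt s v u * X u.
  rewrite -big_fset_condE/= big_mkcond; apply: eq_bigr => u _; rewrite /wt.
  by case: ifP; rewrite ?mul0r.
rewrite (big_fsetID _ (mem Vi))/=; congr (_ + _); apply: eq_fbigl => u.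
  rewrite !inE /=; apply: andb_idl; rewrite -(VinE s) !inE => /andP[//].
by rewrite !inE /= andbC.
Qed.

Variable d : T -> R.
Hypothesis d_generic : forall s v s' v', v \in hidden s -> v' \in hidden s' ->
  \sum_(u <- Vi) wt s v u * d u = \sum_(u <- Vi) wt s' v' u * d u ->
  forall u, u \in Vi -> wt s v u = wt s' v' u.
Hypothesis d_nonzero : forall s v, v \in hidden s ->
  \sum_(u <- Vi) wt s v u * d u = 0 -> forall u, u \in Vi -> wt s v u = 0.

(* The inputs run along the line spanned by a generic [d], parametrised by [1 / x]. *)
Definition input (x : R) (u : T) : R := d u / x.

Definition slope (s : bool) (v : T) : R := \sum_(u <- Vi) wt s v u * d u.

Definition preact (s : bool) (v : T) (x : R) : R :=
  \sum_(u <- par (N s) v) weight (N s) v u * node_map (N s) sigma (input x) u + bias (N s) v.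

Lemma node_map_hidden s v x : v \in hidden s ->
  node_map (N s) sigma (input x) v = sigma (preact s v x).
Proof. by rewrite /hidden -(VinE s) => vh; rewrite node_mapE. Qed.

Lemma preactE s v x : preact s v x =
  \sum_(u <- hidden s) wt s v u * sigma (preact s u x) + slope s v / x + bias (N s) v.
Proof.
rewrite /preact par_sum addrC [in RHS]addrC; congr (_ + _); rewrite addrC; congr (_ + _).
  by rewrite !big_seq; apply: eq_bigr => u uh; rewrite node_map_hidden.
rewrite /slope mulr_suml !big_seq; apply: eq_bigr => u uV.
by rewrite node_map_in ?VinE// /input mulrA.
Qed.

Local Notation V := (all_nodes : finType).

Definition net (p : V) : bool := (val p).1.
Definition nd_of (p : V) : T := (val p).2.
Definition adj (p r : V) : R := if net r == net p then wt (net p) (nd_of p) (nd_of r) else 0.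
Definition pre (p : V) : R -> R := preact (net p) (nd_of p).

Lemma node_ex s v : v \in hidden s -> exists p : V, net p = s /\ nd_of p = v.
Proof.
move=> vh; have h : (s, v) \in all_nodes by rewrite all_nodesE.
by exists [` h]%fset.
Qed.

Lemma nd_hidden (p : V) : nd_of p \in hidden (net p).
Proof. by rewrite -all_nodesE; exact: valP. Qed.

Lemma node_inj (p r : V) : net p = net r -> nd_of p = nd_of r -> p = r.
Proof.
rewrite /net /nd_of => h1 h2; apply/val_inj.
by move: h1 h2; case: (val p) (val r) => a e [a' e'] /= -> ->.
Qed.

Lemma hidden_sum s (Y : T -> R) : \sum_(u <- hidden s) Y u =
  \sum_(p : V) (if net p == s then Y (nd_of p) else 0).
Proof.
transitivity (\sum_(p <- all_nodes) (if p.1 == s then Y p.2 else 0)); last first.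
  by rewrite big_seq_fsetE.
rewrite -big_mkcond -big_filter.
have E : perm_eq [seq p <- all_nodes | p.1 == s] [seq (s, u) | u <- hidden s].
  apply: uniq_perm; first by rewrite filter_uniq// fset_uniq.
    by rewrite map_inj_uniq// => u u' [].
  move=> [s' u]; rewrite mem_filter all_nodesE /=; apply/andP/mapP => [[/eqP -> uh]|[u' uh [-> ->]]].
    by exists u.
  by [].
by rewrite (perm_big _ E) big_map.
Qed.

Lemma adj_net p r : adj p r != 0 -> net r = net p.
Proof.
rewrite /adj; case: (net r =P net p) => // ?.
by rewrite eqxx.
Qed.

Lemma adj_edge p r : net r = net p -> (adj p r != 0) = edge (N (net p)) (nd_of r) (nd_of p).
Proof. by move=> E; rewrite /adj E eqxx wt_neq0. Qed.

Lemma adj_lev p r : adj p r != 0 ->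
  (level (N (net r)) (nd_of r) < level (N (net p)) (nd_of p))%N.
Proof.
by move=> a0; have E := adj_net a0; move: a0; rewrite adj_edge// E; exact: level_edge.
Qed.

Lemma preE p : germ_eq (pre p) (fun x => \sum_r adj p r * sigma (pre r x) +
  slope (net p) (nd_of p) / x + bias (N (net p)) (nd_of p)).
Proof.
exists 1 => // x _; rewrite /pre preactE hidden_sum; congr (_ + _ + _).
by apply: eq_bigr => r _; rewrite /adj; case: eqP => [->//|_]; rewrite mul0r.
Qed.

(** By genericity a zero slope means that no edge comes from an input; a non-input node has a
    parent, which is then hidden. *)
Lemma driven p : slope (net p) (nd_of p) = 0 -> exists r, adj p r != 0.
Proof.
move=> s0; have ph := nd_hidden p.
have [u uv] : exists u, edge (N (net p)) u (nd_of p).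
  move: ph; rewrite in_fsetD -(VinE (net p)) => /andP[]; rewrite !inE => nV pN.
  move: nV; rewrite pN /= => /fset0Pn[u]; rewrite parE; by exists u.
have uh : u \in hidden (net p).
  have [uN _] := edge_nodes uv; rewrite in_fsetD uN andbT; apply/negP => uV.
  by have := wt_neq0 (net p) (nd_of p) u; rewrite uv (d_nonzero ph s0)// eqxx.
by have [r [rn ru]] := node_ex uh; exists r; rewrite adj_edge// ru.
Qed.

Lemma no_clones p r : net p = net r -> (forall u, adj p u = adj r u) ->
  slope (net p) (nd_of p) = slope (net r) (nd_of r) ->
  bias (N (net p)) (nd_of p) = bias (N (net r)) (nd_of r) -> p = r.
Proof.
move=> En Ea Es Eb; apply: (node_inj En); apply/eqP; apply: contrapT => /negP npr.
have [hp hr] := (nd_hidden p, nd_hidden r).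
have Ew u : wt (net p) (nd_of p) u = wt (net p) (nd_of r) u.
  have [uV|uV] := boolP (u \in Vi); first by rewrite [in RHS]En; exact: d_generic.
  have [uN|uN] := boolP (u \in nodes (N (net p))); last first.
    rewrite /wt; do 2?[case: ifP => [/edge_nodes[uN']|_]; first by rewrite uN' in uN].
    by [].
  have /node_ex[q [qn qu]] : u \in hidden (net p) by rewrite in_fsetD uV.
  by have := Ea q; rewrite /adj -En qn eqxx qu.
have Ee u : edge (N (net p)) u (nd_of p) = edge (N (net p)) u (nd_of r).
  by rewrite -!wt_neq0 Ew.
apply: (@cf (net p) (nd_of p) (nd_of r)); split; split=> //.
- by rewrite VinE.
- by rewrite VinE {1}En.
- by apply/fsetP => u; rewrite !parE Ee.
- by rewrite Eb En.
move=> u; rewrite parE => uv; have := Ew u.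
by rewrite /wt -Ee uv.
Qed.

Lemma pre_inj p r : net p = net r -> eqv pre p r -> p = r.
Proof.
exact: (node_germ_inj S_discrete S_sa c_neq0 c_l1 adj_net adj_lev preE driven no_clones).
Qed.

Lemma pre_parent p r q : eqv pre p r -> adj p q != 0 ->
  exists2 q', adj r q' = adj p q & eqv pre q q'.
Proof.
exact: (germ_parent S_discrete S_sa c_neq0 c_l1 adj_net adj_lev preE driven no_clones).
Qed.

Lemma pre_slope p r : eqv pre p r -> slope (net p) (nd_of p) = slope (net r) (nd_of r).
Proof.
exact: (germ_slope S_discrete S_sa c_neq0 c_l1 adj_net adj_lev preE driven no_clones).
Qed.

Lemma pre_bias p r : eqv pre p r ->
  bias (N (net p)) (nd_of p) = bias (N (net r)) (nd_of r).
Proof.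
exact: (germ_bias S_discrete S_sa c_neq0 c_l1 adj_net adj_lev preE driven no_clones).
Qed.

Lemma out_hidden s v : v \in Vo -> v \in hidden s.
Proof.
move=> vo; have := Vout_sub (gfnnP (N s)); rewrite VinE => /fsubsetP; apply.
by rewrite VoutE.
Qed.

Lemma out_eqv p r : nd_of p = nd_of r -> nd_of p \in Vo -> eqv pre p r.
Proof.
move=> E po.
apply: (activation_inj S_discrete S_sa c_neq0 c_l1 adj_net adj_lev preE driven no_clones).
exists 1 => // x _; rewrite /pre -!node_map_hidden ?nd_hidden// -E.
by case: (net p) (net r) => -[]//; rewrite eq_map.
Qed.

(** Induction on a path from [p] to an output. Outputs match by equality of the network maps, and a
    match passes from a node to its parents by [pre_parent]. *)
Lemma matched p : exists2 r, net r = ~~ net p & eqv pre p r.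
Proof.
have [pN _] : nd_of p \in nodes (N (net p)) /\ true.
  by have := nd_hidden p; rewrite in_fsetD => /andP[].
have [s + sl] := nd pN.
elim: s p pN sl => [|y s IH] p pN /=.
  rewrite VoutE => po _; have [r [rn ru]] := node_ex (out_hidden (~~ net p) po).
  by exists r => //; apply: out_eqv.
move=> sl /andP[py ys].
have [p' [p'n p'y]] := node_ex (edge_hidden py).
have [|||r rn e] := IH p'; rewrite ?p'n ?p'y//; first by have [] := edge_nodes py.
have a0 : adj p' p != 0 by rewrite adj_edge p'n ?p'y.
have [q qa pq] := pre_parent e a0; exists q => //.
have qa0 : adj r q != 0 by rewrite qa.
by rewrite (adj_net qa0) rn p'n.
Qed.

Lemma comparison : exists f : T -> T,
  [/\ set_bij [set` nodes (N true)] [set` nodes (N false)] f,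
      {in Vi, forall v, f v = v},
      (forall u v, u \in nodes (N true) -> v \in nodes (N true) ->
         wt false (f v) (f u) = wt true v u),
      (forall v, v \in hidden true -> bias (N false) (f v) = bias (N true) v) &
      {in Vo, forall v, f v = v}].
Proof.
(* A hidden node goes to the node of the other network with the same germ; everything else is
   fixed. *)
have /choice[f Hf] : forall v, exists v', (v \notin hidden true -> v' = v) /\
    forall p, net p = true -> nd_of p = v -> exists r, [/\ net r = false, nd_of r = v' & eqv pre p r].
  move=> v; have [vh|vh] := boolP (v \in hidden true); last first.
    exists v; split=> // p pn pv; have := nd_hidden p.
    by rewrite pn pv (negPf vh).
  have [p [pn pv]] := node_ex vh; have [r rn pr] := matched p.
  exists (nd_of r); split=> // p' p'n p'v; exists r; split=> //; first by rewrite rn pn.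
  by have -> : p' = p by apply: node_inj; rewrite ?pn ?pv.
have fV v : v \in Vi -> f v = v by move=> vV; apply: (Hf v).1; rewrite in_fsetD vV.
have Vnodes s v : v \in Vi -> v \in nodes (N s) by rewrite -(VinE s) !inE => /andP[].
have nodesP s v : v \in nodes (N s) -> v \in Vi \/ exists p, net p = s /\ nd_of p = v.
  move=> vN; have [vV|vV] := boolP (v \in Vi); first by left.
  by right; apply: node_ex; rewrite in_fsetD vV.
have pnodes p : nd_of p \in nodes (N (net p)).
  by have := nd_hidden p; rewrite in_fsetD => /andP[].
have pV p : nd_of p \notin Vi by have := nd_hidden p; rewrite in_fsetD => /andP[].
exists f; split=> //.
- split.
  + move=> v /= /nodesP[vV|[p [pn pv]]]; first by rewrite fV//; exact: Vnodes.
    by have [r [rn <- _]] := (Hf v).2 p pn pv; rewrite -rn; exact: pnodes.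
  + move=> u v; rewrite !inE => /nodesP[uV|[p [pn pu]]] /nodesP[vV|[q [qn qv]]].
    * by rewrite !fV.
    * have [r [rn rv _]] := (Hf v).2 q qn qv; rewrite (fV u)// -rv => E.
      by have := pV r; rewrite -E uV.
    * have [r [rn ru _]] := (Hf u).2 p pn pu; rewrite (fV v)// -ru => E.
      by have := pV r; rewrite E vV.
    have [r [rn ru er]] := (Hf u).2 p pn pu; have [t [tn tv et]] := (Hf v).2 q qn qv.
    rewrite -ru -tv => E; have rt : r = t by apply: node_inj => //; rewrite rn tn.
    suff -> : u = v by [].
    rewrite -pu -qv; congr nd_of; apply: pre_inj; first by rewrite pn qn.
    by apply: eqv_trans er _; rewrite rt eqv_sym.
  + move=> v /= /nodesP[vV|[r [rn rv]]].
      by exists v; [exact: Vnodes|rewrite fV].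
    have [p pn rp] := matched r; rewrite rn /= in pn.
    exists (nd_of p); first by rewrite /= -pn; exact: pnodes.
    have [t [tn <- et]] := (Hf (nd_of p)).2 p pn erefl; rewrite -rv; congr nd_of.
    apply: pre_inj; first by rewrite tn rn.
    by rewrite eqv_sym; apply: eqv_trans rp _.
- move=> u v uN /nodesP[vV|[p [pn pv]]].
    rewrite fV// /wt; do 2?[case: ifP => [/edge_hidden|_]; first by rewrite in_fsetD vV].
    by [].
  have [r [rn rv er]] := (Hf v).2 p pn pv.
  have [uV|[q [qn qu]]] := nodesP _ _ uN.
    rewrite (fV u)// -rv -rn -pv -pn; apply: d_generic => //; try exact: nd_hidden.
    by apply/esym; exact: pre_slope.
  have [t [tn tu et]] := (Hf u).2 q qn qu.
  have adjp x : net x = true -> adj p x = wt true v (nd_of x).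
    by move=> xn; rewrite /adj xn pn eqxx pv.
  have adjr x : net x = false -> adj r x = wt false (f v) (nd_of x).
    by move=> xn; rewrite /adj xn rn eqxx rv.
  rewrite -tu -qu -adjp// -adjr//.
  have [pq0|pq0] := eqVneq (adj p q) 0; last first.
    have [t' at' qt'] := pre_parent er pq0; rewrite -at'; congr adj.
    have at0 : adj r t' != 0 by rewrite at'.
    apply: pre_inj; first by rewrite tn (adj_net at0).
    by apply: eqv_trans qt'; rewrite eqv_sym.
  (* An edge between the images would, by the matching in the other direction, produce an edge
     between the originals. *)
  rewrite pq0; apply/eqP; apply: contrapT => /negP rt0.
  have rp : eqv pre r p by rewrite eqv_sym.
  have [q' aq' tq'] := pre_parent rp rt0.
  have aq0 : adj p q' != 0 by rewrite aq'.
  have qq' : q = q'.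
    apply: pre_inj; first by rewrite qn (adj_net aq0).
    exact: eqv_trans et tq'.
  by move: rt0; rewrite -aq' -qq' pq0 eqxx.
- move=> v vh; have [p [pn pv]] := node_ex vh; have [r [rn rv er]] := (Hf v).2 p pn pv.
  by rewrite -rv -rn -pv -pn; apply/esym; exact: pre_bias.
- move=> v vo; have [p [pn pv]] := node_ex (out_hidden true vo).
  have [r [rn rv er]] := (Hf v).2 p pn pv.
  have [q [qn qv]] := node_ex (out_hidden false vo).
  rewrite -rv -[RHS]qv; congr nd_of; apply: pre_inj; first by rewrite rn qn.
  have pq : eqv pre p q by apply: out_eqv; rewrite ?pv ?qv.
  by apply: eqv_trans pq; rewrite eqv_sym.
Qed.

End Comparison.

Theorem theorem3 (R : realType) (T : choiceType) (N1 N2 : lfnn R T)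
    (C : R) (S : set R) (c : R -> R)
    (nd1 : non_degenerate N1) (nd2 : non_degenerate N2)
    (cf1 : clones_free N1) (cf2 : clones_free N2)
    (eq_in : Vin N1 = Vin N2) (eq_out : Vout N1 = Vout N2)
    (S_discrete : discrete_subset S) (S_self_avoiding : self_avoiding S)
    (c_neq0 : forall s, S s -> c s != 0)
    (c_l1 : summable S (fun s => (c s)%:E))
    (eq_map : forall (t : T -> R) (w : T), w \in Vout N1 ->
       node_map N1 (tanh_series C S c) t w = node_map N2 (tanh_series C S c) t w) :
  faithfully_isomorphic N1 N2.
Proof.
pose N (s : bool) : gfnn R T := if s then N1 else N2.
have VinE s : Vin (N s) = Vin N1 by case: s.
have VoutE s : Vout (N s) = Vout N1 by case: s.
have nd s : non_degenerate (N s) by case: s.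
have cf s : clones_free (N s) by case: s.
pose K : finType := all_nodes N (Vin N1).
pose wk (k : K) u := wt N (val k).1 (val k).2 u.
(* The forms of pairs separate the input weights of different nodes; those with [None] detect nodes
   that have an input parent. *)
pose q (k : K * option K) u := wk k.1 u - (if k.2 is Some k' then wk k' u else 0).
have [d Hd] := generic_direction q (fset_uniq (Vin N1)).
have node s v : v \in hidden N (Vin N1) s -> exists k : K, forall u, wk k u = wt N s v u.
  move=> vh; have h : (s, v) \in all_nodes N (Vin N1) by rewrite all_nodesE.
  by exists [` h]%fset.
have d_generic s v s' v' : v \in hidden N (Vin N1) s -> v' \in hidden N (Vin N1) s' ->
    \sum_(u <- Vin N1) wt N s v u * d u = \sum_(u <- Vin N1) wt N s' v' u * d u ->
    forall u, u \in Vin N1 -> wt N s v u = wt N s' v' u.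
  move=> /node[k Hk] /node[k' Hk'] E u uV; have := Hd (k, Some k') _ u uV.
  rewrite /q /= Hk Hk' => H; apply/eqP; rewrite -subr_eq0; apply/eqP/H.
  by under eq_bigr do rewrite Hk Hk' mulrBl; rewrite sumrB E subrr.
have d_nonzero s v : v \in hidden N (Vin N1) s -> \sum_(u <- Vin N1) wt N s v u * d u = 0 ->
    forall u, u \in Vin N1 -> wt N s v u = 0.
  move=> /node[k Hk] E u uV; have := Hd (k, None) _ u uV.
  rewrite /q /= Hk subr0; apply; rewrite -[RHS]E.
  by apply: eq_bigr => u' _; rewrite Hk subr0.
have [f [fbij fV fw fb fo]] := comparison S_discrete S_self_avoiding c_neq0 c_l1
  VinE VoutE nd cf eq_map d_generic d_nonzero.
split=> //; exists f => //; split=> //.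
- by apply/fsetP => v; rewrite -eq_out; apply/imfsetP/idP => /= [[u uo ->]|vo];
    [rewrite fo|exists v => //; rewrite fo].
- split=> [u v uN vN|u v uv].
    by rewrite -(wt_neq0 N true) -(wt_neq0 N false) fw.
  have [uN vN] := edges_sub (gfnnP N1) uv.
  have := fw u v uN vN; rewrite /wt /= uv; case: ifP => // _ E.
  by have := weight_neq0 (gfnnP N1) uv; rewrite -E eqxx.
Qed.
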